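(* Let $n\ge 2$. Every non-selfinjective Nakayama algebra with $n$ simple modules (up to isomorphism) has dominant dimension at most $2n-2$. This bound is optimal for every $n\ge 2$: there exists a non-selfinjective Nakayama algebra with $n$ simple modules, with dominant dimension equal to $2n-2$, and with exactly $n-1$ injective-projective indecomposable modules (up to isomorphism).
   Context: Standing assumptions: $K$ is an arbitrary field; algebras are finite-dimensional connected $K$-algebras given by quiver and relations, i.e. of the form $KQ/I$ with $Q$ a finite quiver and $I$ an admissible ideal. Modules are finitely generated right modules. An algebra $A$ is selfinjective if the right regular module $A$ is injective. A Nakayama algebra is an algebra such that every indecomposable projective left or right module is uniserial. Dominant dimension: let $0\to A\to I_0\to I_1\to I_2\to\cdots$ be a minimal injective coresolution of the right regular module $A$. If $I_0$ is not projective, $\operatorname{domdim}(A):=0$; otherwise $\operatorname{domdim}(A):=\sup\{m\mid I_i \text{ is projective for } i=0,1,\dots,m\}+1$ (possibly $\infty$). *)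

(* Defs.v *)
From HB Require Import structures.
From mathcomp Require Import all_boot all_algebra all_field.
From mathcomp Require Import finmap.
From mathcomp Require Import boolp classical_sets.
From mathcomp.multinomials Require Import monalg.

Set Implicit Arguments.
Unset Strict Implicit.
Unset Printing Implicit Defensive.

Import GRing.Theory.

Local Open Scope fset_scope.
Local Open Scope ring_scope.

Record quiver := Quiver {
  vertex : finType;
  arrow : finType;
  src : arrow -> vertex;
  tgt : arrow -> vertex }.

Section Paths.
Variable Q : quiver.

Fixpoint is_path (x : vertex Q) (s : seq (arrow Q)) : bool :=
  if s is a :: s' then (src a == x) && is_path (tgt a) s' else true.

(* A path is its starting vertex together with its list of arrows, in the
   order in which they are traversed; [(x, [::])] is the trivial path at [x]. *)
Definition qpath : Type :=
  {u : vertex Q * seq (arrow Q) | is_path u.1 u.2}.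

HB.instance Definition _ := Choice.on qpath.

Definition path_src (p : qpath) : vertex Q := (val p).1.
Definition path_arrows (p : qpath) : seq (arrow Q) := (val p).2.
Definition path_tgt (p : qpath) : vertex Q :=
  last (path_src p) (map (@tgt Q) (path_arrows p)).

Definition trivial_path (x : vertex Q) : qpath := Sub (x, [::]) isT.

(* [p] followed by [q]; [None] if they cannot be composed. *)
Definition path_comp (p q : qpath) : option qpath :=
  if path_tgt p == path_src q
  then (insub (path_src p, path_arrows p ++ path_arrows q) : option qpath)
  else None.

Lemma is_path_cat x (s t : seq (arrow Q)) :
  is_path x (s ++ t) =
  is_path x s && is_path (last x (map (@tgt Q) s)) t.
Proof. by elim: s x => //= a s IH x; rewrite IH andbA. Qed.

Lemma path_compP (p q : qpath) :
  if path_tgt p == path_src q then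
    exists r : qpath, [/\ path_comp p q = Some r, path_src r = path_src p,
      path_tgt r = path_tgt q & path_arrows r = path_arrows p ++ path_arrows q]
  else path_comp p q = None.
Proof.
rewrite /path_comp; case: eqP => // e.
case: insubP => [r _ er|].
  exists r; rewrite /path_tgt /path_src /path_arrows er; split => //=.
  rewrite map_cat last_cat; congr (last _ _); exact: e.
rewrite /= is_path_cat; have := valP p; rewrite /path_src /path_arrows => -> /=.
by move: e; rewrite /path_tgt /path_src /path_arrows => ->; have := valP q => ->.
Qed.

Lemma qpath_eq (p q : qpath) :
  path_src p = path_src q -> path_arrows p = path_arrows q -> p = q.
Proof.
rewrite /path_src /path_arrows => e1 e2; apply: val_inj.
by case: (val p) (val q) e1 e2 => [? ?] [? ?] /= -> ->.
Qed.

Lemma path_compA (p q r : qpath) :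
  obind (path_comp p) (path_comp q r) = obind (path_comp^~ r) (path_comp p q).
Proof.
have := path_compP q r; have := path_compP p q.
case: eqP => [e1 [u [-> us ut ua]]|n1 e1];
  case: eqP => [e2 [v [-> vs vt va]]|n2 e2] /=.
- have := path_compP u r; rewrite ut e2 eqxx => -[x [-> xs _ xa]].
  have := path_compP p v; rewrite vs e1 eqxx => -[y [-> ys _ ya]].
  by congr Some; apply: qpath_eq; rewrite ?xs ?ys ?us // xa ya ua va catA.
- by rewrite e2 /=; have := path_compP u r; rewrite ut; case: eqP n2.
- by rewrite e1 /=; have := path_compP p v; rewrite vs; case: eqP n1.
- by rewrite e1 e2.
Qed.

Lemma trivial_comp x (p : qpath) :
  path_comp (trivial_path x) p = if path_src p == x then Some p else None.
Proof.
have := path_compP (trivial_path x) p.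
rewrite (_ : path_tgt _ = x) // (_ : path_src (trivial_path x) = x) //.
rewrite eq_sym; case: eqP => [e [r [-> rs _ ra]]|_ ->] //.
by congr Some; apply: qpath_eq; rewrite ?rs ?e.
Qed.

Lemma comp_trivial x (p : qpath) :
  path_comp p (trivial_path x) = if path_tgt p == x then Some p else None.
Proof.
have := path_compP p (trivial_path x); rewrite (_ : path_src (trivial_path x) = x) //.
case: eqP => [e [r [-> rs _ ra]]|_ ->] //.
by congr Some; apply: qpath_eq; rewrite ?rs // ra cats0.
Qed.

End Paths.

(* The path algebra KQ: the K-vector space on the paths of Q (a finitely
   supported family of coefficients), multiplied by concatenating paths. *)
Definition pathalg (K : fieldType) (Q : quiver) : Type := {malg K[qpath Q]}.

Section PathAlgebra.
Variables (K : fieldType) (Q : quiver).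

HB.instance Definition _ := GRing.Lmodule.on (pathalg K Q).

Implicit Types f g h : pathalg K Q.

Definition pathalg_basis (c : K) (o : option (qpath Q)) : pathalg K Q :=
  if o is Some p then << c *g p >> else 0.

Definition pathalg_one : pathalg K Q :=
  \sum_(x : vertex Q) pathalg_basis 1 (Some (trivial_path x)).

Definition pathalg_mul f g : pathalg K Q :=
  \sum_(p <- msupp f) \sum_(q <- msupp g)
    pathalg_basis (f@_p * g@_q) (path_comp p q).

Lemma pathalg_basis0 o : pathalg_basis 0 o = 0.
Proof. by case: o => //= p; rewrite monalgU0. Qed.

Lemma pathalg_basisD c d o :
  pathalg_basis (c + d) o = pathalg_basis c o + pathalg_basis d o.
Proof. by case: o => [p|] /=; rewrite ?addr0 // monalgUD. Qed.

Lemma pathalg_mulw (d1 d2 : {fset qpath Q}) f g :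
  msupp f `<=` d1 -> msupp g `<=` d2 ->
  pathalg_mul f g = \sum_(p <- d1) \sum_(q <- d2)
    pathalg_basis (f@_p * g@_q) (path_comp p q).
Proof.
move=> le1 le2; rewrite /pathalg_mul (big_fset_incl _ le1) /=.
  apply/eq_bigr => p _; apply/big_fset_incl => // q _ /mcoeff_outdom ->.
  by rewrite mulr0 pathalg_basis0.
move=> p _ /mcoeff_outdom e.
by rewrite big1 // => q _; rewrite e mul0r pathalg_basis0.
Qed.

Lemma pathalg_mul0l : left_zero 0 pathalg_mul.
Proof. by move=> g; rewrite /pathalg_mul msupp0 big_seq_fset0. Qed.

Lemma pathalg_mul0r : right_zero 0 pathalg_mul.
Proof.
move=> g; rewrite /pathalg_mul big1 // => p _.
by rewrite msupp0 big_seq_fset0.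
Qed.

Lemma pathalg_mulDl : left_distributive pathalg_mul +%R.
Proof.
move=> f g h.
rewrite (pathalg_mulw (msuppD_le f g) (fsubset_refl (msupp h))).
rewrite (pathalg_mulw (fsubsetUl (msupp f) (msupp g)) (fsubset_refl (msupp h))).
rewrite (pathalg_mulw (fsubsetUr (msupp f) (msupp g)) (fsubset_refl (msupp h))).
rewrite -big_split /=; apply/eq_bigr => p _.
rewrite -big_split /=; apply/eq_bigr => q _.
by rewrite mcoeffD mulrDl pathalg_basisD.
Qed.

Lemma pathalg_mulDr : right_distributive pathalg_mul +%R.
Proof.
move=> h f g.
rewrite (pathalg_mulw (fsubset_refl (msupp h)) (msuppD_le f g)).
rewrite (pathalg_mulw (fsubset_refl (msupp h)) (fsubsetUl (msupp f) (msupp g))).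
rewrite (pathalg_mulw (fsubset_refl (msupp h)) (fsubsetUr (msupp f) (msupp g))).
rewrite -big_split /=; apply/eq_bigr => p _.
rewrite -big_split /=; apply/eq_bigr => q _.
by rewrite mcoeffD mulrDr pathalg_basisD.
Qed.

Lemma pathalg_basisM c d o o' :
  pathalg_mul (pathalg_basis c o) (pathalg_basis d o') =
  pathalg_basis (c * d) (obind (fun p => obind (path_comp p) o') o).
Proof.
case: o => [p|] /=; last by rewrite pathalg_mul0l.
case: o' => [q|] /=; last by rewrite pathalg_mul0r.
by rewrite (pathalg_mulw msuppU_le msuppU_le) !big_seq_fset1 !mcoeffUU.
Qed.

Lemma pathalgE f : f = \sum_(p <- msupp f) pathalg_basis f@_p (Some p).
Proof. exact: monalgE. Qed.

Lemma pathalg_mul_suml I (s : seq I) (F : I -> pathalg K Q) g :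
  pathalg_mul (\sum_(i <- s) F i) g = \sum_(i <- s) pathalg_mul (F i) g.
Proof.
exact: (big_morph (pathalg_mul^~ g) (fun _ _ => pathalg_mulDl _ _ _)
  (pathalg_mul0l g)).
Qed.

Lemma pathalg_mul_sumr I (s : seq I) (F : I -> pathalg K Q) g :
  pathalg_mul g (\sum_(i <- s) F i) = \sum_(i <- s) pathalg_mul g (F i).
Proof.
exact: (big_morph (pathalg_mul g) (fun _ _ => pathalg_mulDr _ _ _)
  (pathalg_mul0r g)).
Qed.

Lemma pathalg_mulA : associative pathalg_mul.
Proof.
move=> f g h; rewrite (pathalgE f) (pathalgE g) (pathalgE h).
rewrite [LHS]pathalg_mul_suml [X in _ = pathalg_mul X _]pathalg_mul_suml.
rewrite [RHS]pathalg_mul_suml; apply/eq_bigr => p _.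
rewrite [X in pathalg_mul _ X = _]pathalg_mul_suml [LHS]pathalg_mul_sumr.
rewrite [X in _ = pathalg_mul X _]pathalg_mul_sumr [RHS]pathalg_mul_suml.
apply/eq_bigr => q _.
rewrite [X in pathalg_mul _ X = _]pathalg_mul_sumr [LHS]pathalg_mul_sumr.
rewrite [RHS]pathalg_mul_sumr; apply/eq_bigr => r _.
rewrite [X in pathalg_mul _ X = _]pathalg_basisM.
rewrite [X in _ = pathalg_mul X _]pathalg_basisM.
rewrite [LHS]pathalg_basisM [RHS]pathalg_basisM mulrA.
by congr (pathalg_basis _ _); rewrite /= path_compA.
Qed.

Lemma pathalg_mul1l : left_id pathalg_one pathalg_mul.
Proof.
move=> f; rewrite [in LHS](pathalgE f) [RHS]pathalgE pathalg_mul_sumr.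
apply/eq_bigr => p _; rewrite pathalg_mul_suml (bigD1 (path_src p)) //= big1.
  by rewrite addr0 (pathalg_basisM _ _ (Some _) (Some _)) mul1r /= trivial_comp eqxx.
move=> x nx; rewrite (pathalg_basisM _ _ (Some _) (Some _)) /= trivial_comp.
by rewrite eq_sym (negPf nx).
Qed.

Lemma pathalg_mul1r : right_id pathalg_one pathalg_mul.
Proof.
move=> f; rewrite [in LHS](pathalgE f) [RHS]pathalgE pathalg_mul_suml.
apply/eq_bigr => p _; rewrite pathalg_mul_sumr (bigD1 (path_tgt p)) //= big1.
  by rewrite addr0 (pathalg_basisM _ _ (Some _) (Some _)) mulr1 /= comp_trivial eqxx.
move=> x nx; rewrite (pathalg_basisM _ _ (Some _) (Some _)) /= comp_trivial.
by rewrite eq_sym (negPf nx).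
Qed.

HB.instance Definition _ := GRing.Zmodule_isPzRing.Build (pathalg K Q)
  pathalg_mulA pathalg_mul1l pathalg_mul1r pathalg_mulDl pathalg_mulDr.

(* The l-th power of the ideal generated by the arrows: the combinations of
   paths of length at least l. *)
Definition in_arrow_ideal_pow (l : nat) (f : pathalg K Q) : Prop :=
  forall p : qpath Q, p \in msupp f -> (l <= size (path_arrows p))%N.

Definition two_sided_ideal (I : {pred pathalg K Q}) : Prop :=
  submod_closed I /\ forall f g h, g \in I -> f * g * h \in I.

Definition admissible (I : {pred pathalg K Q}) : Prop :=
  [/\ two_sided_ideal I,
      forall f, f \in I -> in_arrow_ideal_pow 2 f
    & exists2 m, (2 <= m)%N & forall f, in_arrow_ideal_pow m f -> f \in I].

End PathAlgebra.

(* A is isomorphic to KQ/I for some finite quiver Q and admissible ideal I,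
   expressed as a surjective algebra morphism KQ -> A with kernel I. *)
Definition bound_quiver_algebra (K : fieldType) (A : falgType K) : Prop :=
  exists (Q : quiver) (I : {pred pathalg K Q})
         (phi : {linear pathalg K Q -> A}),
    [/\ admissible I, monoid_morphism phi, (forall a, exists f, phi f = a)
      & forall f, (f \in I) = (phi f == 0)].

(* Note that the algebras of type [falgType K] are nonzero. *)
Definition connected_algebra (K : fieldType) (A : falgType K) : Prop :=
  forall (A1 A2 : falgType K) (f : {linear A -> (A1 * A2)%type}),
    monoid_morphism f -> ~ bijective f.

Definition finitely_generated (R : pzRingType) (M : lmodType R) : Prop :=
  exists s : seq M, forall x : M, exists c : 'I_(size s) -> R,
    x = \sum_(i < size s) c i *: s`_i.

Record fgModule (R : pzRingType) := FgModule {
  fg_carrier :> lmodType R;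
  fg_carrierP : finitely_generated fg_carrier }.

(* Right A-modules are left modules over the opposite ring [A^c]. *)
Notation right_module A := (fgModule A^c).
Notation left_module A := (fgModule A).

Lemma finitely_generated_regular (R : pzRingType) : finitely_generated R^o.
Proof.
by exists [:: 1 : R^o] => x; exists (fun=> x); rewrite big_ord1 /= /GRing.scale /= mulr1.
Qed.

Definition regular_module (R : pzRingType) : fgModule R :=
  FgModule (finitely_generated_regular R).

Section Modules.
Variable R : pzRingType.
Implicit Types M N P : fgModule R.

Definition nonzero_module M : Prop := exists x : M, x <> 0.

Definition isomorphic M N : Prop := exists f : {linear M -> N}, bijective f.

Definition projective_module P : Prop :=
  forall M N (g : {linear M -> N}) (f : {linear P -> N}),
    (forall y, exists x, g x = y) ->
    exists h : {linear P -> M}, forall x, g (h x) = f x.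

Definition injective_module P : Prop :=
  forall M N (g : {linear M -> N}) (f : {linear M -> P}),
    injective g ->
    exists h : {linear N -> P}, forall x, h (g x) = f x.

Definition simple_module M : Prop :=
  nonzero_module M /\
  forall S : {pred M}, submod_closed S ->
    (forall x, x \in S -> x = 0) \/ (forall x, x \in S).

Definition indecomposable_module M : Prop :=
  nonzero_module M /\
  forall S T : {pred M}, submod_closed S -> submod_closed T ->
    (forall x, x \in S -> x \in T -> x = 0) ->
    (forall x, exists y z, [/\ y \in S, z \in T & x = y + z]) ->
    (forall x, x \in S -> x = 0) \/ (forall x, x \in T -> x = 0).

Definition uniserial_module M : Prop :=
  forall S T : {pred M}, submod_closed S -> submod_closed T ->
    {subset S <= T} \/ {subset T <= S}.

(* There are exactly n isomorphism classes of modules satisfying C. *)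
Definition num_iso_classes (C : fgModule R -> Prop) (n : nat) : Prop :=
  exists F : 'I_n -> fgModule R,
    [/\ forall i, C (F i),
        forall i j, isomorphic (F i) (F j) -> i = j
      & forall M, C M -> exists i, isomorphic M (F i)].

Definition essential_image M N (f : {linear M -> N}) : Prop :=
  forall S : {pred N}, submod_closed S -> (exists2 y, y \in S & y <> 0) ->
    exists2 x, f x \in S & f x <> 0.

(* Exact sequences 0 -> M -> I_0 -> I_1 -> ... with injective terms; such a
   sequence is minimal when each I_i is an injective envelope of the image of
   the map ending at I_i. *)
Record min_inj_coresolution M := MinInjCoresolution {
  cores_term :> nat -> fgModule R;
  cores_aug : {linear M -> cores_term 0};
  cores_diff : forall i, {linear cores_term i -> cores_term i.+1};
  cores_term_injective : forall i, injective_module (cores_term i);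
  cores_aug_inj : injective cores_aug;
  cores_exact0 : forall x, cores_diff 0 x = 0 <-> exists m, cores_aug m = x;
  cores_exactS : forall i x,
    cores_diff i.+1 x = 0 <-> exists y, cores_diff i y = x;
  cores_minimal0 : essential_image cores_aug;
  cores_minimalS : forall i, essential_image (cores_diff i) }.

End Modules.

(* Natural numbers extended with infinity, represented by [None]. *)
Notation enat := (option nat).

Definition le_enat (x y : enat) : bool :=
  match x, y with
  | _, None => true
  | None, Some _ => false
  | Some m, Some n => (m <= n)%N
  end.

Definition is_sup (S : nat -> Prop) (s : enat) : Prop :=
  (forall m, S m -> le_enat (Some m) s) /\
  (forall t, (forall m, S m -> le_enat (Some m) t) -> le_enat s t).

Definition coresolution_domdim (R : pzRingType) (M : fgModule R)
    (I : min_inj_coresolution M) (d : enat) : Prop :=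
  (~ projective_module (I 0) /\ d = Some 0) \/
  (projective_module (I 0) /\
   exists2 s, is_sup (fun m => forall i, (i <= m)%N -> projective_module (I i)) s
            & d = omap succn s).

Section Algebras.
Variables (K : fieldType) (A : falgType K).

Definition right_regular : right_module A := regular_module A^c.

(* All minimal injective coresolutions of the regular module give the same
   value; [None] is only a default value. *)
Definition domdim : enat :=
  xget None [set d | exists I : min_inj_coresolution right_regular,
                       coresolution_domdim I d].

Definition selfinjective : Prop := injective_module right_regular.

Definition nakayama : Prop :=
  (forall P : left_module A,
     indecomposable_module P -> projective_module P -> uniserial_module P) /\
  (forall P : right_module A,
     indecomposable_module P -> projective_module P -> uniserial_module P).

Definition num_simples (n : nat) : Prop :=
  num_iso_classes (fun S : right_module A => simple_module S) n.

Definition num_indec_proj_inj (n : nat) : Prop :=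
  num_iso_classes (fun P : right_module A =>
    [/\ indecomposable_module P, projective_module P & injective_module P]) n.

(* A non-selfinjective Nakayama algebra in the class of algebras considered. *)
Definition nonselfinjective_nakayama : Prop :=
  [/\ bound_quiver_algebra A, connected_algebra A, nakayama & ~ selfinjective].

End Algebras.

(* Main.v *)
From HB Require Import structures.
From mathcomp Require Import all_boot all_algebra all_fingroup all_field.
From mathcomp Require Import finmap.
From mathcomp Require Import boolp zify ring.
From mathcomp Require classical_sets.
From mathcomp.multinomials Require Import monalg.
Require Import Defs.

Set Implicit Arguments.
Unset Strict Implicit.
Unset Printing Implicit Defensive.

Import GRing.Theory.
Local Open Scope ring_scope.

(** Let [A] be a Nakayama algebra with [n] simple modules. Each vertex of its
    quiver has at most one incoming and one outgoing arrow, because two arrows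
    at a vertex would span incomparable submodules of a uniserial projective.
    Hence the successor relation extends to a permutation [s] of the vertices,
    and [A] has a basis of paths [b x k], with [k < len x], where [b x k] runs
    from [x] to [s^k x]. The right projective at [x] is uniserial with factors
    [x], [s x], ..., and the indecomposable projective and injective modules
    are intervals of such sequences.

    The bound. The projective at [x] is injective exactly when
    [len (s^-1 x) <= len x]; if [A] is not selfinjective this fails for some
    [x]. Put [f z = s^(len z) z], the vertex that follows the socle of the
    projective at [z]. As long as the terms of the coresolution of [A] are
    projective, the cosyzygies of the projective at [x = v_0] stay uniserial,
    and their tops [v_1], [v_2], ... satisfy [v_1 <> v_0], [f v_1 = f v_0] and
    [f v_(j+2) = v_j] ([cosyzygy_chain]). If the terms 0 to [2n-2] were all
    projective, both [v_0] and [v_1] would lie in the image of [f^(n-1)]. On a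
    set with [n] elements this image is stable, so [f] is injective on it,
    contrary to [f v_1 = f v_0] ([not_all_projective]). In a coresolution of
    the whole of [A] the cosyzygies of one summand are followed by keeping an
    element that generates the longest uniserial in its class modulo the
    radical ([longest]), without decomposing the terms.

    The dominant dimension is read off a minimal injective coresolution, so one
    has to exist ([coresolution_exists]). Injective modules are built as duals
    of left projectives ([dual_module]), and an embedding into a direct sum of
    these with the least number of summands is automatically essential
    ([dual_envelope]).

    Optimality. On the oriented cycle with vertices [0, ..., n-1] let the path
    from 0 survive up to length [n-1] and all others up to length [n]. Only the
    projective at 0 is not injective, and only the simple at 0 is not the socle
    of a projective. An injective module is therefore projective as soon as its
    socle avoids the simple at 0 ([injective_projective]), so it is enough that
    the extension groups of this simple by [A] vanish in degrees up to [2n-3].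
    Its projective resolution consists of explicit paths ([cycle_res]) and the
    vanishing is a statement about lengths of paths ([path_exact]), carried
    along the coresolution by dimension shifting ([exact_shift]). *)

(** * Linear maps and submodules *)

Section LinearMaps.
Variable R : pzRingType.
Implicit Types M N : lmodType R.

Definition mklin M N (f : M -> N) (fL : linear f) : {linear M -> N} :=
  HB.pack f (GRing.isLinear.Build R M N *:%R f fL).

Lemma mklinE M N (f : M -> N) (fL : linear f) x : mklin fL x = f x. Proof. by []. Qed.

Lemma bij_linear_inv M N (f : {linear M -> N}) :
  bijective f -> exists g : {linear N -> M}, cancel f g /\ cancel g f.
Proof.
case=> g fK gK.
have gL : linear g.
  by move=> a u v; apply: (can_inj fK); rewrite linearP !gK.
by exists (mklin gL).
Qed.

Lemma inj_surj_bij M N (f : {linear M -> N}) :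
  (forall x, f x = 0 -> x = 0) -> (forall y, exists x, f x = y) -> bijective f.
Proof.
move=> f0 fS; have fI : injective f.
  by move=> x y e; apply/eqP; rewrite -subr_eq0; apply/eqP/f0; rewrite linearB e subrr.
pose g y := proj1_sig (cid (fS y)).
have gK : cancel g f by move=> y; exact: (proj2_sig (cid (fS y))).
by exists g => // x; apply: fI; rewrite gK.
Qed.

End LinearMaps.

Lemma ker0_inj (R : pzRingType) (M N : lmodType R) (f : {linear M -> N}) :
  (forall x, f x = 0 -> x = 0) -> injective f.
Proof.
by move=> f0 x y e; apply/eqP; rewrite -subr_eq0; apply/eqP/f0; rewrite linearB e subrr.
Qed.

Section Submodules.
Variables (R : pzRingType) (M : lmodType R).

Lemma submod_closedP (S : {pred M}) : submod_closed S ->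
  [/\ 0 \in S, {in S &, forall x y, x + y \in S}, {in S, forall x, - x \in S}
    & forall a, {in S, forall x, a *: x \in S}].
Proof.
case=> S0 SL; have SZ a : {in S, forall x, a *: x \in S}.
  by move=> x Sx; rewrite -[_ *: _]addr0 SL.
split=> // [x y Sx Sy|x Sx]; first by rewrite -[x]scale1r SL.
by rewrite -scaleN1r SZ.
Qed.

Lemma mem_asbool (P : M -> Prop) x : (x \in [pred y | `[< P y >]]) <-> P x.
Proof. by rewrite inE; split=> /asboolP. Qed.

Lemma asbool_submod (P : M -> Prop) :
  P 0 -> (forall a x y, P x -> P y -> P (a *: x + y)) ->
  submod_closed [pred y | `[< P y >]].
Proof.
move=> P0 PL; split; first exact/mem_asbool.
by move=> a x y /mem_asbool Px /mem_asbool Py; apply/mem_asbool; apply: PL.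
Qed.

End Submodules.

(** * Principal left ideals *)

Section PrincipalIdeal.
Variables (R : pzRingType) (a : R).

Definition left_ideal : {pred R^o} := [pred s | `[< exists r : R, s = r * a >]].

Lemma lidP (s : R^o) : reflect (exists r : R, s = r * a) (s \in left_ideal).
Proof. by rewrite inE; apply: asboolP. Qed.

Lemma lid_submod : submod_closed left_ideal.
Proof.
split; first by apply/lidP; exists 0; rewrite mul0r.
move=> c _ _ /lidP[r ->] /lidP[s ->]; apply/lidP.
by exists (c * r + s); rewrite mulrDl -mulrA.
Qed.

HB.instance Definition _ := GRing.isSubmodClosed.Build R R^o left_ideal
  (GRing.submod_closed_semi lid_submod).

Definition pideal := {s : R^o | s \in left_ideal}.
HB.instance Definition _ := SubChoice.on pideal.
HB.instance Definition _ := [SubChoice_isSubLmodule of pideal by <:].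

Lemma mem_left_ideal (r : R) : (r * a : R^o) \in left_ideal.
Proof. by apply/lidP; exists r. Qed.

Definition pid_mk (r : R) : pideal := Sub (r * a : R^o) (mem_left_ideal r).

Lemma val_pid_mk r : val (pid_mk r) = r * a. Proof. by []. Qed.

Lemma pid_mkE (s : pideal) : exists r, s = pid_mk r.
Proof.
have /lidP[r e] := valP s; exists r; exact: val_inj.
Qed.

Lemma pideal_fg : finitely_generated pideal.
Proof.
exists [:: pid_mk 1] => s; have [r ->] := pid_mkE s; exists (fun=> r).
by rewrite big_ord1; apply: val_inj; rewrite linearZ /= mul1r.
Qed.

Definition pid_module : fgModule R := FgModule pideal_fg.

(** [R a] is [R] modulo the annihilator of [a]. *)
Lemma pideal_hom (M : lmodType R) (w : M) :
  (forall r, r * a = 0 -> r *: w = 0) ->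
  exists f : {linear pideal -> M}, forall r, f (pid_mk r) = r *: w.
Proof.
move=> ann; pose f (s : pideal) := proj1_sig (cid (pid_mkE s)) *: w.
have fE r : f (pid_mk r) = r *: w.
  rewrite /f; case: cid => r' /= e; apply/eqP; rewrite -subr_eq0 -scalerBl.
  apply/eqP/ann; rewrite mulrBl; apply/eqP; rewrite subr_eq0 eq_sym.
  by have /eqP := congr1 val e.
have fL : linear f.
  move=> c s t; have [r ->] := pid_mkE s; have [r' ->] := pid_mkE t.
  have -> : c *: pid_mk r + pid_mk r' = pid_mk (c * r + r').
    by apply: val_inj; rewrite /= mulrDl -mulrA.
  by rewrite !fE scalerDl scalerA.
by exists (mklin fL).
Qed.

End PrincipalIdeal.

(** * Injective and projective modules *)

Section InjProj.
Variable R : pzRingType.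
Implicit Types M N P E : fgModule R.

(** Extend to [R] the map from [R a] that sends [a] to [w]. *)
Lemma injective_divisible E (a : R) (w : E) : injective_module E ->
  (forall r, r * a = 0 -> r *: w = 0) -> exists w' : E, w = a *: w'.
Proof.
move=> Einj /pideal_hom[f fE].
have vL : linear (val : pideal a -> R^o) by move=> c s t; rewrite linearP.
have [h hE] := Einj (pid_module a) (regular_module R) (mklin vL) f val_inj.
exists (h (1 : R^o)); rewrite -linearZ /= /GRing.scale /= mulr1.
by have := hE (pid_mk a 1); rewrite fE scale1r /= mul1r.
Qed.

Lemma fg_fin (M : lmodType R) (I : finType) (e : I -> M) :
  (forall x, exists c : I -> R, x = \sum_i c i *: e i) -> finitely_generated M.
Proof.
move=> spn; exists [seq e i | i <- enum I] => x; have [c ->] := spn x.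
exists (fun k => nth 0 [seq c i | i <- enum I] k).
rewrite -[LHS]big_enum /=; elim: (enum I) => [|i s IH] /=.
  by rewrite big_nil big_ord0.
by rewrite big_cons big_ord_recl /= IH.
Qed.

Definition free_module (p : nat) : fgModule R.
Proof.
apply: (@FgModule _ {ffun 'I_p -> R^o}).
pose d i : {ffun 'I_p -> R^o} := [ffun j => (i == j)%:R].
apply: (@fg_fin _ 'I_p d) => x.
exists (fun i => x i); apply/ffunP => j; rewrite sum_ffunE.
rewrite (bigD1 j) //= big1 ?addr0 => [|i ij]; rewrite !ffunE ?eqxx ?(negPf ij).
  by rewrite /GRing.scale /= mulr1.
by rewrite scaler0.
Defined.

Lemma free_projective p : projective_module (free_module p).
Proof.
move=> M N' g f gS.
pose d i : free_module p := [ffun j => (i == j)%:R : R^o].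
pose m i := proj1_sig (cid (gS (f (d i)))).
have mE i : g (m i) = f (d i) := proj2_sig (cid (gS (f (d i)))).
pose h (x : free_module p) : M := \sum_i (x i : R) *: m i.
have hL : linear h.
  move=> c x y; rewrite /h scaler_sumr -big_split /=; apply: eq_bigr => i _.
  by rewrite !ffunE scalerDl scalerA.
exists (mklin hL) => x; rewrite mklinE /h linear_sum /=.
transitivity (f (\sum_i (x i : R) *: d i)).
  by rewrite linear_sum; apply: eq_bigr => i _; rewrite !linearZ mE.
congr (f _); apply/ffunP => j; rewrite sum_ffunE.
rewrite (bigD1 j) //= big1 ?addr0 => [|i ij]; rewrite !ffunE ?eqxx ?(negPf ij).
  by rewrite /GRing.scale /= mulr1.
by rewrite scaler0.
Qed.

Lemma retract_projective P M (s : {linear P -> M}) (r : {linear M -> P}) :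
  cancel s r -> projective_module M -> projective_module P.
Proof.
move=> sK Mp N N' g f gS; have [h hE] := Mp N N' g (f \o r) gS.
by exists (h \o s) => x; rewrite /= hE /= sK.
Qed.

Lemma retract_injective P M (s : {linear P -> M}) (r : {linear M -> P}) :
  cancel s r -> injective_module M -> injective_module P.
Proof.
move=> sK Mi N N' g f gI; have [h hE] := Mi N N' g (s \o f) gI.
by exists (r \o h) => x; rewrite /= hE /= sK.
Qed.

Lemma isomorphic_bij M N : isomorphic M N ->
  exists (f : {linear M -> N}) (g : {linear N -> M}), cancel f g /\ cancel g f.
Proof. by case=> f /bij_linear_inv[g fg]; exists f, g. Qed.

Lemma isomorphic_sym M N : isomorphic M N -> isomorphic N M.
Proof. by case/isomorphic_bij => f [g [fK gK]]; exists g; exists f. Qed.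

Lemma isomorphic_trans M N P : isomorphic M N -> isomorphic N P -> isomorphic M P.
Proof.
case=> f fB [g gB]; exists (g \o f); exact: bij_comp.
Qed.

(** The coordinates of a splitting of a map from a free module. *)
Lemma projective_functional P (x : P) : projective_module P -> x != 0 ->
  exists f : {linear P -> R^o}, f x != 0.
Proof.
move=> Pp x0; have [s sP] := fg_carrierP P.
pose g (c : free_module (size s)) : P := \sum_i (c i : R) *: s`_i.
have gL : linear g.
  move=> c y z; rewrite /g scaler_sumr -big_split /=; apply: eq_bigr => i _.
  by rewrite !ffunE scalerDl scalerA.
have [|h hE] := Pp (free_module (size s)) P (mklin gL) (idfun : {linear P -> P}).
  move=> y; have [c cE] := sP y; exists [ffun i => c i]; rewrite mklinE /g cE.
  by apply: eq_bigr => i _; rewrite ffunE.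
have [i hi] : exists i, h x i != 0.
  apply/not_existsP => h0; move/eqP: x0; apply; have <- : mklin gL (h x) = x := hE x.
  rewrite mklinE /g; apply: big1 => i _.
  by have /negP/negPn/eqP -> := h0 i; rewrite scale0r.
have fL : linear (fun y => h y i) by move=> c y z; rewrite linearP !ffunE.
by exists (mklin fL).
Qed.

Lemma uniserial_iso M N : isomorphic M N -> uniserial_module N -> uniserial_module M.
Proof.
case/isomorphic_bij => f [g [fK gK]] Nu S T Sc Tc.
pose im (U : {pred M}) : {pred N} := [pred y | g y \in U].
have imc U : submod_closed U -> submod_closed (im U).
  case=> U0 UL; split; first by rewrite inE linear0.
  by move=> a x y; rewrite !inE => Ux Uy; rewrite linearP UL.
by have [|] := Nu (im S) (im T) (imc _ Sc) (imc _ Tc) => sub; [left|right];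
  move=> x Ux; have := sub (f x); rewrite !inE fK; apply.
Qed.

Lemma injective_retraction E M (f : {linear E -> M}) :
  injective_module E -> injective f ->
  exists r : {linear M -> E}, cancel f r.
Proof. by move=> Ei fI; have [r rE] := Ei E M f idfun fI; exists r. Qed.

(** The image of an injective module is a direct summand, and essentiality
    rules out a nonzero complement. *)
Lemma injective_essential_bij E M (f : {linear E -> M}) :
  injective_module E -> injective f -> essential_image f -> bijective f.
Proof.
move=> Ei fI fe; have [r fK] := injective_retraction Ei fI.
exists r => // y; apply/eqP; rewrite eq_sym -subr_eq0; apply/negPn/negP => y0.
have [] := fe [pred z | r z == 0].
- split; first by rewrite inE linear0.
  by move=> a u v; rewrite !inE => /eqP ru /eqP rv; rewrite linearP ru rv scaler0 addr0.
- by exists (y - f (r y)); [rewrite inE linearB fK subrr | apply/eqP].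
by move=> x; rewrite inE fK => /eqP ->; rewrite linear0.
Qed.

Section Idempotent.
Variable e : R.
Hypothesis ee : e * e = e.

Lemma pideal_idem (s : pideal e) : (val s : R) * e = val s.
Proof. by have [r ->] := pid_mkE s; rewrite val_pid_mk -mulrA ee. Qed.

Lemma idem_projective : projective_module (pid_module e).
Proof.
have sL : linear (val : pideal e -> R^o) by move=> c s t; rewrite linearP.
have rL : linear (pid_mk e : R^o -> pideal e).
  by move=> c s t; apply: val_inj; rewrite /= mulrDl -mulrA.
apply: (@retract_projective (pid_module e) (regular_module R) (mklin sL) (mklin rL)).
  by move=> s; apply: val_inj; rewrite /= pideal_idem.
move=> M N g f gS; have [m mE] := gS (f (1 : R^o)).
have hL : linear (fun r : R^o => (r : R) *: m).
  by move=> c x y; rewrite scalerDl scalerA.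
exists (mklin hL) => x; rewrite mklinE linearZ mE -linearZ /=.
by rewrite /GRing.scale /= mulr1.
Qed.

(** In a decomposition [R e = S + T] the component of the generator in [S] is an
    idempotent of [e R e]; if it is 0 or [e], a summand vanishes. *)
Lemma idem_indecomposable : e != 0 ->
  (forall s, e * s = s -> s * e = s -> s * s = s -> s = 0 \/ s = e) ->
  indecomposable_module (pid_module e).
Proof.
move=> e0 idem; split.
  exists (pid_mk e 1) => /(congr1 val) /=; rewrite mul1r => e0'.
  by rewrite e0' eqxx in e0.
move=> S T Sc Tc ST0 STsum.
have [s [t [Ss Tt est]]] := STsum (pid_mk e 1).
have Est : e = val s + val t by have := congr1 val est; rewrite /= mul1r.
have [_ SD SN SZ] := submod_closedP Sc; have [_ TD TN TZ] := submod_closedP Tc.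
have sge (u : pideal e) : (val u : R) *: pid_mk e 1 = u.
  by apply: val_inj; rewrite /= /GRing.scale /= mul1r pideal_idem.
have key (u : R) : u *: s \in S /\ u *: t \in T by split; [apply: SZ|apply: TZ].
have uniq u v : u \in S -> v \in T -> forall u' v', u' \in S -> v' \in T ->
    u + v = u' + v' -> u = u' /\ v = v'.
  move=> Su Tv u' v' Su' Tv' E.
  have E2 : u - u' = v' - v.
    by apply/eqP; rewrite subr_eq addrAC eq_sym subr_eq E addrC.
  have : u - u' = 0.
    by apply: ST0; [apply: SD => //; apply: SN|rewrite E2; apply: TD => //; apply: TN].
  by move=> E3; split; apply/eqP; [rewrite -subr_eq0 E3|rewrite eq_sym -subr_eq0 -E2 E3].
have [sgS tgS] : (val s : R) *: s = s /\ (val s : R) *: t = 0.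
  apply: uniq; rewrite ?SZ ?TZ //; first by have [] := Tc.
  by rewrite addr0 -scalerDr -est sge.
have ss : (val s : R) * val s = val s by have := congr1 val sgS.
have ve (u : pideal e) : (val u : R) * e = val u := pideal_idem u.
have es : e * val s = val s.
  have : e *: s = s /\ e *: t = t.
    apply: uniq; rewrite ?SZ ?TZ // -scalerDr -est.
    by apply: val_inj; rewrite /= /GRing.scale /= mul1r ee.
  by case=> /(congr1 val).
have dec (x : pid_module e) : x = (val x : R) *: s + (val x : R) *: t.
  by rewrite -scalerDr -est sge.
have allx x : x \in S -> x = (val x : R) *: s.
  move=> Sx; have [T0 _] := Tc.
  have [] // := uniq x 0 Sx T0 _ _ (SZ (val x) s Ss) (TZ (val x) t Tt).
  by rewrite addr0 -dec.
have ally x : x \in T -> x = (val x : R) *: t.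
  move=> Tx; have [S0 _] := Sc.
  have [] // := uniq 0 x S0 Tx _ _ (SZ (val x) s Ss) (TZ (val x) t Tt).
  by rewrite add0r -dec.
have [s0|se] := idem (val s) es (ve s) ss.
  left=> x Sx; rewrite (allx x Sx); have -> : s = 0 by apply: val_inj.
  by rewrite scaler0.
right=> x Tx; rewrite (ally x Tx); have -> : t = 0.
  by apply: val_inj; apply: (addrI (val s)); rewrite -Est se addr0.
by rewrite scaler0.
Qed.

End Idempotent.

Lemma uniserial_indecomposable M :
  nonzero_module M -> uniserial_module M -> indecomposable_module M.
Proof.
move=> M0 Mu; split=> // S T Sc Tc ST0 _.
by have [sub|sub] := Mu S T Sc Tc; [left|right] => x xS; apply: ST0 => //; apply: sub.
Qed.

End InjProj.

(** * Coordinates on finitely generated modules *)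

(** Take a subspace of maximal dimension among those contained in [P]. *)
Lemma vspace_of_pred (K : fieldType) (W : vectType K) (P : W -> Prop) :
  P 0 -> (forall c x y, P x -> P y -> P (c *: x + y)) ->
  exists U : {vspace W}, forall x, x \in U <-> P x.
Proof.
move=> P0 PL.
pose Q d := `[< exists U : {vspace W}, \dim U = d /\ forall x, x \in U -> P x >].
have Q0 : exists d, Q d.
  by exists 0; apply/asboolP; exists 0%VS; rewrite dimv0; split=> // x /[!memv0] /eqP->.
have Qle d : Q d -> (d <= \dim {:W})%N.
  by move=> /asboolP[U [<- _]]; apply: dimvS; apply: subvf.
have [d /asboolP[U [dU UP]] dmax] := ex_maxnP Q0 Qle.
exists U => x; split; first exact: UP.
move=> Px; apply/negPn/negP => /negP xU.
have : Q (\dim (U + <[x]>)).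
  apply/asboolP; exists (U + <[x]>)%VS; split=> // w.
  by case/memv_addP => u Uu [_ /vlineP[c ->] ->]; rewrite addrC; apply: PL => //; apply: UP.
move/dmax; rewrite -dU => le.
have /eqP UE : (U == U + <[x]>)%VS by rewrite eqEdim addvSl.
by apply: xU; rewrite UE; apply: (subvP (addvSr _ _)); apply: memv_line.
Qed.

Section Scalars.
Variables (K : fieldType) (R : pzRingType) (kap : {rmorphism K -> R}).
Variables (I : finType) (rb : I -> R).
Hypothesis rb_span : forall r, exists f : I -> K, r = \sum_i kap (f i) * rb i.

(** A copy of the module, so that scalars of [K] do not compete with those of
    [R]; the phantom [kap] makes the copy remember which embedding it uses. *)
Definition kmod (M : lmodType R) : Type := let _ := kap in M.
HB.instance Definition _ (M : lmodType R) := GRing.Zmodule.on (kmod M).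

Section KScale.
Variable M : lmodType R.
Definition kscale (c : K) (x : kmod M) : kmod M := kap c *: (x : M).
Lemma kscaleA a b v : kscale a (kscale b v) = kscale (a * b) v.
Proof. by rewrite /kscale scalerA -rmorphM. Qed.
Lemma kscale1 : left_id 1 kscale.
Proof. by move=> v; rewrite /kscale rmorph1 scale1r. Qed.
Lemma kscaleDr : right_distributive kscale +%R.
Proof. by move=> a u v; rewrite /kscale scalerDr. Qed.
Lemma kscaleDl v : {morph kscale^~ v : a b / a + b}.
Proof. by move=> a b; rewrite /kscale rmorphD scalerDl. Qed.
HB.instance Definition _ := GRing.Zmodule_isLmodule.Build K (kmod M)
  kscaleA kscale1 kscaleDr kscaleDl.
End KScale.

Lemma kmodZ (M : lmodType R) c (x : M) : c *: (x : kmod M) = kap c *: x :> M.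
Proof. by []. Qed.

(** Combining generators of the module with a basis of the algebra gives a
    surjection from a finite-dimensional space; a complement of its kernel
    splits it. *)
Lemma fg_coordinates (M : fgModule R) :
  exists (W : finType) (p : {linear {ffun W -> K^o} -> kmod M})
    (q : {linear kmod M -> {ffun W -> K^o}}), cancel q p.
Proof.
have [s sP] := fg_carrierP M.
pose T : finType := ('I_(size s) * I)%type.
pose p0 (w : {ffun T -> K^o}) : kmod M :=
  \sum_(t : T) (kap (w t) * rb t.2) *: (s`_(t.1) : M).
have p0L : linear p0.
  move=> c x y; rewrite kmodZ /p0 scaler_sumr -big_split /=; apply: eq_bigr => t _.
  by rewrite !ffunE rmorphD rmorphM mulrDl scalerDl scalerA mulrA.
pose p := mklin p0L.
have pS m : exists w, p w = m.
  have [c cE] := sP m; pose f i := proj1_sig (cid (rb_span (c i))).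
  have fE i : c i = \sum_j kap (f i j) * rb j := proj2_sig (cid (rb_span (c i))).
  exists [ffun t => f t.1 t.2]; rewrite mklinE /p0 cE.
  symmetry; transitivity (\sum_i \sum_j (kap (f i j) * rb j) *: (s`_i : M)).
    by apply: eq_bigr => i _; rewrite fE scaler_suml.
  by rewrite pair_bigA; apply: eq_bigr => t _; rewrite ffunE.
have [||U UP] := @vspace_of_pred K {ffun T -> K^o} (fun w => p w = 0).
- by rewrite linear0.
- by move=> c x y px py; rewrite linearP px py scaler0 addr0.
pose pr := daddv_pi (U^C) U.
have capUC : (U^C :&: U = 0)%VS by rewrite capvC capv_compl.
have capCU : (U :&: U^C = 0)%VS by rewrite capv_compl.
have prE w : pr w + daddv_pi U (U^C) w = w.
  by apply: daddv_pi_add => //; rewrite addvC addv_complf memvf.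
have pr0 w : w \in U -> pr w = 0.
  by move=> Uw; have := prE w; rewrite daddv_pi_id // => e; apply: (addIr w); rewrite add0r.
have ppr w : p (pr w) = p w.
  rewrite -[in RHS](prE w) linearD.
  have -> : p (daddv_pi U (U^C) w) = 0 by apply/UP; apply: memv_pi.
  by rewrite addr0.
have prp w w' : p w = p w' -> pr w = pr w'.
  move=> e; apply/eqP; rewrite -subr_eq0 -linearB /=; apply/eqP/pr0/UP.
  by rewrite linearB e subrr.
pose g m := proj1_sig (cid (pS m)).
have gK m : p (g m) = m := proj2_sig (cid (pS m)).
have qL : linear (fun m : kmod M => pr (g m)).
  by move=> c x y; rewrite -linearP; apply: prp; rewrite linearP !gK.
by exists T, p, (mklin qL) => m; rewrite -[RHS]gK -ppr.
Qed.

(** Project the coordinates along the subspace to a complement: the coordinates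
    of the projection vanish together exactly on the subspace. *)
Lemma separating_functionals (M : fgModule R) (Z : M -> Prop) :
  Z 0 -> (forall c x y, Z x -> Z y -> Z (kap c *: x + y)) ->
  exists (J : finType) (f : J -> {linear kmod M -> K^o}),
    forall x, Z x <-> forall j, f j x = 0.
Proof.
move=> Z0 ZL; have [W [p [q qK]]] := fg_coordinates M.
have [||U UP] := @vspace_of_pred K {ffun W -> K^o} (fun w => Z (p w)).
- by rewrite linear0.
- by move=> c x y px py; rewrite linearP; apply: ZL.
pose pr := daddv_pi (U^C) U.
have capCU : (U :&: U^C = 0)%VS by rewrite capv_compl.
have capUC : (U^C :&: U = 0)%VS by rewrite capvC capv_compl.
have prE w : pr w + daddv_pi U (U^C) w = w.
  by apply: daddv_pi_add => //; rewrite addvC addv_complf memvf.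
have fL j : linear (fun m : kmod M => pr (q m) j : K^o).
  by move=> c x y; rewrite !linearP !ffunE.
exists W, (fun j => mklin (fL j)) => x; split.
  move=> Zx j; rewrite mklinE.
  have Uq : q x \in U by apply/UP; rewrite qK.
  have -> : pr (q x) = 0.
    by have := prE (q x); rewrite (daddv_pi_id capCU Uq) => e; apply: (addIr (q x)); rewrite add0r.
  by rewrite ffunE.
move=> f0; rewrite -[x]qK; apply/UP; rewrite -(prE (q x)).
have -> : pr (q x) = 0 by apply/ffunP => j; have := f0 j; rewrite mklinE ffunE.
by rewrite add0r memv_pi.
Qed.

(** In coordinates the embedding is an injective linear map, which has a linear
    left inverse. *)
Lemma extend_functional (M N : fgModule R) (g : {linear M -> N})
    (f : {linear kmod M -> K^o}) : injective g ->
  exists h : {linear kmod N -> K^o}, forall x, h (g x) = f x.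
Proof.
move=> gI; have [W [p [q qK]]] := fg_coordinates M.
have [W' [p' [q' qK']]] := fg_coordinates N.
pose G w : {ffun W' -> K^o} := q' (g (p w)).
have GL : linear G.
  by move=> c x y; rewrite /G -linearP; congr (q' _); rewrite !linearP.
pose F := linfun (mklin GL).
have FE w : F w = q' (g (p w)) by rewrite lfunE.
have hL : linear (fun n : kmod N => f (p (F^-1%VF (q' n)))).
  by move=> c x y; rewrite !linearP.
exists (mklin hL) => m; rewrite mklinE.
have : F (F^-1%VF (q' (g m))) = q' (g m).
  apply: limg_lfunVK; have -> : q' (g m) = F (q m) by rewrite FE qK.
  by apply: memv_img; rewrite memvf.
by rewrite FE => /(can_inj qK')/gI ->.
Qed.

End Scalars.

(** * Algebras with a basis of paths *)

(** The multiplication table of a Nakayama algebra, for left modules over [R]: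
    [nb_path x k] is the path of length [k] starting at [x], and the right factor
    of a product is the path that is followed first. Right modules are obtained
    with the converse ring. The permutation [nb_next] exists even when the quiver
    is not a cycle: a nonzero path follows it only for [len x - 1] steps from [x]. *)
Record nakayama_basis (K : fieldType) (R : pzRingType) (kap : {rmorphism K -> R}) :=
  NakayamaBasis {
    nb_vertex : finType;
    nb_next : {perm nb_vertex};
    nb_len : nb_vertex -> nat;
    nb_path :> nb_vertex -> nat -> R;
    nb_bound : nat;
    nb_central : forall c r, kap c * r = r * kap c;
    nb_mul : forall x k y l, nb_path y l * nb_path x k =
      if y == iter k nb_next x then nb_path x (k + l)%N else 0;
    nb_eq0 : forall x k, (nb_path x k == 0) = (nb_len x <= k)%N;
    nb_one : \sum_x nb_path x 0%N = 1;
    nb_len_gt0 : forall x, (0 < nb_len x)%N;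
    nb_len_bound : forall x, (nb_len x <= nb_bound)%N;
    nb_span : forall r, exists f : nb_vertex -> nat -> K,
      r = \sum_x \sum_(k < nb_bound) kap (f x k) * nb_path x k }.

Arguments nb_len {K R kap} n x.
Arguments nb_path {K R kap} n x k.
Arguments nb_eq0 {K R kap} n x k.
Arguments nb_mul {K R kap} n x k y l.
Arguments nb_len_gt0 {K R kap} n x.
Arguments nb_len_bound {K R kap} n x.

Section NakayamaBasis.
Variables (K : fieldType) (R : pzRingType) (kap : {rmorphism K -> R}).
Variable b : nakayama_basis kap.

Notation V := (nb_vertex b).
Notation s := (nb_next b).
Notation len := (nb_len b).
Notation bnd := (nb_bound b).
Let kapC := nb_central b.

Lemma path0 x k : (len x <= k)%N -> b x k = 0.
Proof. by move=> le; apply/eqP; rewrite nb_eq0. Qed.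

Lemma path_neq0 x k : (k < len x)%N -> b x k != 0.
Proof. by move=> lt; rewrite nb_eq0 -ltnNge. Qed.

Lemma path_mul x k l : b (iter k s x) l * b x k = b x (k + l)%N.
Proof. by rewrite nb_mul eqxx. Qed.

Lemma path_mul0 x k y l : y != iter k s x -> b y l * b x k = 0.
Proof. by move=> ne; rewrite nb_mul (negPf ne). Qed.

Lemma path_idem x : b x 0%N * b x 0%N = b x 0%N.
Proof. by rewrite nb_mul /= eqxx. Qed.

Lemma path_end x k : b (iter k s x) 0%N * b x k = b x k.
Proof. by rewrite path_mul addn0. Qed.

Lemma path_start x k : b x k * b x 0%N = b x k.
Proof. by rewrite nb_mul eqxx. Qed.

(** A relation starting at a later vertex is a relation here. *)
Lemma len_next x k : (len x <= len (iter k s x) + k)%N.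
Proof. by rewrite -nb_eq0 addnC -path_mul path0 ?mul0r. Qed.

Lemma len_next1 x : (len x <= (len (s x)).+1)%N.
Proof. by have := len_next x 1; rewrite addn1. Qed.

Lemma iter_prevK k x : iter k s (iter k (s^-1)%g x) = x.
Proof.
by elim: k x => // k IH x; rewrite iterSr [iter k.+1 _ x]iterS permKV IH.
Qed.

Lemma iter_nextK k x : iter k (s^-1)%g (iter k s x) = x.
Proof.
by elim: k x => // k IH x; rewrite iterSr [iter k.+1 _ x]iterS permK IH.
Qed.

Lemma iter_next_inj k : injective (fun x => iter k s x).
Proof. by move=> x y /(congr1 (iter k (s^-1)%g)); rewrite !iter_nextK. Qed.

(** Linear independence is a consequence of the multiplication table: in a
    vanishing combination of paths from [x], multiply the shortest path that
    occurs up to the longest nonzero one, which kills all other terms. *)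
Lemma path_free (f : V -> nat -> K) :
  \sum_x \sum_(k < bnd) kap (f x k) * b x k = 0 ->
  forall x k, (k < len x)%N -> f x k = 0.
Proof.
move=> f0 x; elim/ltn_ind => k IH lt.
have fx : \sum_(j < bnd) kap (f x j) * b x j = 0.
  rewrite -[RHS](mul0r (b x 0%N)) -[in RHS]f0 mulr_suml (bigD1 x) //= [X in _ + X]big1 ?addr0.
    by rewrite mulr_suml; apply: eq_bigr => j _; rewrite -mulrA path_start.
  move=> y ne; rewrite mulr_suml big1 // => j _.
  by rewrite -mulrA path_mul0 ?mulr0.
have kb : (k < bnd)%N by apply: leq_trans lt (nb_len_bound b x).
have := congr1 (fun r => b (iter k s x) (len x - k.+1)%N * r) fx.
rewrite /= mulr0 mulr_sumr (bigD1 (Ordinal kb)) //= big1 ?addr0 => [|j ne].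
  rewrite mulrA -kapC -mulrA path_mul => e; apply/eqP; apply/negPn/negP => fn0.
  have /eqP : b x (k + (len x - k.+1))%N = 0.
    by rewrite -[LHS]mul1r -(rmorph1 kap) -(mulVf fn0) rmorphM -mulrA e mulr0.
  by apply/negP/path_neq0; lia.
have [lt'|gt|ek] := ltngtP (val j) k.
- by rewrite (IH j) ?rmorph0 ?mul0r ?mulr0 //; apply: ltn_trans lt' lt.
- rewrite mulrA -kapC -mulrA nb_mul; case: eqP => _; last by rewrite mulr0.
  have {}gt : (k < j)%N := gt.
  by rewrite path0 ?mulr0 //; lia.
- by case/negP: ne; apply/eqP/val_inj.
Qed.

Definition coef (r : R) (x : V) (k : nat) : K :=
  if (k < len x)%N then proj1_sig (cid (nb_span b r)) x k else 0.

Lemma coefE r : r = \sum_x \sum_(k < bnd) kap (coef r x k) * b x k.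
Proof.
rewrite [LHS](proj2_sig (cid (nb_span b r))); apply: eq_bigr => x _.
apply: eq_bigr => k _; rewrite /coef; case: ltnP => // le.
by rewrite (path0 le) !mulr0.
Qed.

Lemma coef_uniq r (f : V -> nat -> K) : r = \sum_x \sum_(k < bnd) kap (f x k) * b x k ->
  forall x k, (k < len x)%N -> coef r x k = f x k.
Proof.
move=> e x k lt; apply/eqP; rewrite -subr_eq0; apply/eqP.
apply: (path_free (f := fun x k => coef r x k - f x k)) => //.
rewrite -[RHS](subrr r) [in X in _ = X - _](coefE r) [in X in _ = _ - X]e -sumrB.
apply: eq_bigr => y _; rewrite -sumrB; apply: eq_bigr => j _.
by rewrite rmorphB mulrBl.
Qed.

Lemma coef_ge r x k : (len x <= k)%N -> coef r x k = 0.
Proof. by rewrite /coef ltnNge => ->. Qed.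

Lemma coef_lin c r t x k : coef (kap c * r + t) x k = c * coef r x k + coef t x k.
Proof.
case: (ltnP k (len x)) => [lt|ge]; last by rewrite !coef_ge // mulr0 addr0.
apply: (coef_uniq (f := fun x k => c * coef r x k + coef t x k)) => //.
rewrite [in LHS](coefE r) [in X in _ + X](coefE t) mulr_sumr -big_split /=.
apply: eq_bigr => y _; rewrite mulr_sumr -big_split /=; apply: eq_bigr => j _.
by rewrite rmorphD rmorphM mulrDl mulrA.
Qed.

Lemma coefD r t x k : coef (r + t) x k = coef r x k + coef t x k.
Proof. by have := coef_lin 1 r t x k; rewrite rmorph1 !mul1r. Qed.

Lemma coef0 x k : coef 0 x k = 0.
Proof. by apply: (addIr (coef 0 x k)); rewrite -coefD !add0r. Qed.

Lemma coefZ c r x k : coef (kap c * r) x k = c * coef r x k.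
Proof. by have := coef_lin c r 0 x k; rewrite !addr0 coef0 addr0. Qed.

Lemma coefN r x k : coef (- r) x k = - coef r x k.
Proof. by apply: (addIr (coef r x k)); rewrite -coefD !addNr coef0. Qed.

Lemma coef_sum (J : Type) (q : seq J) (P : pred J) F x k :
  coef (\sum_(j <- q | P j) F j) x k = \sum_(j <- q | P j) coef (F j) x k.
Proof. exact: (big_morph (fun r => coef r x k) (fun r t => coefD r t x k) (coef0 x k)). Qed.

Lemma coef_path y l x k :
  coef (b y l) x k = ([&& x == y, k == l & k < len x]%N)%:R.
Proof.
case: (ltnP k (len x)) => [lt|ge]; last by rewrite coef_ge // !andbF.
rewrite andbT; have [ll|gl] := ltnP l (len y); last first.
  rewrite (path0 gl) coef0; case: eqP => // exy; case: eqP => // ekl.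
  by move: lt; rewrite exy ekl ltnNge gl.
have lb : (l < bnd)%N by apply: leq_trans ll (nb_len_bound b y).
rewrite (coef_uniq (f := fun x k => ((x == y) && (k == l))%:R)) //.
rewrite (bigD1 y) //= [X in _ + X]big1 ?addr0 => [|z ne].
  rewrite (bigD1 (Ordinal lb)) //= [X in _ + X]big1 ?addr0 => [|j ne].
    by rewrite !eqxx rmorph1 mul1r.
  by rewrite (_ : (val j == l) = false) ?andbF ?rmorph0 ?mul0r //; apply/negbTE.
by rewrite big1 // => j _; rewrite (negPf ne) rmorph0 mul0r.
Qed.

Lemma functional_ext (f g : R -> K) :
  (forall c r t, f (kap c * r + t) = c * f r + f t) ->
  (forall c r t, g (kap c * r + t) = c * g r + g t) ->
  (forall x k, (k < len x)%N -> f (b x k) = g (b x k)) -> f =1 g.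
Proof.
move=> fL gL fg r.
have D0 (h : R -> K) : (forall c r t, h (kap c * r + t) = c * h r + h t) -> h 0 = 0.
  move=> hL; have := hL 1 0 0; rewrite mulr0 mul1r addr0 => /eqP.
  by rewrite -subr_eq0 opprD addrA subrr add0r oppr_eq0 => /eqP.
have S (h : R -> K) : (forall c r t, h (kap c * r + t) = c * h r + h t) ->
  h r = \sum_x \sum_(k < bnd) coef r x k * h (b x k).
  move=> hL; have hD u v : h (u + v) = h u + h v.
    by have := hL 1 u v; rewrite rmorph1 !mul1r.
  have hsum := big_morph h hD (D0 h hL).
  rewrite [in LHS](coefE r) hsum; apply: eq_bigr => x _; rewrite hsum.
  by apply: eq_bigr => k _; rewrite -[kap _ * _]addr0 hL (D0 h hL) addr0.
rewrite (S f fL) (S g gL); apply: eq_bigr => x _; apply: eq_bigr => k _.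
by case: (ltnP k (len x)) => [lt|ge]; [rewrite fg | rewrite coef_ge // !mul0r].
Qed.

Lemma coef_mulL y l r x k : coef (b y l * r) x k =
  if [&& l <= k, k < len x & y == iter (k - l) s x]%N then coef r x (k - l) else 0.
Proof.
move: r; apply: functional_ext => [c r t|c r t|z m lt].
- by rewrite mulrDr mulrA -kapC -mulrA coef_lin.
- by case: ifP => _; rewrite ?coef_lin // mulr0 addr0.
rewrite nb_mul; case: eqP => [->|ne].
  rewrite !coef_path; case: (leqP l k) => /= [le|gt]; last first.
    by rewrite (_ : (k == m + l)%N = false) ?andbF //; apply/negbTE; rewrite neq_ltn (leq_trans gt) ?leq_addl.
  rewrite (_ : (k == m + l)%N = (k - l == m)%N); last first.
    by lia.
  case: eqP => [->|] /=; last by rewrite if_same.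
  case: eqP => [->|] /=; last by rewrite if_same.
  by rewrite eqxx andbT lt /=; case: (k < len z)%N.
rewrite coef0; case: ifP => // /and3P[le klt /eqP ey].
rewrite coef_path; case: eqP => //= exz; case: eqP => //= em.
by case: ne; rewrite ey exz em.
Qed.

Lemma coef_mulR y l r x k : coef (r * b y l) x k =
  if [&& x == y, l <= k & k < len x]%N then coef r (iter l s y) (k - l) else 0.
Proof.
move: r; apply: functional_ext => [c r t|c r t|z m lt].
- by rewrite mulrDl -mulrA coef_lin.
- by case: ifP => _; rewrite ?coef_lin // mulr0 addr0.
rewrite nb_mul; case: eqP => [ez|ne].
  rewrite !coef_path; case: eqP => //= ->; case: (leqP l k) => /= [le|gt]; last first.
    by rewrite (_ : (k == l + m)%N = false) //; apply/negbTE; rewrite neq_ltn (leq_trans gt) ?leq_addr.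
  rewrite (_ : (k == l + m)%N = (k - l == m)%N); last first.
    by lia.
  rewrite -ez eqxx; case: eqP => [->|] //=; last by rewrite if_same.
  by rewrite lt; case: (k < len y)%N.
rewrite coef0; case: ifP => // _.
by rewrite coef_path; case: eqP => // e; case: ne.
Qed.

Section Modules.
Variable M : lmodType R.
Implicit Types m u : M.

Lemma scale_coef r m :
  r *: m = \sum_x \sum_(k < bnd) kap (coef r x k) *: (b x k *: m).
Proof.
rewrite [in LHS](coefE r) scaler_suml; apply: eq_bigr => x _.
by rewrite scaler_suml; apply: eq_bigr => k _; rewrite scalerA.
Qed.

Lemma path_off v x k m : b v 0%N *: m = m -> x != v -> b x k *: m = 0.
Proof. by move=> <- ne; rewrite scalerA path_mul0 ?scale0r. Qed.

Lemma sum_vertices m : m = \sum_x b x 0%N *: m.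
Proof. by rewrite -scaler_suml nb_one scale1r. Qed.

Lemma scale_at v r m : b v 0%N *: m = m ->
  r *: m = \sum_(k < bnd) kap (coef r v k) *: (b v k *: m).
Proof.
move=> mv; rewrite scale_coef (bigD1 v) //= [X in _ + X]big1 ?addr0 // => x ne.
by rewrite big1 // => k _; rewrite (path_off _ mv) // scaler0.
Qed.

Lemma path_kill v k l m : b v k *: m = 0 -> (k <= l)%N -> b v l *: m = 0.
Proof.
by move=> e le; rewrite -(subnKC le) -path_mul -scalerA e scaler0.
Qed.

(** Among the paths starting at the end of [b z k], an element that kills it
    involves only those of length at least [len z - k]. *)
Lemma annihilator_path z k r m :
  b (iter k s z) 0%N *: m = m -> b (iter k s z) (len z - k)%N *: m = 0 ->
  r * b z k = 0 -> r *: m = 0.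
Proof.
move=> mv m0 r0; rewrite (scale_at _ mv) big1 // => l _.
case: (ltnP (k + l) (len z)) => [lt|ge]; last first.
  by rewrite (path_kill m0) ?scaler0 // leq_subLR.
have := coef_mulR z k r z (k + l); rewrite r0 coef0 eqxx leq_addr lt addKn /= => <-.
by rewrite rmorph0 scale0r.
Qed.
End Modules.

(** The relations satisfied by the path are satisfied by the element, so
    [injective_divisible] applies. *)
Lemma injective_divide (E : fgModule R) z k (m : E) : injective_module E ->
  b (iter k s z) 0%N *: m = m -> b (iter k s z) (len z - k)%N *: m = 0 ->
  exists u : E, b z 0%N *: u = u /\ b z k *: u = m.
Proof.
move=> Ei mv m0.
have [r r0|u ->] := @injective_divisible _ E (b z k) m Ei.
  exact: annihilator_path mv m0 r0.
by exists (b z 0%N *: u); rewrite !scalerA path_idem path_start.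
Qed.

End NakayamaBasis.

(** * Dual modules *)

Section DualModules.
Variables (K : fieldType) (R : pzRingType) (kap : {rmorphism K -> R}).
Variable b : nakayama_basis kap.

Notation V := (nb_vertex b).
Notation s := (nb_next b).
Notation len := (nb_len b).
Notation bnd := (nb_bound b).
Let kapC := nb_central b.

Definition back k (y : V) : V := iter k (s^-1)%g y.

Lemma back_iter k x : back k (iter k s x) = x. Proof. exact: iter_nextK. Qed.
Lemma iter_back k x : iter k s (back k x) = x. Proof. exact: iter_prevK. Qed.

Lemma back_eq k x y : (back k y == x) = (y == iter k s x).
Proof. by apply/eqP/eqP => [<-|->]; rewrite ?iter_back ?back_iter. Qed.

Lemma backD k l y : back (k + l) y = back k (back l y).
Proof. exact: iterD. Qed.

Definition path_to y k := b (back k y) k.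

Lemma len_back k l y : (len (back (k + l) y) <= len (back l y) + k)%N.
Proof. by rewrite backD; have := len_next (back k (back l y)) k; rewrite iter_back. Qed.

Lemma lt_back k l y : (l <= k)%N -> (k < len (back k y))%N -> (l < len (back l y))%N.
Proof. by move=> le; have := len_back (k - l) l y; rewrite subnK //; lia. Qed.

Section Dual.
Variables (N : nat) (y : 'I_N -> V).

(** The module dual to the sum of the right projectives [b (y i) 0 R]: an
    element is a family of functionals, given by their values on the paths that
    end at [y i], listed by length. As a module the [i]-th summand is uniserial
    with socle at [y i], the value on the trivial path being the socle
    coordinate. *)
Definition dual_index : finType :=
  {t : 'I_N * 'I_bnd | (t.2 < len (back t.2 (y t.1)))%N}.

Definition dual : Type := {ffun dual_index -> K^o}.
HB.instance Definition _ := GRing.Zmodule.on dual.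

Definition dual_mk (f : 'I_N -> nat -> K) : dual := 
  [ffun t : dual_index => (f (val t).1 (val t).2 : K^o)].

Definition dual_at (u : dual) (i : 'I_N) (k : nat) : K :=
  if insub k : option 'I_bnd is Some k' then
    if insub (i, k') : option dual_index is Some t then u t else 0
  else 0.

Lemma dual_at_val u (t : dual_index) : dual_at u (val t).1 (val t).2 = u t.
Proof.
rewrite /dual_at valK; case: insubP => [t' _ e|/negP[]]; last exact: (valP t).
by congr (u _); apply: val_inj; rewrite e; case: (val t).
Qed.

Lemma dual_at0 u i k : (len (back k (y i)) <= k)%N -> dual_at u i k = 0.
Proof.
move=> le; rewrite /dual_at; case: insubP => // k' _ ek; case: insubP => // t /= lt _.
by move: lt; rewrite ek ltnNge le.
Qed.

Lemma dual_at_mk f i k : (k < len (back k (y i)))%N -> dual_at (dual_mk f) i k = f i k.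
Proof.
move=> lt; rewrite /dual_at; case: insubP => [k' _ ek|]; last first.
  by rewrite (leq_trans lt) // nb_len_bound.
case: insubP => [t _ e|]; first by rewrite ffunE e /= ek.
by rewrite /= ek lt.
Qed.

Lemma dual_at_eq u v : (forall i k, dual_at u i k = dual_at v i k) -> u = v.
Proof. by move=> e; apply/ffunP => t; rewrite -!dual_at_val. Qed.

Lemma dual_atD u v i k : dual_at (u + v) i k = dual_at u i k + dual_at v i k.
Proof.
rewrite /dual_at; case: insubP => [k' _ _|_]; last by rewrite addr0.
by case: insubP => [t _ _|_]; rewrite ?addr0 // ffunE.
Qed.

Lemma dual_at_zero i k : dual_at 0 i k = 0.
Proof. by apply: (addIr (dual_at 0 i k)); rewrite -dual_atD !add0r. Qed.

(** The value of the [i]-th functional at an arbitrary element of the algebra. *)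
Definition dual_eval (u : dual) i (r : R) : K :=
  \sum_(l < bnd) coef r (back l (y i)) l * dual_at u i l.

Lemma dual_eval_lin u i c r t : dual_eval u i (kap c * r + t) = c * dual_eval u i r + dual_eval u i t.
Proof.
rewrite /dual_eval mulr_sumr -big_split /=; apply: eq_bigr => l _.
by rewrite coef_lin mulrDl mulrA.
Qed.

Lemma dual_eval_path u i x l :
  dual_eval u i (b x l) = if iter l s x == y i then dual_at u i l else 0.
Proof.
rewrite /dual_eval; have [ge|lt] := leqP (len x) l.
  rewrite big1 => [|j _]; last by rewrite path0 // coef0 mul0r.
  by case: eqP => // e; rewrite dual_at0 // -e back_iter.
have lb : (l < bnd)%N by apply: leq_trans lt (nb_len_bound b x).
rewrite (bigD1 (Ordinal lb)) //= [X in _ + X]big1 ?addr0 => [|j ne].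
  rewrite coef_path back_eq eqxx eq_sym; case: eqP => [e|_] /=; last by rewrite mul0r.
  by rewrite -e back_iter lt mul1r.
rewrite coef_path (_ : (j == l :> nat) = false) ?andbF ?mul0r //.
by apply/negbTE; apply: contra ne => /eqP e; apply/eqP/val_inj.
Qed.

Definition dscale (r : R) (u : dual) : dual :=
  dual_mk (fun i k => dual_eval u i (path_to (y i) k * r)).

(** The action is [(r u)(t) = u (t r)]; its definition imposes this on paths
    that end at [y i] only. *)
Lemma dual_eval_scale u i r t : dual_eval (dscale r u) i t = dual_eval u i (t * r).
Proof.
move: t; apply: (functional_ext (b := b)) => [c p t|c p t|x l lt].
- exact: dual_eval_lin.
- by rewrite /= mulrDl -mulrA dual_eval_lin.
rewrite dual_eval_path; case: eqP => [e|ne].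
  by rewrite dual_at_mk -e ?back_iter // /path_to back_iter.
rewrite /dual_eval big1 // => j _; rewrite coef_mulL; case: ifP; last by rewrite mul0r.
case/and3P=> le _ /eqP e; case: ne.
by rewrite e -iterD subnKC // iter_back.
Qed.

Lemma dscaleA a c v : dscale a (dscale c v) = dscale (a * c) v.
Proof.
apply: dual_at_eq => i k; have [ge|lt] := leqP (len (back k (y i))) k; first by rewrite !dual_at0.
by rewrite !dual_at_mk // dual_eval_scale mulrA.
Qed.

Lemma dscale1 : left_id 1 dscale.
Proof.
move=> v; apply: dual_at_eq => i k.
have [ge|lt] := leqP (len (back k (y i))) k; first by rewrite !dual_at0.
by rewrite dual_at_mk // mulr1 dual_eval_path iter_back eqxx.
Qed.

Lemma dscaleDr : right_distributive dscale +%R.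
Proof.
move=> a u v; apply: dual_at_eq => i k; rewrite dual_atD.
have [ge|lt] := leqP (len (back k (y i))) k; first by rewrite !dual_at0 // addr0.
rewrite !dual_at_mk // /dual_eval -big_split /=; apply: eq_bigr => l _.
by rewrite dual_atD mulrDr.
Qed.

Lemma dscaleDl v : {morph dscale^~ v : a c / a + c}.
Proof.
move=> a c; apply: dual_at_eq => i k; rewrite dual_atD.
have [ge|lt] := leqP (len (back k (y i))) k; first by rewrite !dual_at0 // addr0.
rewrite !dual_at_mk // /dual_eval -big_split /=; apply: eq_bigr => l _.
by rewrite mulrDr coefD mulrDl.
Qed.

HB.instance Definition _ := GRing.Zmodule_isLmodule.Build R dual
  dscaleA dscale1 dscaleDr dscaleDl.

Lemma dual_at_path x l (u : dual) i k :
  dual_at (b x l *: u) i k = if back k (y i) == iter l s x then dual_at u i (l + k)%N else 0.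
Proof.
have [ge|lt] := leqP (len (back k (y i))) k.
  rewrite dual_at0 //; case: eqP => // e; rewrite dual_at0 //.
  by have := len_back l k (y i); lia.
rewrite dual_at_mk // /path_to nb_mul; case: eqP => e.
  have ey : y i = iter (l + k) s x by rewrite addnC iterD -e iter_back.
  by rewrite dual_eval_path -ey eqxx.
by rewrite /dual_eval big1 // => j _; rewrite coef0 mul0r.
Qed.

Lemma dual_at_kap c (u : dual) i k : dual_at (kap c *: u) i k = c * dual_at u i k.
Proof.
have [ge|lt] := leqP (len (back k (y i))) k; first by rewrite !dual_at0 // mulr0.
have dev0 : dual_eval u i 0 = 0 by rewrite /dual_eval big1 // => j _; rewrite coef0 mul0r.
rewrite dual_at_mk // -kapC -[kap c * _]addr0 dual_eval_lin dev0 addr0 dual_eval_path.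
by rewrite iter_back eqxx.
Qed.

Lemma dual_fg : finitely_generated dual.
Proof.
pose d t : dual := [ffun t' : dual_index => ((t == t')%:R : K^o)].
apply: (@fg_fin _ _ dual_index d) => u; exists (fun t => kap (u t)).
apply: dual_at_eq => i k.
have datS (F : dual_index -> dual) : dual_at (\sum_t F t) i k = \sum_t dual_at (F t) i k.
  exact: (big_morph (fun w => dual_at w i k) (fun v w => dual_atD v w i k) (dual_at_zero i k)).
rewrite datS; under eq_bigr do rewrite dual_at_kap.
rewrite /dual_at; case: insubP => [k' _ _|_]; last by rewrite big1 // => t _; rewrite mulr0.
case: insubP => [t _ _|_]; last by rewrite big1 // => t _; rewrite mulr0.
rewrite (bigD1 t) //= ffunE eqxx mulr1 big1 ?addr0 // => t' ne.
by rewrite ffunE (negPf ne) mulr0.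
Qed.

Definition dual_module : fgModule R := FgModule dual_fg.

(** Adjunction: homomorphisms into the dual module are families of functionals,
    one for each summand. *)
Lemma dual_hom (M : lmodType R) (f : 'I_N -> {linear kmod kap M -> K^o}) :
  (forall i x, f i (b (y i) 0%N *: (x : M)) = f i x) ->
  exists F : {linear M -> dual_module},
    forall x i k, dual_at (F x) i k = f i (path_to (y i) k *: x).
Proof.
move=> fy; pose F0 (x : M) : dual := dual_mk (fun i k => f i (path_to (y i) k *: x)).
have F0E x i k : dual_at (F0 x) i k = f i (path_to (y i) k *: x).
  have [ge|lt] := leqP (len (back k (y i))) k; last by rewrite dual_at_mk.
  by rewrite dual_at0 // /path_to path0 // scale0r linear0.
have devF x i t : dual_eval (F0 x) i t = f i (t *: x).
  move: t; apply: (functional_ext (b := b)) => [c p t|c p t|z l lt]; first exact: dual_eval_lin.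
    by rewrite scalerDl -scalerA -[kap c *: _]kmodZ linearP.
  rewrite dual_eval_path F0E; case: eqP => [e|ne]; first by rewrite /path_to -e back_iter.
  rewrite -fy scalerA path_mul0 ?scale0r ?linear0 //.
  by apply/eqP => e; apply: ne.
have FL : linear (F0 : M -> dual_module).
  move=> r u v; apply: dual_at_eq => i k; rewrite dual_atD !F0E scalerDr.
  rewrite (linearD (f i)) /=; congr (_ + _).
  have [ge|lt] := leqP (len (back k (y i))) k.
    by rewrite dual_at0 // /path_to path0 // scale0r linear0.
  by rewrite dual_at_mk // devF scalerA.
by exists (mklin FL).
Qed.

Lemma dual_at0_linear (i : 'I_N) : linear (fun u : kmod kap dual_module => dual_at u i 0 : K^o).
Proof. by move=> c u v; rewrite dual_atD dual_at_kap. Qed.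

Lemma dual_at_shift (u : dual) i k : dual_at (path_to (y i) k *: u) i 0 = dual_at u i k.
Proof. by rewrite dual_at_path iter_back eqxx addn0. Qed.

End Dual.
End DualModules.

(** * Injective envelopes and minimal coresolutions *)

Section Envelopes.
Variables (K : fieldType) (R : pzRingType) (kap : {rmorphism K -> R}).
Variable b : nakayama_basis kap.

Notation V := (nb_vertex b).
Notation s := (nb_next b).
Notation len := (nb_len b).
Notation bnd := (nb_bound b).
Let kapC := nb_central b.

Lemma nb_span_pair r : exists f : V * 'I_bnd -> K,
  r = \sum_t kap (f t) * b t.1 t.2.
Proof.
by have [f ->] := nb_span b r; exists (fun t : V * 'I_bnd => f t.1 t.2); rewrite pair_bigA.
Qed.

Lemma kmod_path_linear (M : lmodType R) (f : {linear kmod kap M -> K^o}) x k :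
  linear (fun m : kmod kap M => f (b x k *: (m : M)) : K^o).
Proof.
move=> c u v; rewrite -linearP; congr (f _).
have e : b x k *: (kap c *: (u : M) + (v : M)) =
    kap c *: (b x k *: (u : M)) + b x k *: (v : M).
  by rewrite scalerDr !scalerA kapC.
exact: e.
Qed.

(** By adjunction, extending a homomorphism amounts to extending functionals. *)
Lemma dual_injective N (y : 'I_N -> V) : injective_module (dual_module y).
Proof.
move=> M M' g f gI.
have fL i : linear (fun x : kmod kap M => dual_at (f x) i 0 : K^o).
  by move=> c u v; rewrite linearP dual_atD dual_at_kap.
pose h i := proj1_sig (cid (extend_functional nb_span_pair (mklin (fL i)) gI)).
have hE i x : h i (g x) = dual_at (f x) i 0 :=
  proj2_sig (cid (extend_functional nb_span_pair (mklin (fL i)) gI)) x.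
have [|F FE] := @dual_hom _ _ _ b N y M'
  (fun i => mklin (kmod_path_linear (h i) (y i) 0)).
  by move=> i x; rewrite /= scalerA path_idem.
exists F => x; apply: dual_at_eq => i k; rewrite FE /= scalerA.
rewrite /path_to -[X in b X 0%N](iter_back k) path_end -linearZ hE linearZ.
by rewrite dual_at_shift.
Qed.

Section Socle.
Variables (N : nat) (y : 'I_N -> V).
Implicit Types u : dual_module y.

(** Multiplying [u] by the path of length [k] to [y i] then produces a nonzero
    element of the socle, see [dual_at_top]. *)
Lemma dual_top u : u != 0 -> exists i k,
  dual_at u i k != 0 /\ forall j l, (k < l)%N -> dual_at u j l = 0.
Proof.
move=> u0; pose P k := [exists i, dual_at u i k != 0].
have Pex : exists k, P k.
  apply/not_existsP => nP; move/eqP: u0; apply; apply: dual_at_eq => i k.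
  rewrite dual_at_zero; apply/eqP/negPn/negP => d0; apply: (nP k).
  by apply/existsP; exists i.
have Pb k : P k -> (k <= bnd)%N.
  case/existsP => i; apply: contraNT; rewrite -ltnNge => lt; apply/eqP/dual_at0.
  by apply: leq_trans (nb_len_bound b _) (ltnW lt).
have [k /existsP[i d0] kmax] := ex_maxnP Pex Pb.
exists i, k; split=> // j l lt; apply/eqP/negPn/negP => dn.
have : P l by apply/existsP; exists j.
by move/kmax; rewrite leqNgt lt.
Qed.

Lemma dual_at_top u i k : (forall j l, (k < l)%N -> dual_at u j l = 0) ->
  forall j l, dual_at (path_to (y i) k *: u) j l =
    if (l == 0%N) && (y j == y i) then dual_at u j k else 0.
Proof.
move=> top j l; rewrite dual_at_path iter_back; case: l => [|l].
  by rewrite addn0.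
by rewrite top ?if_same // addnS ltnS leq_addr.
Qed.

End Socle.

(** Among the maps with kernel [Z] into dual modules take one with the least
    number of summands. If its image met a nonzero submodule [S] only in
    0, it would miss the line of a socle element [t] of [S]. Dividing by the summand that contains [t]
    diagonally removes one summand; the kernel does not grow, because every
    nonzero element of that diagonal summand has a nonzero multiple on the line. *)
Lemma dual_envelope (M : fgModule R) (Z : M -> Prop) :
  Z 0 -> (forall r x x', Z x -> Z x' -> Z (r *: x + x')) ->
  exists N (y : 'I_N -> V) (F : {linear M -> dual_module y}),
    (forall x, F x = 0 <-> Z x) /\ essential_image F.
Proof.
move=> Z0 ZL.
pose good N := `[< exists (y : 'I_N -> V) (F : {linear M -> dual_module y}),
  forall x, F x = 0 <-> Z x >].
have good_ex : exists N, good N.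
  have [||J [f fE]] := separating_functionals nb_span_pair (M := M) (Z := Z) => //.
    by move=> c x x'; apply: ZL.
  pose T : finType := (J * V)%type.
  exists #|T|; apply/asboolP; pose y (i : 'I_#|T|) : V := (enum_val i).2.
  have [|F FE] := @dual_hom _ _ _ b _ y M
    (fun i => mklin (kmod_path_linear (f (enum_val i).1) (y i) 0)).
    by move=> i x; rewrite /= scalerA path_idem.
  exists y, F => x; split=> [Fx|Zx].
    apply/fE => j; rewrite (sum_vertices b x) linear_sum big1 // => v _.
    have := FE x (enum_rank ((j, v) : T)) 0%N; rewrite Fx dual_at_zero /= /y enum_rankK /=.
    by rewrite scalerA path_idem.
  have ZZ r : Z (r *: x) by rewrite -[_ *: _]addr0; apply: ZL.
  apply: dual_at_eq => i k; rewrite FE dual_at_zero /= scalerA.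
  by have /fE := ZZ (b (y i) 0%N * path_to (y i) k); apply.
have [N /asboolP[y [F FE]] Nmin] := ex_minnP good_ex.
case: N y F FE Nmin => [|N] y F FE Nmin.
  by exists 0%N, y, F; split=> // S Sc [u Su []]; apply: dual_at_eq; case.
(* Suppose that the image of F meets S in 0 only; the summand i0 found next is
   the one to be removed. *)
exists N.+1, y, F; split=> // S Sc [u Su /eqP u0]; apply: contrapT => nS0.
have {nS0}nS x : ~ (F x \in S /\ F x <> 0) by case=> ? ?; apply: nS0; exists x.
have [_ SD _ SZ] := submod_closedP Sc.
have [i0 [k0 [d0 top]]] := dual_top u0.
pose t := path_to (y i0) k0 *: u.
have tE : forall j l, dual_at t j l =
    if (l == 0%N) && (y j == y i0) then dual_at u j k0 else 0 := dual_at_top i0 top.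
have St : t \in S by apply: SZ.
pose c i := dual_at t i 0; have c0 : c i0 != 0 by rewrite /c tE !eqxx.
have cy i : y i != y i0 -> c i = 0 by move=> ne; rewrite /c tE (negPf ne) andbF.
have : good N; last by move/Nmin; rewrite ltnn.
apply/asboolP; pose y' j := y (lift i0 j); exists y'.
have gL j : linear (fun x : kmod kap M =>
    dual_at (F x) (lift i0 j) 0 - (c (lift i0 j) / c i0) * dual_at (F x) i0 0 : K^o).
  move=> a x x'; rewrite linearP !dual_atD !dual_at_kap.
  have e (A A' B B' q : K) : a * A + A' - q * (a * B + B') = a * (A - q * B) + (A' - q * B').
    by ring.
  exact: e.
have [|F' F'E] := @dual_hom _ _ _ b N y' M (fun j => mklin (gL j)).
  move=> j x; rewrite /= linearZ !dual_at_path /= !addn0 /y' eqxx.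
  by case: eqP => // /eqP ne; rewrite cy ?mul0r // eq_sym.
have F'dual_at x j k : dual_at (F' x) j k =
    dual_at (F x) (lift i0 j) k - (c (lift i0 j) / c i0) * dual_at (F x) i0 k.
  rewrite F'E /= linearZ dual_at_shift; congr (_ - _).
  rewrite dual_at_path /= iter_back addn0.
  by case: eqP => // /eqP ne; rewrite cy ?mul0r // eq_sym.
exists F' => x; split=> [F'0|/FE F0]; last first.
  by apply: dual_at_eq => j k; rewrite F'dual_at F0 !dual_at_zero mulr0 subrr.
(* An element killed by the reduced map lies in the diagonal summand through t. *)
have prop i k : dual_at (F x) i k = (c i / c i0) * dual_at (F x) i0 k.
  case: (unliftP i0 i) => [j ->|->]; last by rewrite divff // mul1r.
  by have := F'dual_at x j k; rewrite F'0 dual_at_zero => /eqP; rewrite eq_sym subr_eq0 => /eqP.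
apply/FE/eqP/negPn/negP => Fx0.
have [i [k [dk ktop]]] := dual_top Fx0.
pose d := dual_at (F x) i0 k.
have dn0 : d != 0 by apply: contra dk; rewrite prop -/d => /eqP ->; rewrite mulr0.
apply: (nS (path_to (y i0) k *: x)); split.
  have -> : F (path_to (y i0) k *: x) = kap (d / c i0) *: t; last exact: SZ.
  apply: dual_at_eq => j l; rewrite linearZ dual_at_top // dual_at_kap.
  case: (l =P 0%N) => [->|/eqP l0] /=; last by rewrite tE (negPf l0) /= mulr0.
  rewrite -/(c j) prop -/d mulrAC [RHS]mulrAC [c j * d]mulrC.
  by case: eqP => // /eqP ne; rewrite cy // mulr0 mul0r.
move=> /(congr1 (fun w => dual_at w i0 0)); rewrite linearZ dual_at_shift dual_at_zero => /eqP.
by apply/negP.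
Qed.

(** Iterate envelopes of cokernels. A stage consists of the map whose cokernel
    comes next; its target is the next term. *)
Lemma coresolution_exists (M : fgModule R) : inhabited (min_inj_coresolution M).
Proof.
pose E (p : {N : nat & 'I_N -> V}) := dual_module (projT2 p).
have env0 : exists p (F : {linear M -> E p}), injective F /\ essential_image F.
  have [||N [y [F [F0 Fe]]]] := @dual_envelope M (fun x => x = 0) => //.
    by move=> r _ _ -> ->; rewrite scaler0 addr0.
  exists (existT (fun N => 'I_N -> V) N y), F; split=> //.
  by apply: ker0_inj => x /F0.
pose stage := {A : fgModule R & {p : {N : nat & 'I_N -> V} & {linear A -> E p}}}.
pose target (t : stage) := E (projT1 (projT2 t)).
pose map (t : stage) : {linear projT1 t -> target t} := projT2 (projT2 t).
have [env envP] : exists env : forall t, {p : _ & {linear target t -> E p}},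
    forall t, (forall x, projT2 (env t) x = 0 <-> exists a, map t a = x) /\
      essential_image (projT2 (env t)).
  have envt t : exists q : {p : _ & {linear target t -> E p}},
      (forall x, projT2 q x = 0 <-> exists a, map t a = x) /\
      essential_image (projT2 q).
    have [||N [y [F HF]]] := @dual_envelope (target t) (fun x => exists a, map t a = x).
    - by exists 0; rewrite linear0.
    - by move=> r _ _ [a <-] [a' <-]; exists (r *: a + a'); rewrite linearP.
    - by exists (existT (fun p => {linear target t -> E p})
                  (existT (fun N => 'I_N -> V) N y) F).
  exists (fun t => projT1 (cid (envt t))) => t.
  exact: (projT2 (cid (envt t))).
have [p0 [F0 [F0I F0e]]] := env0.
pose next (t : stage) : stage := existT _ (target t) (env t).
pose st i : stage := iter i next (existT _ M (existT _ p0 F0)).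
pose d i : {linear target (st i) -> target (st i.+1)} := projT2 (env (st i)).
have ex0 x : d 0%N x = 0 <-> exists m, F0 m = x := proj1 (envP (st 0%N)) x.
have exS i x : d i.+1 x = 0 <-> exists y, d i y = x := proj1 (envP (st i.+1)) x.
have es i : essential_image (d i) := proj2 (envP (st i)).
have inj i : injective_module (target (st i)) by exact: dual_injective.
exact: (inhabits (@MinInjCoresolution R M (fun i => target (st i)) F0 d inj F0I
  ex0 exS F0e es)).
Qed.

End Envelopes.

(** * Projective modules that are injective *)

Section ProjInj.
Variables (K : fieldType) (R : pzRingType) (kap : {rmorphism K -> R}).
Variable b : nakayama_basis kap.

Notation V := (nb_vertex b).
Notation s := (nb_next b).
Notation len := (nb_len b).
Notation bnd := (nb_bound b).
Notation P x := (pid_module (b x 0%N)).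
Let kapC := nb_central b.

Definition proj_socle z : V := iter (len z).-1 s z.
(** The projective at [z] is not the radical of the projective at the previous
    vertex. *)
Definition unextendable z := (len (back 1 z) <= len z)%N.

Lemma vert_coef (x : V) (u : P x) (y : V) k : y != x -> coef (val u : R) y k = 0.
Proof.
by move=> ne; rewrite -(pideal_idem (path_idem x)) coef_mulR (negPf ne).
Qed.

Lemma pid_coef0 x (u : P x) : (forall k, coef (val u : R) x k = 0) -> u = 0.
Proof.
move=> c0; apply: val_inj; rewrite [LHS](coefE b (val u : R)) big1 // => y _.
rewrite big1 // => k _; case: (eqVneq y x) => [->|ne].
  by rewrite c0 rmorph0 mul0r.
by rewrite vert_coef // rmorph0 mul0r.
Qed.

Lemma coef_kmod_linear x y k : 
  linear (fun u : kmod kap (P x) => @coef K R kap b (val u) y k : K^o).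
Proof. by move=> c u v; exact: (@coef_lin K R kap b c (val u) (val v) y k). Qed.

(** The paths from [z] and the nonzero paths to the end of the longest of them
    are matched by completion to that longest path. *)
Lemma unextendable_dual z : unextendable z ->
  isomorphic (P z) (dual_module (fun _ : 'I_1 => proj_socle z)).
Proof.
move=> hz; have lz := nb_len_gt0 b z.
have soc_back l : (l < len z)%N -> back l (proj_socle z) = iter ((len z).-1 - l) s z.
  by move=> lt; apply/eqP; rewrite back_eq -iterD subnKC //; lia.
have soc_le l : (l < len (back l (proj_socle z)))%N = (l < len z)%N.
  apply/idP/idP => [lt|lt]; last first.
    rewrite soc_back //; have := len_next z ((len z).-1 - l); lia.
  rewrite ltnNge; apply/negP => ge; have := lt_back ge lt.
  have -> : back (len z) (proj_socle z) = back 1 z.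
    by rewrite -{1}(prednK lz) -add1n backD back_iter.
  by move: hz; rewrite /unextendable; lia.
have [|F FE] := @dual_hom _ _ _ b 1 (fun=> proj_socle z) (P z)
  (fun=> mklin (coef_kmod_linear (x := z) z (len z).-1)).
  move=> i u; rewrite /= /GRing.scale /= coef_mulL /=.
  by rewrite subn0 eqxx prednK // leqnn.
have FdE u i l : (l < len z)%N -> dual_at (F u) i l = coef (val u : R) z ((len z).-1 - l).
  move=> lt; rewrite FE /= /GRing.scale /= /path_to coef_mulL soc_back // eqxx.
  by rewrite prednK // leqnn andbT; case: ifP => //; lia.
exists F; apply: inj_surj_bij => [u Fu|w].
  apply: pid_coef0 => k; case: (ltnP k (len z)) => [lt|]; last exact: coef_ge.
  have kk : ((len z).-1 - ((len z).-1 - k))%N = k by lia.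
  have := FdE u 0 ((len z).-1 - k)%N; rewrite Fu dual_at_zero kk => <- //.
  by lia.
pose a := \sum_(k < len z) kap (dual_at w 0 k) * b z ((len z).-1 - k)%N.
exists (pid_mk (b z 0%N) a); apply: dual_at_eq => i l; rewrite (ord1 i).
case: (ltnP l (len z)) => [lt|ge]; last by rewrite !dual_at0 // leqNgt soc_le -leqNgt.
have aP : a * b z 0%N = a.
  by rewrite mulr_suml; apply: eq_bigr => k _; rewrite -mulrA path_start.
rewrite FdE // val_pid_mk aP coef_sum (bigD1 (Ordinal lt)) //= big1 ?addr0 => [|k ne].
  by rewrite coefZ coef_path !eqxx /= (_ : (_ < _)%N) ?mulr1 //; lia.
rewrite coefZ coef_path eqxx /= (_ : (_ == _)%N = false) ?mulr0 //.
apply/negbTE; apply: contra ne => /eqP e; apply/eqP/val_inj => /=.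
by have := ltn_ord k; lia.
Qed.

Lemma unextendable_injective z : unextendable z -> injective_module (P z).
Proof.
move=> /unextendable_dual/isomorphic_bij[f [g [fK gK]]].
exact: retract_injective fK (@dual_injective _ _ _ b 1 _).
Qed.

(** Otherwise the generator, lying in the radical of the larger projective,
    would be divisible by an arrow inside its own module. *)
Lemma injective_unextendable z : injective_module (P z) -> unextendable z.
Proof.
move=> Pi; rewrite /unextendable leqNgt; apply/negP => lt.
pose y := back 1 z; have sy : iter 1 s y = z := iter_back 1 z.
have [||u [_ ]] := @injective_divide _ _ _ b (P z) y 1 (pid_mk (b z 0%N) 1) Pi.
- by rewrite sy; apply: val_inj; rewrite /= /GRing.scale /= mul1r path_idem.
- rewrite sy; apply: val_inj; rewrite /= /GRing.scale /= mul1r path_start path0 //.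
  by rewrite -/y in lt; lia.
move=> /(congr1 val) /= e.
have : coef (b y 1%N * val u) z 0 = coef (b z 0%N) z 0.
  by congr (coef _ z 0); rewrite -[RHS]mul1r -e.
rewrite coef_mulL /= coef_path !eqxx nb_len_gt0 /= => /eqP.
by rewrite eq_sym oner_eq0.
Qed.

Lemma path_val_linear a : linear (val : pideal a -> R^o).
Proof. by move=> c u v; rewrite linearP. Qed.

(** The regular module is the sum of the projectives at the vertices. *)
Lemma regular_injective :
  (forall z, unextendable z) -> injective_module (regular_module R).
Proof.
move=> hz M N g f gI.
have rL z : linear (fun m : M => pid_mk (b z 0%N) (f m) : P z).
  by move=> c u v; apply: val_inj; rewrite /= linearP mulrDl -mulrA.
pose h z := proj1_sig (cid (unextendable_injective (hz z) (mklin (rL z)) gI)).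
have hE z m : h z (g m) = pid_mk (b z 0%N) (f m) :=
  proj2_sig (cid (unextendable_injective (hz z) (mklin (rL z)) gI)) m.
have HL : linear (fun n : N => \sum_z (val (h z n) : R^o)).
  move=> c u v; rewrite scaler_sumr -big_split /=; apply: eq_bigr => z _.
  by rewrite linearP.
exists (mklin HL) => m; rewrite mklinE; under eq_bigr do rewrite hE /=.
have e : \sum_z (f m : R) * b z 0%N = f m by rewrite -mulr_sumr nb_one mulr1.
exact: e.
Qed.

Lemma nonselfinjective_vertex :
  ~ injective_module (regular_module R) -> exists x, ~~ unextendable x.
Proof.
move=> nI; apply/not_existsP => h; apply: nI; apply: regular_injective => z.
by apply/negPn/negP/h.
Qed.

(** The module is isomorphic to a sum of dual modules at its socle vertices, and
    each of these is an unextendable projective. So it embeds in a free module,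
    and the embedding splits by injectivity. *)
Lemma injective_projective (E : fgModule R) : injective_module E ->
  (forall v (m : E), m <> 0 -> b v 0%N *: m = m -> b v 1%N *: m = 0 ->
     exists2 z, proj_socle z = v & unextendable z) ->
  projective_module E.
Proof.
move=> Ei good.
have [||N [y [F [F0 Fe]]]] := @dual_envelope _ _ _ b E (fun x => x = 0) => //.
  by move=> r _ _ -> ->; rewrite scaler0 addr0.
have FI : injective F by apply: ker0_inj => x /F0.
have /bij_linear_inv[G [FK GK]] := injective_essential_bij Ei FI Fe.
have goody i : exists2 z, proj_socle z = y i & unextendable z.
  pose t : dual_module y := dual_mk y (fun j k => ((j == i) && (k == 0%N))%:R).
  have tE j k : dual_at t j k = ((j == i) && (k == 0%N))%:R.
    have [ge|lt] := leqP (len (back k (y j))) k; last by rewrite dual_at_mk.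
    rewrite dual_at0 //; case: k => [|k] in ge *; last by rewrite andbF.
    by have := nb_len_gt0 b (back 0 (y j)); lia.
  apply: (good (y i) (G t)).
  - move=> /(congr1 F); rewrite GK linear0 => /(congr1 (fun w => dual_at w i 0)) /eqP.
    by rewrite tE dual_at_zero !eqxx oner_eq0.
  - rewrite -linearZ; congr (G _); apply: dual_at_eq => j k; rewrite dual_at_path add0n /=.
    case: eqP => // ne; rewrite tE; case: (j =P i) => //= ej; case: k ne => //= ne.
    by case: ne; rewrite ej.
  rewrite -linearZ -[RHS](linear0 G); congr (G _); apply: dual_at_eq => j k.
  by rewrite dual_at_path tE andbF if_same dual_at_zero.
pose z i := projT1 (cid2 (goody i)).
have zs i : proj_socle (z i) = y i by rewrite /z; case: cid2.
have zh i : unextendable (z i) by rewrite /z; case: cid2.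
have emb i : exists f : {linear dual_module y -> R^o}, forall w,
    f w = 0 -> forall k, dual_at w i k = 0.
  have [|H HE] := @dual_hom _ _ _ b 1 (fun=> proj_socle (z i)) (dual_module y)
    (fun=> mklin (@dual_at0_linear _ _ _ b N y i)).
    by move=> _ w; rewrite /= dual_at_path zs eqxx.
  have [p [q [pK qK]]] := isomorphic_bij (unextendable_dual (zh i)).
  exists (mklin (@path_val_linear (b (z i) 0%N)) \o q \o H) => w /= e k.
  have : H w = 0 by rewrite -[H w]qK (_ : q (H w) = 0) ?linear0 //; apply: val_inj.
  move=> /(congr1 (fun w => dual_at w 0 k)); rewrite HE /= dual_at_zero => <-.
  by rewrite zs dual_at_shift.
pose f i := projT1 (cid (emb i)).
have fE i w : f i w = 0 -> forall k, dual_at w i k = 0 := projT2 (cid (emb i)) w.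
have aL : linear (fun m : E => [ffun i => f i (F m)] : free_module R N).
  by move=> c u v; apply/ffunP => i; rewrite !ffunE !linearP.
have aI : injective (mklin aL).
  apply: ker0_inj => m e; apply/F0/dual_at_eq => i k; rewrite dual_at_zero; apply: fE.
  by have /ffunP/(_ i) := e; rewrite !ffunE.
have [r rK] := injective_retraction Ei aI.
exact: retract_projective rK (@free_projective R N).
Qed.

End ProjInj.

(** * Uniserial projectives, simple modules and projective covers *)

Section Uniserial.
Variables (K : fieldType) (R : pzRingType) (kap : {rmorphism K -> R}).
Variable b : nakayama_basis kap.

Notation V := (nb_vertex b).
Notation s := (nb_next b).
Notation len := (nb_len b).
Notation bnd := (nb_bound b).
Notation P x := (pid_module (b x 0%N)).
Let kapC := nb_central b.

(** An element whose lowest path has length [k] generates all paths of length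
    at least [k]: multiply it up to the right length and clear the longer
    paths, from the socle downwards. *)
Lemma lowest_generates x (r : R) k : r * b x 0%N = r ->
  coef r x k != 0 -> (forall m, (m < k)%N -> coef r x m = 0) ->
  forall j, (k <= j)%N -> exists q, q * r = b x j.
Proof.
move=> rx ck low j; have [d] := ubnP (len x - j); elim: d j => // d IH j led lekj.
have [ge|lt] := leqP (len x) j; first by exists 0; rewrite mul0r path0.
pose w := b (iter k s x) (j - k)%N * r.
have wx y m : coef w y m = if (y == x) && (j <= m)%N then coef w x m else 0.
  case: (eqVneq y x) => [->|ne] /=; last first.
    by rewrite /w -rx mulrA coef_mulR (negPf ne).
  case: leqP => // lt'; rewrite /w coef_mulL; case: ifP => // /and3P[le _ _].
  by apply: low; lia.
have wj : coef w x j = coef r x k.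
  by rewrite /w coef_mulL lt leq_subr subKn // eqxx.
have jb : (j < bnd)%N by apply: leq_trans lt (nb_len_bound b x).
have wE : w = kap (coef r x k) * b x j +
    \sum_(m < bnd | (j < m)%N) kap (coef w x m) * b x m.
  rewrite [LHS](coefE b w) (bigD1 x) //= [X in _ + X]big1 ?addr0 => [|y ne]; last first.
    by rewrite big1 // => m _; rewrite wx (negPf ne) rmorph0 mul0r.
  rewrite (bigD1 (Ordinal jb)) //= wj; congr (_ + _).
  rewrite [LHS](bigID (fun m : 'I_bnd => (j < m)%N)) /= [X in _ + X]big1 ?addr0.
    apply: eq_bigl => m; case: (ltnP j m) => lt'; rewrite ?andbF // andbT.
    by apply/eqP => e; move: lt'; rewrite e /= ltnn.
  move=> m /andP[ne nlt]; rewrite wx eqxx /= (_ : (j <= m)%N = false) ?rmorph0 ?mul0r //.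
  have {}ne : (m != j :> nat)%N by apply: contra ne => /eqP e; apply/eqP/val_inj.
  by apply/negbTE; lia.
have qex (m : 'I_bnd) : exists q, (j < m)%N -> q * r = b x m.
  case: (ltnP j m) => [lt'|_]; last by exists 0.
  have [||q qE] := IH m; [lia|lia|by exists q].
pose q m := proj1_sig (cid (qex m)).
have qE (m : 'I_bnd) : (j < m)%N -> q m * r = b x m := proj2_sig (cid (qex m)).
exists (kap (coef r x k)^-1 * (b (iter k s x) (j - k)%N -
  \sum_(m < bnd | (j < m)%N) kap (coef w x m) * q m)).
rewrite -mulrA mulrBl -/w mulr_suml.
rewrite (_ : \sum_(_ < _ | _) _ = \sum_(m < bnd | (j < m)%N) kap (coef w x m) * b x m).
  by rewrite [in X in X - _]wE addrK mulrA -rmorphM mulVf // rmorph1 mul1r.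
by apply: eq_bigr => m lt'; rewrite -mulrA qE.
Qed.

Lemma pid_val_idem x (u : P x) : (val u : R) * b x 0%N = val u.
Proof. exact: (pideal_idem (path_idem x)). Qed.

Lemma pid_order x (u : P x) : u != 0 -> exists k,
  coef (val u : R) x k != 0 /\ forall m, (m < k)%N -> coef (val u : R) x m = 0.
Proof.
move=> u0; have cex : exists k, coef (val u : R) x k != 0.
  apply/not_existsP => c0; move/eqP: u0; apply; apply: pid_coef0 => k.
  by apply/eqP/negPn/negP/c0.
have [k ck kmin] := ex_minnP cex; exists k; split=> // m lt.
by apply/eqP/negPn/negP => /kmin; rewrite leqNgt lt.
Qed.

(** A submodule contains, with an element, everything of at least its order;
    hence submodules are totally ordered. *)
Lemma submodule_order x (S : {pred P x}) (u : P x) k : submod_closed S -> u \in S ->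
  coef (val u : R) x k != 0 -> (forall m, (m < k)%N -> coef (val u : R) x m = 0) ->
  forall t : P x, (forall m, (m < k)%N -> coef (val t : R) x m = 0) -> t \in S.
Proof.
move=> Sc Su ck low t tlow; have [S0 SD _ SZ] := submod_closedP Sc.
have Sj j : (k <= j)%N -> pid_mk (b x 0%N) (b x j) \in S.
  move=> le; have [q qE] := lowest_generates (pid_val_idem u) ck low le.
  have -> : pid_mk (b x 0%N) (b x j) = q *: u; last exact: SZ.
  by apply: val_inj; rewrite /= /GRing.scale /= qE path_start.
have -> : t = \sum_(j < bnd) kap (coef (val t : R) x j) *: pid_mk (b x 0%N) (b x j).
  apply: val_inj; rewrite linear_sum [LHS](coefE b (val t : R)).
  rewrite (bigD1 x) //= [X in _ + X]big1 ?addr0 => [|y ne].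
    by apply: eq_bigr => j _; rewrite /= /GRing.scale /= path_start.
  by rewrite big1 // => j _; rewrite vert_coef // rmorph0 mul0r.
apply: (big_ind (fun v => v \in S)) => // j _.
by case: (ltnP j k) => [lt|le]; [rewrite tlow // rmorph0 scale0r | apply: SZ; apply: Sj].
Qed.

Lemma proj_uniserial x : uniserial_module (P x).
Proof.
move=> S T Sc Tc; case: (EM (exists2 u, u \in S & u \notin T)); last first.
  move=> n; left=> u Su; apply/negPn/negP => Tu; apply: n; by exists u.
case=> u Su Tu; right=> t Tt.
have u0 : u != 0 by apply: contraNneq Tu => ->; case: Tc.
have [k [ck low]] := pid_order u0.
case: (EM (forall m, (m < k)%N -> coef (val t : R) x m = 0)).
  exact: submodule_order Sc Su ck low _.
have t0 : t = 0 \/ t != 0 by case: (eqVneq t 0); [left|right].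
case: t0 => [-> _|t0 n]; first by case: Sc.
have [k' [ck' low']] := pid_order t0.
have [lt|ge] := ltnP k' k; last first.
  by case: n => m lt; apply: low'; apply: leq_trans ge.
case/negP: Tu; apply: (submodule_order Tc Tt ck' low') => m lt'.
by apply: low; apply: ltn_trans lt.
Qed.

Lemma proj_nonzero x : nonzero_module (P x).
Proof.
exists (pid_mk (b x 0%N) 1) => /(congr1 val) /= /eqP.
by rewrite mul1r; apply/negP/path_neq0/nb_len_gt0.
Qed.

Lemma proj_indecomposable x : indecomposable_module (P x).
Proof. exact: uniserial_indecomposable (proj_nonzero x) (@proj_uniserial x). Qed.

(** The coefficient of a trivial path is a character of the algebra, which
    defines the simple module at the vertex. *)
Lemma coef_top_mul (r t : R) (x : V) : coef (r * t) x 0 = coef r x 0 * coef t x 0.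
Proof.
move: r; apply: (functional_ext (b := b)) => [c r u|c r u|z m lt].
- by rewrite /= mulrDl -mulrA coef_lin.
- by rewrite coef_lin mulrDl mulrA.
rewrite coef_mulL coef_path nb_len_gt0 sub0n leqn0 andbT /= [x == z]eq_sym andbC [0%N == m]eq_sym.
by case: ifP; rewrite ?mul1r ?mul0r.
Qed.

Lemma coef_one (x : V) : coef (1 : R) x 0 = 1 :> K.
Proof.
rewrite -(nb_one b) coef_sum (bigD1 x) //= coef_path eqxx nb_len_gt0 big1 ?addr0 // => y ne.
by rewrite coef_path eq_sym (negPf ne).
Qed.

Lemma coef_kap c (x : V) : coef (kap c) x 0 = c.
Proof. by rewrite -[kap c]mulr1 coefZ coef_one mulr1. Qed.

(** One copy of [K] for each vertex, since the module structure depends on it. *)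
Definition top (x : V) : Type := let _ := x in K.
HB.instance Definition _ x := GRing.Zmodule.on (top x).

Section Top.
Variable x : V.
Definition top_scale (r : R) (c : top x) : top x := coef r x 0 * (c : K).
Lemma top_scaleA a c v : top_scale a (top_scale c v) = top_scale (a * c) v.
Proof. by rewrite /top_scale coef_top_mul mulrA. Qed.
Lemma top_scale1 : left_id 1 top_scale.
Proof. by move=> v; rewrite /top_scale coef_one mul1r. Qed.
Lemma top_scaleDr : right_distributive top_scale +%R.
Proof. by move=> a u v; exact: mulrDr. Qed.
Lemma top_scaleDl v : {morph top_scale^~ v : a c / a + c}.
Proof. by move=> a c; rewrite /top_scale coefD; exact: mulrDl. Qed.
HB.instance Definition _ := GRing.Zmodule_isLmodule.Build R (top x)
  top_scaleA top_scale1 top_scaleDr top_scaleDl.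

Lemma top_fg : finitely_generated (top x).
Proof.
apply: (@fg_fin _ (top x) unit (fun=> (1 : K))) => c; exists (fun=> kap c).
rewrite (big_pred1 tt) => [|[]] //.
have e : coef (kap c) x 0 * 1 = c :> K by rewrite coef_kap mulr1.
exact: esym e.
Qed.

Definition top_module : fgModule R := FgModule top_fg.

Lemma top_nonzero : nonzero_module top_module.
Proof. by exists (1 : K); apply/eqP; exact: oner_neq0. Qed.

Lemma top_simple : simple_module top_module.
Proof.
split; first exact: top_nonzero.
move=> S Sc; have [S0 SD SN SZ] := submod_closedP Sc.
case: (EM (exists2 c, c \in S & c <> 0)) => [[c Sc' c0]|n]; last first.
  by left=> c Sc'; apply/eqP/negPn/negP => /eqP c0; apply: n; exists c.
right=> d; have c0' : (c : K) != 0 by apply/eqP.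
have -> : d = kap ((d : K) / (c : K)) *: c; last exact: SZ.
have e : coef (kap ((d : K) / (c : K))) x 0 * (c : K) = d by rewrite coef_kap mulfVK.
exact: esym e.
Qed.
End Top.

Lemma top_inj x y : isomorphic (top_module x) (top_module y) -> x = y.
Proof.
case=> f fB; apply/eqP/negPn/negP => ne.
have : f (1 : K) = 0.
  have e1 : (1 : K) = b x 0%N *: ((1 : K) : top_module x) :> top_module x.
    have e : (1 : K) = coef (b x 0%N) x 0 * 1 :> K.
      by rewrite coef_path !eqxx nb_len_gt0 mulr1.
    exact: e.
  rewrite [X in f X]e1 linearZ.
  have e c : coef (b x 0%N) y 0 * c = 0 :> K.
    by rewrite coef_path eq_sym (negPf ne) mul0r.
  exact: e.
move=> /eqP; rewrite -(linear0 f) (inj_eq (bij_inj fB)).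
by apply/negP; exact: oner_neq0.
Qed.

Lemma path_bound x : b x bnd = 0.
Proof. by rewrite path0 // nb_len_bound. Qed.

(** Following a longest path that does not kill [m] leads to an element killed by
    all arrows; its multiples by scalars form a submodule. *)
Lemma simple_top (M : fgModule R) : simple_module M ->
  exists x, isomorphic M (top_module x).
Proof.
case=> [[m m0] Ms].
have [k [y [mk0 mk1]]] : exists k y, b y k *: m != 0 /\ forall z, b z k.+1 *: m = 0.
  pose Q k := [exists y, b y k *: m != 0].
  have Q0 : exists k, Q k.
    exists 0%N; apply/existsP; apply: contrapT => n; apply: m0.
    rewrite (sum_vertices b m) big1 // => y _; apply/eqP/negPn/negP => ny.
    by apply: n; exists y.
  have Qb k : Q k -> (k <= bnd)%N.
    case/existsP => y; apply: contraNT; rewrite -ltnNge => lt.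
    by rewrite path0 ?scale0r // (leq_trans (nb_len_bound b y)) // ltnW.
  have [k /existsP[y yk] kmax] := ex_maxnP Q0 Qb.
  exists k, y; split=> // z; apply/eqP/negPn/negP => nz.
  have /kmax : Q k.+1 by apply/existsP; exists z.
  by rewrite ltnn.
pose x := iter k s y; pose w := b y k *: m.
have w0 : w != 0 by [].
have wr r : r *: w = kap (coef r x 0) *: w.
  have wx : b x 0%N *: w = w by rewrite /w scalerA path_end.
  rewrite (scale_at _ wx).
  have bpos : (0 < bnd)%N by apply: leq_trans (nb_len_gt0 b x) (nb_len_bound b x).
  rewrite (bigD1 (Ordinal bpos)) //= wx big1 ?addr0 // => [[[|l] lt]] // _ /=.
  have -> : b x l.+1 *: w = 0; last by rewrite scaler0.
  apply: (@path_kill _ _ _ b M x 1) => //.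
  by rewrite /w scalerA path_mul addn1.
have fL : linear (fun c : top_module x => kap (c : K) *: w).
  move=> r c d; rewrite scalerA; have e : kap (coef r x 0 * (c : K) + (d : K)) *: w =
      (r * kap (c : K)) *: w + kap (d : K) *: w.
    by rewrite [(r * _) *: w]wr coef_top_mul coef_kap rmorphD scalerDl.
  exact: e.
exists x; apply: isomorphic_sym; exists (mklin fL); apply: inj_surj_bij.
  move=> c /= cw; apply/eqP/negPn/negP => c0; move/eqP: w0; apply.
  have c0' : (c : K) != 0 by [].
  by rewrite -[w]scale1r -(rmorph1 kap) -(mulVf c0') rmorphM -scalerA cw scaler0.
have [|S0|SA] := Ms [pred u | `[< exists c : K, u = kap c *: w >]].
- apply: asbool_submod; first by exists 0; rewrite rmorph0 scale0r.
  move=> r _ _ [c ->] [d ->]; exists (coef r x 0 * c + d).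
  by rewrite scalerA [(r * _) *: w]wr coef_top_mul coef_kap rmorphD scalerDl.
- move/eqP: w0 => []; apply: S0; apply/mem_asbool; exists 1.
  by rewrite rmorph1 scale1r.
by move=> u; have /mem_asbool[c ->] := SA u; exists (c : top_module x).
Qed.

Lemma simples_count : num_iso_classes (fun S : fgModule R => simple_module S) #|V|.
Proof.
exists (fun i => top_module (enum_val i)); split.
- by move=> i; apply: top_simple.
- by move=> i j /top_inj/enum_val_inj.
move=> M /simple_top[x iso]; exists (enum_rank x); by rewrite enum_rankK.
Qed.

(** The tops of distinct vertices are not isomorphic. *)
Lemma card_vertices n : num_iso_classes (fun S : fgModule R => simple_module S) n ->
  (#|V| <= n)%N.
Proof.
case=> F [_ _ Fall]; pose f x := projT1 (cid (Fall _ (top_simple x))).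
have fE x : isomorphic (top_module x) (F (f x)) := projT2 (cid (Fall _ (top_simple x))).
rewrite -[leqRHS]card_ord; apply: (@leq_card _ _ f) => x y e.
apply: top_inj; apply: isomorphic_trans (fE x) _; rewrite e.
exact: isomorphic_sym (fE y).
Qed.

(** The radical of [M] is proper, since otherwise all elements would be divisible
    by paths of arbitrary length. A functional that vanishes on it, restricted to
    a vertex, is a homomorphism. *)
Lemma top_functional (M : fgModule R) : nonzero_module M ->
  exists x (f : {linear M -> top_module x}), exists m, f m != 0.
Proof.
move=> [m1 m10].
pose Z (m : M) := exists m' : V -> M, m = \sum_y b y 1%N *: m' y.
have [m0 Zm0] : exists m0, ~ Z m0.
  apply: contrapT => n; have ZA m : Z m by apply: contrapT => nz; apply: n; exists m.
  have ZI k : forall m : M, exists m' : V -> M, m = \sum_y b y k *: m' y.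
    elim: k => [|k IH] m; first by exists (fun=> m); exact: sum_vertices.
    have [m' ->] := IH m; pose q y := projT1 (cid (ZA (m' y))).
    have qE y : m' y = \sum_z b z 1%N *: q y z := projT2 (cid (ZA (m' y))).
    exists (fun z => q (s z) z); rewrite -[LHS]/(\sum_y b y k *: m' y).
    transitivity (\sum_y \sum_z (b y k * b z 1%N) *: q y z).
      apply: eq_bigr => y _; rewrite [in LHS]qE scaler_sumr.
      by apply: eq_bigr => z _; rewrite scalerA.
    rewrite exchange_big /=; apply: eq_bigr => z _.
    rewrite (bigD1 (s z)) //= big1 ?addr0 => [|y ne].
      by rewrite -[s z]/(iter 1 s z) path_mul add1n.
    by rewrite path_mul0 ?scale0r.
  apply: m10; have [m' ->] := ZI bnd m1.
  by apply: big1 => y _; rewrite path_bound scale0r.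
have ZZ : Z 0 by exists (fun=> 0); rewrite big1 // => y _; rewrite scaler0.
have ZL c m m' : Z m -> Z m' -> Z (kap c *: m + m').
  move=> [q ->] [q' ->]; exists (fun y => kap c *: q y + q' y).
  rewrite scaler_sumr -big_split /=; apply: eq_bigr => y _.
  by rewrite scalerDr !scalerA kapC.
have [J [g gZ]] := separating_functionals (nb_span_pair b) ZZ ZL.
have [j gj] : exists j, g j m0 != 0.
  apply: contrapT => n; apply: Zm0; apply/gZ => j.
  by apply/eqP/negPn/negP => nz; apply: n; exists j.
have [x gx] : exists x, g j (b x 0%N *: m0) != 0.
  apply: contrapT => n; move/eqP: gj; apply; rewrite (sum_vertices b m0) linear_sum.
  by apply: big1 => x _; apply/eqP/negPn/negP => nz; apply: n; exists x.
pose f0 (m : M) : K := g j (b x 0%N *: m).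
have f0L c m m' : f0 (kap c *: m + m') = c * f0 m + f0 m'.
  exact: (@kmod_path_linear K R kap b M (g j) x 0).
have f0path y l m : f0 (b y l *: m) = ((x == y) && (l == 0%N))%:R * f0 m.
  rewrite /f0 scalerA nb_mul; case: l => [|l] /=; last first.
    rewrite andbF mul0r; case: eqP => _; last by rewrite scale0r linear0.
    rewrite addn0; suff /gZ : Z (b y l.+1 *: m) by apply.
    exists (fun z => if z == iter l s y then b y l *: m else 0).
    rewrite (bigD1 (iter l s y)) //= eqxx big1 ?addr0 => [|z /negPf ->].
      by rewrite scalerA path_mul addn1.
    by rewrite scaler0.
  by rewrite andbT addn0; case: eqP => [->|_]; rewrite ?scale0r ?linear0 ?mul1r ?mul0r.
have f0r r m : f0 (r *: m) = coef r x 0 * f0 m.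
  move: r; apply: (functional_ext (b := b)) => [c r t|c r t|z l lt].
  - by rewrite scalerDl -scalerA f0L.
  - by rewrite coef_lin mulrDl mulrA.
  by rewrite f0path coef_path nb_len_gt0 andbT [0%N == l]eq_sym.
have fL : linear (f0 : M -> top_module x).
  move=> r m m'; rewrite /= -[in LHS](scale1r m) -(rmorph1 kap).
  have := f0L 1 (r *: m) m'; rewrite rmorph1 !scale1r mul1r => ->.
  by rewrite f0r.
by exists x, (mklin fL), m0.
Qed.

(** A map from [M] onto a simple module lifts to the projective at its vertex.
    The lift hits a generator, because it does so modulo the radical, and it
    splits; its kernel vanishes by indecomposability. *)
Lemma projective_cover (M : fgModule R) : indecomposable_module M ->
  projective_module M -> exists x, isomorphic M (P x).
Proof.
move=> [M0 Mi] Mp; have [x [f [m0 fm0]]] := top_functional M0.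
have gL : linear (fun r : R^o => coef (r : R) x 0 : top_module x).
  by move=> c r t; rewrite coefD; congr (_ + _); exact: coef_top_mul.
have [|h hE] := Mp (regular_module R) (top_module x) (mklin gL) f.
  by move=> c; exists (kap (c : K)); exact: coef_kap.
have hhL : linear (fun m : M => pid_mk (b x 0%N) (h m) : P x).
  by move=> c u v; apply: val_inj; rewrite /= linearP mulrDl -mulrA.
pose hh := mklin hhL; exists x.
have c0 : coef (val (hh m0) : R) x 0 != 0.
  rewrite /= coef_mulR eqxx nb_len_gt0 subn0 /=. 
  by apply/eqP => e; move/eqP: fm0; apply; rewrite -hE; exact: e.
have hhS v : exists m, hh m = v.
  have [//|q qE] := lowest_generates (pid_val_idem (hh m0)) c0 _ (leqnn 0).
  have [a ->] := pid_mkE v; exists ((a * q) *: m0); rewrite linearZ.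
  by apply: val_inj; rewrite /= /GRing.scale /= -mulrA; congr (a * _).
have [t tE] := idem_projective (path_idem x) idfun hhS.
have ht v : hh (t v) = v := tE v.
exists hh; apply: inj_surj_bij => // m hm.
have [||||/(_ (t (pid_mk (b x 0%N) 1))) T0|] //:=
  Mi [pred u | t (hh u) == u] [pred u | hh u == 0].
- split; first by rewrite inE !linear0.
  by move=> a u v; rewrite !inE => /eqP eu /eqP ev; rewrite !linearP /= eu ev.
- split; first by rewrite inE linear0.
  by move=> a u v; rewrite !inE => /eqP eu /eqP ev; rewrite linearP eu ev scaler0 addr0.
- by move=> u; rewrite !inE => /eqP eu /eqP hu; rewrite -eu hu linear0.
- move=> u; exists (t (hh u)), (u - t (hh u)); split.
  - by rewrite inE ht.
  - by rewrite inE linearB ht subrr.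
  by rewrite addrC subrK.
- have := proj_nonzero x; have : pid_mk (b x 0%N) 1 = 0 :> P x.
    have := T0; rewrite inE ht eqxx => /(_ isT) /(congr1 hh).
    by rewrite ht linear0.
  move=> e [u]; have [a ->] := pid_mkE u; case.
  have -> : pid_mk (b x 0%N) a = a *: (pid_mk (b x 0%N) 1 : P x).
    by apply: val_inj; rewrite /= /GRing.scale /= mul1r.
  by rewrite e scaler0.
by move=> /(_ m); rewrite inE hm eqxx => /(_ isT).
Qed.

Lemma indecomposable_projective_uniserial (M : fgModule R) :
  indecomposable_module M -> projective_module M -> uniserial_module M.
Proof.
move=> Mi Mp; have [x iso] := projective_cover Mi Mp.
exact: uniserial_iso iso (@proj_uniserial x).
Qed.

(** Distinct vertices have projectives with different tops: all coefficients at
    the top vanish on the multiples of the image of the generator. *)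
Lemma proj_inj x y : isomorphic (P x) (P y) -> x = y.
Proof.
case=> f [g fK gK]; apply/eqP/negPn/negP => ne.
pose u := pid_mk (b x 0%N) 1 : P x; pose w := pid_mk (b y 0%N) 1 : P y.
have ux : b x 0%N *: u = u.
  by apply: val_inj; rewrite /= /GRing.scale /= mul1r path_idem.
have fu : coef (val (f u) : R) y 0 = 0.
  have -> : f u = b x 0%N *: f u by rewrite -linearZ ux.
  by rewrite /= /GRing.scale /= coef_top_mul coef_path eq_sym (negPf ne) mul0r.
have [a ga] := pid_mkE (g w).
have : coef (val w : R) y 0 = 0.
  have -> : w = a *: f u.
    rewrite -linearZ -[LHS]gK ga; congr (f _); apply: val_inj.
    by rewrite /= /GRing.scale /= mul1r.
  by rewrite /= /GRing.scale /= coef_top_mul fu mulr0.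
by rewrite /= mul1r coef_path !eqxx nb_len_gt0 /= => /eqP; rewrite oner_eq0.
Qed.

End Uniserial.

(** * Coresolutions of the regular module *)

(** If [f] were not injective on the image of its [N]-th power, each of its first
    [N+1] powers would lose a point, and none would be left. *)
Lemma eventual_image_inj (T : finType) (f : T -> T) N : (#|T| <= N.+1)%N ->
  forall x y, f (iter N f x) = f (iter N f y) -> iter N f x = iter N f y.
Proof.
move=> cT x y exy; apply/eqP/negPn/negP => nxy.
pose W k := [set iter k f z | z in [set: T]].
have WS k : W k.+1 = [set f z | z in W k].
  by rewrite /W -imset_comp; apply: eq_imset => z.
have WN z k : (k <= N)%N -> iter N f z \in W k.
  by move=> le; rewrite -(subnKC le) iterD; apply: imset_f; rewrite inE.
have lt k : (k <= N)%N -> (#|W k.+1| < #|W k|)%N.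
  move=> le; rewrite ltn_neqAle WS leq_imset_card andbT.
  apply: contra nxy => /imset_injP inj; apply/eqP; apply: inj => //; exact: WN.
have bound k : (k <= N.+1)%N -> (#|W k| + k <= N.+1)%N.
  elim: k => [|k IH] le; first by rewrite addn0 (leq_trans (max_card _)).
  by have := lt k le; have := IH (ltnW le); lia.
have : (0 < #|W N.+1|)%N.
  by apply/card_gt0P; exists (iter N.+1 f x); apply: imset_f; rewrite inE.
by have := bound N.+1 (leqnn _); lia.
Qed.

Section Coresolution.
Variables (K : fieldType) (R : pzRingType) (kap : {rmorphism K -> R}).
Variable b : nakayama_basis kap.

Notation V := (nb_vertex b).
Notation s := (nb_next b).
Notation len := (nb_len b).
Notation bnd := (nb_bound b).
Let kapC := nb_central b.

Variable I : min_inj_coresolution (regular_module R).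

(** Also the kernel of the map that leaves the [j]-th term. *)
Definition cosyzygy j : I j -> Prop :=
  match j with
  | 0 => fun x => exists m, cores_aug I m = x
  | j.+1 => fun x => exists y, cores_diff I j y = x
  end.

Lemma cosyzygyP j (x : I j) : cores_diff I j x = 0 <-> cosyzygy x.
Proof. by case: j x => [|j] x; [exact: cores_exact0 | exact: cores_exactS]. Qed.

Lemma cosyzygy_lin j r (x y : I j) : cosyzygy x -> cosyzygy y -> cosyzygy (r *: x + y).
Proof.
by move=> /cosyzygyP dx /cosyzygyP dy; apply/cosyzygyP; rewrite linearP dx dy scaler0 addr0.
Qed.

Lemma cosyzygy0 j : cosyzygy (0 : I j).
Proof. by apply/cosyzygyP; rewrite linear0. Qed.

Lemma cosyzygyD j (x y : I j) : cosyzygy x -> cosyzygy y -> cosyzygy (x + y).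
Proof. by move=> zx zy; rewrite -[x]scale1r; apply: cosyzygy_lin. Qed.

Lemma cosyzygyZ j r (x : I j) : cosyzygy x -> cosyzygy (r *: x).
Proof. by move=> zx; rewrite -[_ *: _]addr0; apply: cosyzygy_lin => //; apply: cosyzygy0. Qed.

Lemma cosyzygyB j (x y : I j) : cosyzygy x -> cosyzygy y -> cosyzygy (x - y).
Proof. by move=> zx zy; apply: cosyzygyD => //; rewrite -scaleN1r; apply: cosyzygyZ. Qed.

Lemma cosyzygy_diff j (x : I j) : cosyzygy (cores_diff I j x).
Proof. by exists x. Qed.

Lemma cosyzygy_sum j (F : V -> I j) : (forall y, cosyzygy (F y)) -> cosyzygy (\sum_y F y).
Proof.
by move=> zF; apply: (big_ind (@cosyzygy j)) => //; [exact: cosyzygy0 | exact: cosyzygyD].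
Qed.

Lemma cosyzygy_essential j (S : {pred I j}) : submod_closed S ->
  (exists2 y, y \in S & y <> 0) -> exists x, [/\ x \in S, cosyzygy x & x <> 0].
Proof.
case: j S => [|j] S Sc ne.
  by have [x] := cores_minimal0 Sc ne; exists (cores_aug I x); split=> //; exists x.
by have [x] := cores_minimalS Sc ne; exists (cores_diff I j x); split=> //; exists x.
Qed.

(** The radical of the cosyzygy, as the sum of its multiples by arrows. *)
Definition rad_cosyzygy j (x : I j) : Prop :=
  exists w : V -> I j, (forall y, cosyzygy (w y)) /\ x = \sum_y b y 1%N *: w y.

Lemma rad_cosyzygy_path j y l (x : I j) : cosyzygy x -> rad_cosyzygy (b y l.+1 *: x).
Proof.
move=> zx; exists (fun z => if z == iter l s y then b y l *: x else 0); split.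
  by move=> z; case: ifP => _; [apply: cosyzygyZ | apply: cosyzygy0].
rewrite (bigD1 (iter l s y)) //= eqxx big1 ?addr0 => [|z /negPf ->]; last by rewrite scaler0.
by rewrite scalerA path_mul addn1.
Qed.

Lemma rad_cosyzygyD j (x y : I j) : rad_cosyzygy x -> rad_cosyzygy y -> rad_cosyzygy (x + y).
Proof.
case=> w [zw ->] [w' [zw' ->]]; exists (fun z => w z + w' z); split.
  by move=> z; apply: cosyzygyD.
by rewrite -big_split /=; apply: eq_bigr => z _; rewrite scalerDr.
Qed.

Lemma rad_cosyzygy_sub j (x : I j) : rad_cosyzygy x -> cosyzygy x.
Proof. by case=> w [zw ->]; apply: cosyzygy_sum => y; apply: cosyzygyZ. Qed.

(** The element [m] generates a uniserial module with top [v] and length [l], and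
    no element congruent to it modulo the radical generates a shorter one. This
    stands in for the information that [m] generates a direct summand of the
    cosyzygy, and it passes from one cosyzygy to the next without decomposing them. *)
Definition longest j (v : V) (l : nat) (m : I j) : Prop :=
  [/\ cosyzygy m, b v 0%N *: m = m, b v l *: m = 0 &
    forall m', cosyzygy m' -> rad_cosyzygy (m - m') -> b v l.-1 *: m' <> 0].

(** An element congruent to [b x 0] modulo the radical has the same coefficient at
    the trivial path, hence the same length. *)
Lemma longest_start x : longest x (len x) (cores_aug I (b x 0%N : R^o)).
Proof.
split.
- by exists (b x 0%N : R^o).
- by rewrite -linearZ /= /GRing.scale /= path_idem.
- by rewrite path0 ?scale0r.
move=> _ [a <-] [w [zw]]; have lx := nb_len_gt0 b x.
pose c y := projT1 (cid (zw y)).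
have cE y : cores_aug I (c y) = w y := projT2 (cid (zw y)).
rewrite -linearB; have -> : \sum_y b y 1%N *: w y =
    cores_aug I (\sum_y b y 1%N *: c y).
  by rewrite linear_sum; apply: eq_bigr => y _; rewrite linearZ cE.
move/cores_aug_inj => e; rewrite -linearZ -(linear0 (cores_aug I)) => /cores_aug_inj a0.
have : coef (b x (len x).-1 * b x 0%N) x (len x).-1 =
       coef (b x (len x).-1 * \sum_y b y 1%N * (c y : R)) x (len x).-1.
  congr coef; have -> : \sum_y b y 1%N * (c y : R) = b x 0%N - (a : R) := esym e.
  by rewrite mulrBr (_ : _ * (a : R) = 0) ?subr0.
rewrite path_start coef_path !eqxx prednK // leqnn coef_mulL leqnn prednK // leqnn subnn /= eqxx.
rewrite coef_sum big1 => [/eqP|y _]; first by rewrite oner_eq0.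
by rewrite coef_mulL.
Qed.

(** A functional detects the socle of the module generated by [m], so this module
    embeds in a projective; take the largest such projective, at [z], in which it
    is the part beyond length [k]. By injectivity [m] is then a multiple
    [b z k u], and the next element is the image of [u]. If something congruent
    to this image were killed by [b z (k-1)], then [m] would be congruent to an
    element divisible by a path of length [k+1], which is too short because the
    projective at [z] cannot be extended. *)
Lemma longest_step j v l (m : I j) : (0 < l)%N -> longest v l m ->
  projective_module (I j) ->
  exists z k, [/\ iter k s z = v, len z = (k + l)%N, unextendable z &
    (0 < k)%N -> exists m' : I j.+1, longest z k m'].
Proof.
move=> l0 [zm mv ml mlong] Ip.
have nz : b v l.-1 *: m != 0.
  apply/eqP; apply: mlong => //; exists (fun=> 0); split; first by move=> _; apply: cosyzygy0.
  by rewrite subrr big1 // => y _; rewrite scaler0.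
(* A path occurring in the value a of the functional gives a projective that
   contains the module generated by m. *)
have [f fm] := projective_functional Ip nz; pose a : R := f m.
have fa r : f (r *: m) = r * a :> R by rewrite linearZ.
pose Q k := [exists x, (iter k s x == v) && (len x == k + l)%N].
have Qex : exists k, Q k.
  apply: contrapT => n; move/eqP: fm; apply.
  rewrite [LHS]fa (coefE b a) mulr_sumr big1 // => x _; rewrite mulr_sumr big1 // => k _.
  rewrite mulrA -kapC -mulrA nb_mul; case: eqP => [e|_]; last by rewrite mulr0.
  have [le|lt] := leqP (len x) (k + l.-1); first by rewrite path0 ?mulr0.
  have lt' : (k < len x)%N by lia.
  have [c0|cn] := eqVneq (coef a x k) 0; first by rewrite c0 rmorph0 mul0r.
  case: n; exists (k : nat); apply/existsP; exists x; rewrite -e eqxx /=.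
  have : coef (b v l * a) x (k + l) = 0 by rewrite -fa ml linear0 coef0.
  rewrite coef_mulL leq_addl addnK -e eqxx andbT /=.
  by case: ltnP => [_ c0|ge _]; [rewrite c0 eqxx in cn | apply/eqP; lia].
have Qb k : Q k -> (k <= bnd)%N.
  by case/existsP => x /andP[_ /eqP e]; have := nb_len_bound b x; lia.
have [k /existsP[z /andP[/eqP zk /eqP zl]] kmax] := ex_maxnP Qex Qb.
have hz : unextendable z.
  rewrite /unextendable leqNgt; apply/negP => lt; have /kmax : Q k.+1; last by rewrite ltnn.
  apply/existsP; exists (back 1 z).
  have sz : s (back 1 z) = z := iter_back 1 z.
  have le := len_next1 (back 1 z); rewrite sz in le.
  by rewrite iterSr sz zk eqxx andTb; apply/eqP; lia.
exists z, k; split=> // k0.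
have [||u [uz um]] := injective_divide (z := z) (k := k) (m := m) (@cores_term_injective _ _ I j).
- by rewrite zk.
- by rewrite zk zl addKn.
exists (cores_diff I j u); split.
- exact: cosyzygy_diff.
- by rewrite -linearZ uz.
- by rewrite -linearZ um; apply/cosyzygyP.
move=> _ [u' <-] [w [zw]] e /eqP; rewrite -linearZ => /eqP/cosyzygyP zu'.
pose c y := projT1 (cid (zw y)).
have cE y : cores_diff I j (c y) = w y := projT2 (cid (zw y)).
(* By hypothesis u - u' is a sum of multiples of arrows up to the kernel. *)
pose q := u - u' - \sum_y b y 1%N *: c y.
have zq : cosyzygy q.
  apply/cosyzygyP; rewrite !linearB e linear_sum; apply/eqP; rewrite subr_eq0; apply/eqP.
  by apply: eq_bigr => y _; rewrite linearZ cE.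
pose y := back 1 z; have sy : iter 1 s y = z := iter_back 1 z.
pose m' := b y k.+1 *: c y.
have bzk (x : I j) : b z k *: x = b (iter k.-1 s z) 1%N *: (b z k.-1 *: x).
  by rewrite scalerA path_mul addn1 prednK.
have byz : b z k * b y 1%N = b y k.+1 by rewrite -{1}sy path_mul add1n.
have mm' : m - m' = b z k *: u' + b z k *: q.
  rewrite /q !scalerBr um scaler_sumr (bigD1 y) //= [X in _ - (_ + X)]big1 => [|x ne].
    by rewrite scalerA byz -/m' addr0 addrA [_ + (m - _)]addrCA subrr addr0.
  rewrite scalerA path_mul0 ?scale0r // -{1}sy.
  by apply: contra ne => /eqP /(@iter_next_inj _ _ _ b 1) ->.
have rmm' : rad_cosyzygy (m - m').
  rewrite mm'; apply: rad_cosyzygyD; last by rewrite -(prednK k0); apply: rad_cosyzygy_path.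
  by rewrite bzk; apply: rad_cosyzygy_path.
have zm' : cosyzygy m' by rewrite -(subKr m m'); apply: cosyzygyB => //; apply: rad_cosyzygy_sub.
apply: (mlong m' zm' rmm'); rewrite /m' scalerA.
have -> : v = iter k.+1 s y by rewrite -zk -sy -iterD addn1.
by rewrite path_mul path0 ?scale0r //; move: hz; rewrite /unextendable -/y; lia.
Qed.

(** The uniserials of top [v j] and length [l j] are the cosyzygies of the
    projective at [x]. The chain does not stop: a cosyzygy of length 0 would mean
    that the previous one is an unextendable projective, whereas the projective
    at [x] is extendable and its later cosyzygies are proper quotients of
    projectives. *)
Lemma cosyzygy_chain (x : V) J : ~~ unextendable x -> (forall i, (i < J)%N -> projective_module (I i)) ->
  exists (v : nat -> V) (l : nat -> nat),
    [/\ v 0%N = x, l 0%N = len x, forall j, (j <= J)%N -> (0 < l j)%N,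
       forall j, (j < J)%N -> iter (l j.+1) s (v j.+1) = v j /\ len (v j.+1) = (l j.+1 + l j)%N
     & exists m : I J, longest (v J) (l J) m].
Proof.
move=> nx; elim: J => [|J IH] Ip.
  exists (fun=> x), (fun=> len x); split=> // [j _|]; first exact: nb_len_gt0.
  by exists (cores_aug I (b x 0%N : R^o)); apply: longest_start.
have [|v [l [v0 l0 lpos vl [m mL]]]] := IH; first by move=> i lt; apply: Ip; apply: ltnW.
have [z [k [zk zl hz zm]]] := longest_step (lpos J (leqnn J)) mL (Ip J (leqnn _)).
have k0 : (0 < k)%N.
  rewrite lt0n; apply/negP => /eqP k0; rewrite k0 add0n in zk zl.
  have {}zk : z = v J by [].
  case: J v0 l0 lpos vl zk zl {IH Ip m mL zm} => [|J] v0 l0 lpos vl zk zl.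
    by move/negP: nx; apply; rewrite -v0 -zk.
  have [_ e] := vl J (leqnn _); have := lpos J (leqnSn J).
  by rewrite -zk zl in e; lia.
have [m' m'L] := zm k0.
exists (fun i => if (i <= J)%N then v i else z), (fun i => if (i <= J)%N then l i else k).
split=> //=.
- by move=> j le; case: ifP => // lej; apply: lpos.
- move=> j; rewrite ltnS => le; case: (eqVneq j J) => [->|ne].
    by rewrite leqnn ltnn.
  have lt : (j < J)%N by rewrite ltn_neqAle ne.
  by rewrite lt le; apply: vl.
by rewrite ltnn; exists m'.
Qed.

(** The map [f] sends [z] to the successor of the socle of the projective at [z].
    The chain gives [f (v 1) = f (v 0)] and [f (v (j+2)) = v j], which puts [v 0]
    and [v 1] into the stable image of [f], so they coincide; but then the first
    cosyzygy would have length 0. *)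
Lemma not_all_projective n (x : V) : (0 < n)%N -> (#|V| <= n)%N -> ~~ unextendable x ->
  ~ (forall i, (i <= 2 * n - 2)%N -> projective_module (I i)).
Proof.
move=> n0 cV nx Ip.
have [|v [l [v0 l0 lpos vl _]]] := @cosyzygy_chain x (2 * n - 1) nx.
  by move=> i lt; apply: Ip; lia.
pose f z := iter (len z) s z.
have f1 : f (v 1%N) = f (v 0%N).
  have [|e1 e2] := vl 0%N; first by lia.
  by rewrite /f e2 addnC iterD e1 v0 l0.
have f2 j : (j.+1 < 2 * n - 1)%N -> f (v j.+2) = v j.
  move=> lt; have [e1 e2] := vl _ lt; have [e3 _] := vl j (ltnW lt).
  by rewrite /f e2 addnC iterD e1 e3.
have it i a : (a <= 1)%N -> (i <= n.-1)%N -> iter i f (v (2 * i + a)%N) = v a.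
  move=> a1; elim: i => [|i IH] le; first by rewrite muln0.
  rewrite iterSr (_ : 2 * i.+1 + a = (2 * i + a).+2)%N; last by lia.
  by rewrite f2 ?IH //; lia.
have cV' : (#|V| <= n.-1.+1)%N by rewrite prednK.
have := @eventual_image_inj V f n.-1 cV' (v (2 * n.-1 + 1)%N) (v (2 * n.-1 + 0)%N).
rewrite !it // => /(_ f1) e.
have [|e1 e2] := vl 0%N; first by lia.
have := lpos 1%N; rewrite e l0 -v0 in e2 *.
by lia.
Qed.

(** * Vanishing of extensions of a simple module *)

Section LowerBound.
Variables (v : V) (q : nat -> V) (k : nat -> nat) (L : nat).
Hypotheses (q0 : q 0%N = v) (k0 : k 0%N = 1%N).
Hypothesis qS : forall i, q i.+1 = iter (k i) s (q i).
Hypothesis kS : forall i, k i.+1 = (len (q i) - k i)%N.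

(** The simple module at [v] is resolved by the projectives at [q 0 = v], [q 1],
    ..., the maps being multiplication by the paths [b (q i) (k i)]. Maps from the
    projective at [q i] to a module are its elements at the vertex [q i], so this
    is the vanishing of the [i]-th extension group. *)
Definition exact_at (M : lmodType R) (Z : M -> Prop) i : Prop :=
  forall z, Z z -> b (q i) 0%N *: z = z -> b (q i) (k i) *: z = 0 ->
    match i with
    | 0 => z = 0
    | i'.+1 => exists z', [/\ Z z', b (q i') 0%N *: z' = z' & z = b (q i') (k i') *: z']
    end.

(** The line spanned by a socle element is a submodule, so by minimality it meets
    the cosyzygy. *)
Lemma socle_cosyzygy j (u : I j) : b v 0%N *: u = u -> b v 1%N *: u = 0 -> cosyzygy u.
Proof.
move=> uv u0; case: (EM (u = 0)) => [->|un]; first exact: cosyzygy0.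
have ur r : r *: u = kap (coef r v 0) *: u.
  rewrite (scale_at _ uv).
  have bpos : (0 < bnd)%N by apply: leq_trans (nb_len_gt0 b v) (nb_len_bound b v).
  rewrite (bigD1 (Ordinal bpos)) //= uv big1 ?addr0 // => [[[|l] lt]] // _ /=.
  by rewrite (path_kill u0) ?scaler0.
have [|| x [/mem_asbool[c ->] zx x0]] :=
  @cosyzygy_essential j [pred y | `[< exists c : K, y = kap c *: u >]].
- apply: asbool_submod; first by exists 0; rewrite rmorph0 scale0r.
  move=> r _ _ [c ->] [d ->]; exists (coef (r * kap c) v 0 + d).
  by rewrite scalerA [(r * _) *: u]ur rmorphD scalerDl.
- by exists u => //; apply/mem_asbool; exists 1; rewrite rmorph1 scale1r.
have cn : c != 0 by apply/eqP => c0; apply: x0; rewrite c0 rmorph0 scale0r.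
rewrite -[u]scale1r -(rmorph1 kap) -(mulVf cn) rmorphM -scalerA.
exact: cosyzygyZ.
Qed.

(** Dimension shifting: the middle term has no higher extensions, being
    injective; in degree 0 minimality is used instead. *)
Lemma exact_shift i j : exact_at (@cosyzygy j) i.+1 -> exact_at (@cosyzygy j.+1) i.
Proof.
move=> ex _ [w <-] wq wk.
pose w' := b (q i) 0%N *: w.
have dw' : cores_diff I j w' = cores_diff I j w by rewrite linearZ.
have w'q : b (q i) 0%N *: w' = w' by rewrite /w' scalerA path_idem.
have zy : cosyzygy (b (q i) (k i) *: w') by apply/cosyzygyP; rewrite linearZ dw'.
have [||z' [zz' z'q e]] := ex _ zy.
- by rewrite qS scalerA path_end.
- rewrite qS scalerA path_mul path0 ?scale0r // kS; lia.
have ku : b (q i) (k i) *: (w' - z') = 0 by rewrite scalerBr e subrr.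
have qu : b (q i) 0%N *: (w' - z') = w' - z' by rewrite scalerBr w'q z'q.
have du : cores_diff I j (w' - z') = cores_diff I j w.
  by rewrite linearB dw'; have /cosyzygyP -> := zz'; rewrite subr0.
case: i => [|i] in ex wq wk w' dw' w'q zy z' zz' z'q e ku qu du *.
  rewrite q0 k0 in ku qu; rewrite -du; apply/cosyzygyP; exact: socle_cosyzygy.
have [||u [uq ue]] := injective_divide (z := q i) (k := k i) (m := w' - z')
    (@cores_term_injective _ _ I j).
- by rewrite -qS.
- by rewrite -qS -kS.
exists (cores_diff I j u); split.
- exact: cosyzygy_diff.
- by rewrite -linearZ uq.
by rewrite -linearZ ue du.
Qed.

Lemma exact_zero : (forall i, (i <= L)%N -> exact_at (@cosyzygy 0) i) ->
  forall i j, (i + j <= L)%N -> exact_at (@cosyzygy j) i.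
Proof.
move=> ex0 i j; elim: j i => [|j IH] i le; first by apply: ex0; rewrite addn0 in le.
by apply: exact_shift; apply: IH; rewrite addSnnS.
Qed.

Lemma projective_terms : (forall i, (i <= L)%N -> exact_at (@cosyzygy 0) i) ->
  (forall v', v' != v -> exists2 z, proj_socle z = v' & unextendable z) ->
  forall j, (j <= L)%N -> projective_module (I j).
Proof.
move=> ex0 good j le; apply: injective_projective; first exact: cores_term_injective.
move=> v' m m0 mv m1; apply: good; apply/eqP => e; rewrite e in mv m1.
apply: m0; have ex := exact_zero ex0 (i := 0) (j := j) le.
by apply: ex; rewrite ?q0 ?k0 //; apply: socle_cosyzygy.
Qed.

(** Multiplication by a path permutes paths or kills them, so both the kernel of
    [b (q i) (k i)] and the multiples of the previous path are spanned by paths. *)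
Lemma path_exact i : (forall x l, (l < len x)%N -> iter l s x = q i ->
    (len x <= l + k i)%N -> (0 < i)%N && (k i.-1 <= l)%N) ->
  exact_at (@cosyzygy 0) i.
Proof.
move=> cond _ [a <-]; rewrite -!linearZ.
move=> /cores_aug_inj aq; rewrite -(linear0 (cores_aug I)) => /cores_aug_inj ak.
have key x l : coef (a : R) x l != 0 -> (0 < i)%N && (k i.-1 <= l)%N && (iter l s x == q i).
  move=> cn; have lt : (l < len x)%N.
    by rewrite ltnNge; apply: contraNN cn => ge; rewrite coef_ge.
  have lq : iter l s x = q i.
    apply/eqP/negPn/negP => ne; move/eqP: cn; apply.
    rewrite -aq /GRing.scale /= coef_mulL /= subn0 eq_sym (negPf ne).
    by rewrite andbF.
  rewrite lq eqxx andbT; apply: (cond x l lt lq).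
  rewrite leqNgt; apply/negP => lt'; move/eqP: cn; apply.
  have : coef (b (q i) (k i) *: a : R) x (l + k i) = 0 by rewrite ak coef0.
  by rewrite /GRing.scale /= coef_mulL leq_addl lt' addnK lq eqxx.
case: i => [|i] in cond aq ak key *.
  congr (cores_aug I _); rewrite (coefE b (a : R)).
  rewrite big1 // => x _; rewrite big1 // => l _.
  case: (eqVneq (coef (a : R) x l) 0) => [->|/key//]; by rewrite rmorph0 mul0r.
pose a' : R := \sum_x \sum_(l < bnd) kap (coef (a : R) x l) * b x (l - k i)%N.
exists (cores_aug I (b (q i) 0%N * a' : R^o)); split.
- by exists (b (q i) 0%N * a' : R^o).
- by rewrite -linearZ /= /GRing.scale /= mulrA path_idem.
rewrite -linearZ; congr (cores_aug I _); rewrite /= /GRing.scale /= mulrA path_start.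
rewrite [LHS](coefE b (a : R)) mulr_sumr; apply: eq_bigr => x _.
rewrite mulr_sumr; apply: eq_bigr => l _.
case: (eqVneq (coef (a : R) x l) 0) => [->|/key/andP[/= le /eqP lq]].
  by rewrite rmorph0 !mul0r mulr0.
rewrite mulrA -kapC -mulrA; congr (_ * _).
have -> : q i = iter (l - k i) s x.
  by apply: (@iter_next_inj _ _ _ b (k i)); rewrite -qS -lq -iterD subnKC.
by rewrite path_mul subnK.
Qed.

End LowerBound.
End Coresolution.

(** * Path bases and dominant dimension *)

(** The same table for an algebra, with products written in the order in which
    arrows are traversed. *)
Record path_basis (K : fieldType) (A : falgType K) := PathBasis {
  pb_vertex : finType;
  pb_next : {perm pb_vertex};
  pb_len : pb_vertex -> nat;
  pb_path :> pb_vertex -> nat -> A;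
  pb_bound : nat;
  pb_mul : forall x k y l, pb_path x k * pb_path y l =
    if y == iter k pb_next x then pb_path x (k + l)%N else 0;
  pb_eq0 : forall x k, (pb_path x k == 0) = (pb_len x <= k)%N;
  pb_one : \sum_x pb_path x 0%N = 1;
  pb_len_gt0 : forall x, (0 < pb_len x)%N;
  pb_len_bound : forall x, (pb_len x <= pb_bound)%N;
  pb_span : forall a, exists f : pb_vertex -> nat -> K,
    a = \sum_x \sum_(k < pb_bound) f x k *: pb_path x k }.

Arguments pb_len {K A} p x.
Arguments pb_path {K A} p x k.
Arguments pb_eq0 {K A} p x k.
Arguments pb_mul {K A} p x k y l.
Arguments pb_len_gt0 {K A} p x.
Arguments pb_len_bound {K A} p x.

Section TwoSides.
Variables (K : fieldType) (A : falgType K).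

Definition scal_op (c : K) : A^c := c%:A.

Lemma scal_op_zmod : zmod_morphism scal_op.
Proof. by move=> c d; exact: (scalerBl c d (1 : A)). Qed.

Lemma scal_op_monoid : monoid_morphism scal_op.
Proof.
split; first exact: scale1r.
move=> c d; have e : (c * d)%:A = d%:A * c%:A :> A.
  by rewrite -scalerAl mul1r scalerA mulrC.
exact: e.
Qed.

HB.instance Definition _ := GRing.isZmodMorphism.Build K A^c scal_op scal_op_zmod.
HB.instance Definition _ := GRing.isMonoidMorphism.Build K A^c scal_op scal_op_monoid.

Variable p : path_basis A.
Notation V := (pb_vertex p).
Notation s := (pb_next p).
Notation len := (pb_len p).
Notation bnd := (pb_bound p).

Definition right_basis : nakayama_basis scal_op.
Proof.
apply: (@NakayamaBasis K A^c scal_op V s len (pb_path p) bnd).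
- move=> c r; have e : (r : A) * c%:A = c%:A * (r : A).
    by rewrite -scalerAr -scalerAl mulr1 mul1r.
  exact: e.
- by move=> x k y l; exact: (pb_mul p x k y l).
- exact: (pb_eq0 p).
- exact: (pb_one p).
- exact: (pb_len_gt0 p).
- exact: (pb_len_bound p).
move=> r; have [f e] := pb_span p r; exists f; rewrite [LHS]e.
apply: eq_bigr => x _; apply: eq_bigr => k _.
have e' : f x k *: pb_path p x k = pb_path p x k * (f x k)%:A.
  by rewrite -scalerAr mulr1.
exact: e'.
Defined.

Let bk k (y : V) : V := iter k (s^-1)%g y.

Lemma pb_back k x : iter k s (bk k x) = x.
Proof. exact: (@iter_prevK K A^c scal_op right_basis k x). Qed.
Lemma pb_forth k x : bk k (iter k s x) = x.
Proof. exact: (@iter_nextK K A^c scal_op right_basis k x). Qed.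

Lemma left_len_ex y : exists k, p (bk k y) k == 0.
Proof. by exists bnd; rewrite pb_eq0 pb_len_bound. Qed.

Definition left_len y := ex_minn (left_len_ex y).

Lemma left_eq0 y k : (p (bk k y) k == 0) = (left_len y <= k)%N.
Proof.
rewrite /left_len; case: ex_minnP => m pm mmin; apply/idP/idP; first exact: mmin.
move=> le; rewrite -(subnK le) /bk iterD -/(bk m y).
have := pb_mul p (bk (k - m) (bk m y)) (k - m) (bk m y) m.
by rewrite pb_back eqxx => <-; rewrite (eqP pm) mulr0.
Qed.

(** For left modules the paths are indexed by their end and followed backwards. *)
Definition left_basis : nakayama_basis (in_alg A).
Proof.
apply: (@NakayamaBasis K A (in_alg A) V (s^-1)%g left_len (fun y k => p (bk k y) k) bnd).
- by move=> c r; rewrite /= -scalerAl -scalerAr mul1r mulr1.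
- move=> x k y l; rewrite pb_mul pb_back eq_sym -/(bk k x); case: eqP => // ->.
  by rewrite /bk -iterD addnC.
- exact: left_eq0.
- exact: (pb_one p).
- by move=> y; rewrite ltnNge -left_eq0 pb_eq0 -ltnNge pb_len_gt0.
- by move=> y; rewrite -left_eq0 pb_eq0 pb_len_bound.
move=> a; have [f ->] := pb_span p a; exists (fun y k => f (bk k y) k).
rewrite exchange_big [RHS]exchange_big /=; apply: eq_bigr => k _.
rewrite (reindex (bk k)) /=; last first.
  by exists (iter k s) => x _; rewrite ?pb_back ?pb_forth.
by apply: eq_bigr => y _; rewrite mulr_algl.
Defined.

Lemma path_basis_nakayama : nakayama A.
Proof.
split=> P Pi Pp.
  exact: (@indecomposable_projective_uniserial _ _ _ left_basis).
exact: (@indecomposable_projective_uniserial _ _ _ right_basis).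
Qed.

End TwoSides.

Section DominantDimension.
Variables (R : pzRingType) (M : fgModule R).

Lemma sup_exists (S : nat -> Prop) : exists d, is_sup S d.
Proof.
case: (EM (exists N, forall m, S m -> (m <= N)%N)) => [[N SN]|unb].
  case: (EM (exists m, S m)) => [exS|noS].
    pose P m := `[< S m >].
    have exP : exists m, P m by have [m Sm] := exS; exists m; apply/asboolP.
    have ubP m : P m -> (m <= N)%N by move=> /asboolP; apply: SN.
    have [d /asboolP Sd dmax] := ex_maxnP exP ubP.
    exists (Some d); split=> [m Sm|t]; first by apply: dmax; apply/asboolP.
    by apply.
  exists (Some 0%N); split=> [m Sm|[t|] _ //]; by case: noS; exists m.
exists None; split=> // [[N|//]] le; case: unb; exists N; exact: le.
Qed.

Variable I : min_inj_coresolution M.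

Lemma coresolution_domdim_exists : exists d, coresolution_domdim I d.
Proof.
case: (EM (projective_module (I 0%N))) => [I0|nI0].
  have [t tS] := sup_exists (fun m => forall i, (i <= m)%N -> projective_module (I i)).
  by exists (omap succn t); right; split=> //; exists t.
by exists (Some 0%N); left.
Qed.

Lemma coresolution_domdim_le d N : coresolution_domdim I d ->
  ~ (forall i, (i <= N)%N -> projective_module (I i)) -> le_enat d (Some N).
Proof.
move=> [[_ ->] //|[I0 [t [tub tmin] ->]]] nI.
have lt m : (forall i, (i <= m)%N -> projective_module (I i)) -> (m < N)%N.
  by move=> Im; rewrite ltnNge; apply/negP => le; apply: nI => i /leq_trans/(_ le)/Im.
have N0 : (0 < N)%N by apply: lt => i; rewrite leqn0 => /eqP ->.
have := tmin (Some N.-1); case: t {tub tmin} => [t|] /= h.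
  by rewrite -(prednK N0) ltnS; apply: h => m /lt; lia.
by apply: h => m /lt; lia.
Qed.

Lemma coresolution_domdim_eq d N : coresolution_domdim I d ->
  ~ (forall i, (i <= N)%N -> projective_module (I i)) ->
  (forall i, (i < N)%N -> projective_module (I i)) -> d = Some N.
Proof.
move=> dI nI Ip; have := coresolution_domdim_le dI nI.
case: dI => [[nI0 ->] _|[I0 [t [tub _] ->]]].
  by case: N nI Ip => // N _ Ip; case: nI0; apply: Ip.
case: N nI Ip => [|N] nI Ip; first by case: nI => i; rewrite leqn0 => /eqP ->.
case: t tub => [t|] //= tub; rewrite ltnS => le; congr (Some _.+1).
by apply/eqP; rewrite eqn_leq le /=; apply: tub => i; apply: Ip.
Qed.

End DominantDimension.

(** A minimal coresolution exists, so the set that defines the dominant dimension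
    is not empty. *)
Lemma domdim_attained (K : fieldType) (A : falgType K) : path_basis A ->
  exists I : min_inj_coresolution (right_regular A), coresolution_domdim I (domdim A).
Proof.
move=> p; have [I] := coresolution_exists (right_basis p) (right_regular A).
have [d dI] := coresolution_domdim_exists I.
apply: (@classical_sets.xgetPex _ _ (fun d => exists J : min_inj_coresolution (right_regular A),
  coresolution_domdim J d)).
by exists d, I.
Qed.

(** * From bound quivers to path bases *)

(** The complements of the two images have the same size; match their lists of
    elements. *)
Lemma perm_extension (T U : finType) (f g : U -> T) : injective f -> injective g ->
  exists t : {perm T}, forall u, t (f u) = g u.
Proof.
move=> fI gI; pose D := [set f u | u : U]%SET; pose D' := [set g u | u : U]%SET.
have cD : size (enum (~: D)%SET) = size (enum (~: D')%SET).
  rewrite -!cardE; apply: (@addnI #|D|); rewrite cardsC.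
  by rewrite card_imset // -(card_imset _ gI) cardsC.
pose h x := if [pick u | f u == x] is Some u then g u
            else nth x (enum (~: D')%SET) (index x (enum (~: D)%SET)).
have hf u : h (f u) = g u.
  by rewrite /h; case: pickP => [v /eqP/fI ->|/(_ u)]; rewrite ?eqxx.
have hn x : x \notin D -> h x = nth x (enum (~: D')%SET) (index x (enum (~: D)%SET)) /\
    (index x (enum (~: D)%SET) < size (enum (~: D')%SET))%N.
  move=> xD; split; last by rewrite -cD index_mem mem_enum inE.
  rewrite /h; case: pickP => // u /eqP e; case/negP: xD; rewrite -e.
  by apply: imset_f.
have hn' x : x \notin D -> h x \notin D'.
  move=> /hn[-> lt]; have := mem_nth x lt; by rewrite mem_enum inE.
have hI : injective h.
  move=> x y; case: (boolP (x \in D)) => [/imsetP[u _ ->]|xD];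
    case: (boolP (y \in D)) => [/imsetP[v _ ->]|yD].
  - by rewrite !hf => /gI ->.
  - by rewrite hf => e; have := hn' _ yD; rewrite -e imset_f.
  - by rewrite hf => e; have := hn' _ xD; rewrite e imset_f.
  have [-> lx] := hn x xD; have [-> ly] := hn y yD.
  rewrite (set_nth_default y) // => /eqP; rewrite nth_uniq ?enum_uniq // => /eqP e.
  by rewrite -(nth_index x (_ : x \in enum (~: D)%SET)) ?mem_enum ?inE // e
    nth_index // mem_enum inE.
by exists (perm hI) => u; rewrite permE.
Qed.

Lemma corner_idem (T : pzRingType) (e f : T) :
  e * e = e -> e * (f * e) = e * (e * (f * e) * e).
Proof. by move=> ee; rewrite -!mulrA ee [in RHS]mulrA ee. Qed.

Lemma corner_compl (T : pzRingType) (e f : T) :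
  e * e = e -> f = e * (f * e) -> e - f = e * ((e - f) * e).
Proof. by move=> ee fe; rewrite mulrBl ee mulrBr -fe ee. Qed.

Section PathAlgebra.
Variables (K : fieldType) (Q : quiver).
Implicit Types (f g h : pathalg K Q) (q r : qpath Q).

Definition path_elt q : pathalg K Q := pathalg_basis 1 (Some q).

Lemma path_elt_coef q r : (path_elt q)@_r = (q == r)%:R :> K.
Proof. by rewrite /path_elt /= mcoeffU. Qed.

Lemma pathalg_mulE f g : f * g = pathalg_mul f g. Proof. by []. Qed.

Lemma path_elt_mul q r : path_elt q * path_elt r = pathalg_basis 1 (path_comp q r).
Proof. by rewrite pathalg_mulE pathalg_basisM mul1r. Qed.

Lemma pcoefD f g q : (f + g)@_q = f@_q + g@_q. Proof. exact: mcoeffD. Qed.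
Lemma pcoefZ c f q : (c *: f)@_q = c * f@_q. Proof. exact: mcoeffZ. Qed.
Lemma pcoef0 q : (0 : pathalg K Q)@_q = 0. Proof. exact: mcoeff0. Qed.
Lemma pcoefB f g q : (f - g)@_q = f@_q - g@_q. Proof. exact: mcoeffB. Qed.
Lemma pcoef_sum (J : Type) (s : seq J) (P : pred J) (F : J -> pathalg K Q) q :
  (\sum_(j <- s | P j) F j)@_q = \sum_(j <- s | P j) (F j)@_q.
Proof. exact: (big_morph (fun f => f@_q) (fun f g => pcoefD f g q) (pcoef0 q)). Qed.

Lemma pcoef_eq f g : (forall q, f@_q = g@_q) -> f = g.
Proof. by move=> e; apply/malgP. Qed.

Lemma pcoef_basis c (o : option (qpath Q)) q :
  (pathalg_basis c o : pathalg K Q)@_q = c *+ (o == Some q).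
Proof. by case: o => [r|] /=; [rewrite mcoeffU | exact: pcoef0]. Qed.

Lemma pathalg_basisZ c (o : option (qpath Q)) :
  pathalg_basis c o = c *: (pathalg_basis 1 o : pathalg K Q).
Proof.
apply: pcoef_eq => q.
rewrite [RHS]pcoefZ.
rewrite [LHS]pcoef_basis.
rewrite pcoef_basis.
by rewrite mulr_natr.
Qed.

Lemma pathalg_sum f : f = \sum_(q <- msupp f) f@_q *: path_elt q.
Proof. by rewrite [LHS]pathalgE; apply: eq_bigr => q _; exact: pathalg_basisZ. Qed.

Lemma pcoef_mul f g q : (f * g)@_q =
  \sum_(p <- msupp f) \sum_(r <- msupp g) (f@_p * g@_r) *+ (path_comp p r == Some q).
Proof.
rewrite pathalg_mulE /pathalg_mul pcoef_sum; apply: eq_bigr => p _.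
by rewrite pcoef_sum; apply: eq_bigr => r _; rewrite pcoef_basis.
Qed.

Local Opaque pathalg_mul.

Lemma pcoef_mul0 f g q :
  (forall p r, path_comp p r = Some q -> f@_p = 0 \/ g@_r = 0) -> (f * g)@_q = 0.
Proof.
move=> H; rewrite pcoef_mul big1 // => p _; rewrite big1 // => r _.
by case: eqP => // /H[] ->; rewrite ?mul0r ?mulr0.
Qed.

Lemma path_comp_some (p r q : qpath Q) : path_comp p r = Some q ->
  [/\ path_tgt p = path_src r, path_src q = path_src p, path_tgt q = path_tgt r &
    path_arrows q = path_arrows p ++ path_arrows r].
Proof.
have := path_compP p r; case: eqP => [e [w [-> ws wt wa]] [<-]|_ ->] //.
Qed.

Definition plen q := size (path_arrows q).

Lemma plen0 q : plen q = 0%N -> q = trivial_path (path_src q).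
Proof. by move/size0nil => e; apply: qpath_eq. Qed.

(** Membership in a power of the arrow ideal, stated by vanishing coefficients. *)
Definition in_pow l f := forall q, (plen q < l)%N -> f@_q = 0.

Lemma in_powP l f : in_pow l f <-> in_arrow_ideal_pow l f.
Proof.
split=> [fl q|fl q lt].
  by rewrite -mcoeff_neq0 => /eqP fq; rewrite leqNgt; apply/negP => /fl.
apply/eqP/negPn/negP; rewrite mcoeff_neq0 => /fl.
by rewrite leqNgt lt.
Qed.

Lemma in_pow_mul k l f g : in_pow k f -> in_pow l g -> in_pow (k + l) (f * g).
Proof.
move=> fk gl q lt; apply: pcoef_mul0 => p r /path_comp_some[_ _ _ e].
have := lt; rewrite /plen e size_cat -/(plen p) -/(plen r).
by case: (ltnP (plen p) k) => [/fk|le]; [left | right; apply: gl; lia].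
Qed.

Lemma in_pow_exp m f : in_pow 1 f -> in_pow m (f ^+ m).
Proof.
move=> f1; elim: m => [|m IH] //.
by rewrite exprS; apply: (@in_pow_mul 1).
Qed.

(** A trivial path factors only as a product of trivial paths. *)
Lemma pcoef_mul_triv f g x :
  (f * g)@_(trivial_path x) = f@_(trivial_path x) * g@_(trivial_path x).
Proof.
have comp (p r : qpath Q) : path_comp p r == Some (trivial_path x) =
    (p == trivial_path x) && (r == trivial_path x).
  apply/eqP/andP => [/path_comp_some[e1 e2 e3 e4]|[/eqP -> /eqP ->]]; last first.
    by rewrite trivial_comp eqxx.
  have [p0 r0] : plen p = 0%N /\ plen r = 0%N.
    by have := congr1 size (esym e4); rewrite size_cat /=; rewrite /plen; lia.
  have ep : p = trivial_path x by rewrite (plen0 p0); congr trivial_path; rewrite -e2.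
  split; first by rewrite ep.
  by apply/eqP; rewrite (plen0 r0) -e1 ep.
have coefE h : h@_(trivial_path x) =
    \sum_(p <- msupp h) h@_p * (p == trivial_path x)%:R.
  rewrite {1}(pathalg_sum h) pcoef_sum; apply: eq_bigr => p _.
  by rewrite pcoefZ path_elt_coef.
rewrite pcoef_mul (coefE f) (coefE g) mulr_suml; apply: eq_bigr => p _.
rewrite mulr_sumr; apply: eq_bigr => r _; rewrite comp mulrACA -natrM mulnb.
by rewrite mulr_natr.
Qed.

Lemma path_elt_triv_mul x q : path_elt (trivial_path x) * path_elt q = if path_src q == x then path_elt q else 0.
Proof. by rewrite path_elt_mul trivial_comp; case: ifP. Qed.

Lemma pathalg_oneE : \sum_x path_elt (trivial_path x) = 1 :> pathalg K Q.
Proof. by []. Qed.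

Lemma apath_subproof (a : arrow Q) : is_path (src a) [:: a].
Proof. by rewrite /= eqxx. Qed.

Definition apath (a : arrow Q) : qpath Q := Sub (src a, [:: a]) (apath_subproof a).

End PathAlgebra.

Section QuiverPresentation.
Variables (K : fieldType) (A : falgType K) (Q : quiver).
Variables (I : {pred pathalg K Q}) (phi : {linear pathalg K Q -> A}).
Hypothesis Iadm : admissible I.
Hypothesis phiM : monoid_morphism phi.
Hypothesis phiS : forall a, exists f, phi f = a.
Hypothesis phiK : forall f, (f \in I) = (phi f == 0).

Let phi1 : phi 1 = 1 := fst phiM.
Let phiMul f g : phi (f * g) = phi f * phi g := snd phiM f g.

Let phi_exp f m : phi (f ^+ m) = phi f ^+ m.
Proof. by elim: m => [|m IH]; rewrite ?phi1 // !exprS phiMul IH. Qed.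

Lemma kernel_low f q : phi f = 0 -> (plen q < 2)%N -> f@_q = 0.
Proof.
move=> /eqP; rewrite -phiK => fI; have [_ I2 _] := Iadm.
by have /in_powP := I2 f fI; apply.
Qed.

Lemma nilpotent_radical : exists2 m, (0 < m)%N & forall f, in_pow m f -> phi f = 0.
Proof.
have [_ _ [m m2 mI]] := Iadm; exists m; first exact: leq_trans m2.
by move=> f /in_powP/mI; rewrite phiK => /eqP.
Qed.

Lemma radical_idempotent f : in_pow 1 f -> phi f * phi f = phi f -> phi f = 0.
Proof.
move=> f1 ff; have [m m0 mP] := nilpotent_radical.
have := mP _ (in_pow_exp (m := m) f1); rewrite phi_exp.
suff -> : phi f ^+ m = phi f by [].
by case: m m0 {mP} => // m _; elim: m => // m IH; rewrite exprS IH.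
Qed.

Definition vtx x : A := phi (path_elt K (trivial_path x)).

Lemma vtx_idem x : vtx x * vtx x = vtx x.
Proof. by rewrite /vtx -phiMul path_elt_triv_mul eqxx. Qed.

Lemma vtx_neq0 x : vtx x != 0.
Proof.
apply/eqP => /(@kernel_low _ (trivial_path x)) /(_ isT) /eqP.
by rewrite path_elt_coef eqxx oner_eq0.
Qed.

(** The corner at a vertex is spanned by its trivial path and nilpotent elements:
    the coefficient of an idempotent at the trivial path is 0 or 1, and one of
    [t], [vtx x - t] is nilpotent. *)
Lemma vtx_primitive x (t : A) : vtx x * t = t -> t * vtx x = t -> t * t = t ->
  t = 0 \/ t = vtx x.
Proof.
move=> et te tt; have [f0 f0E] := phiS t.
have [e [ev e_coef ee]] : exists e : pathalg K Q, [/\ phi e = vtx x,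
    forall q, e@_q = (trivial_path x == q)%:R & e * e = e].
  exists (path_elt K (trivial_path x)); split=> //; first exact: path_elt_coef.
  by rewrite path_elt_triv_mul eqxx.
have [f [ft fe]] : exists f, phi f = t /\ f = e * (f * e).
  exists (e * (f0 * e)); split; last exact: corner_idem.
  by rewrite !phiMul f0E ev te et.
have low g : g = e * (g * e) -> g@_(trivial_path x) = 0 -> in_pow 1 g.
  move=> ge g0 q; rewrite ltnS leqn0 => /eqP /plen0 ->; set y := path_src q.
  case: (eqVneq y x) => [->//|ne]; rewrite ge pcoef_mul_triv e_coef.
  have -> : (trivial_path x == trivial_path y) = false.
    by apply/negbTE; apply: contra ne => /eqP /(congr1 (@path_src Q)) e0; apply/eqP; exact: esym e0.
  by rewrite mul0r.
have c2 : f@_(trivial_path x) * f@_(trivial_path x) = f@_(trivial_path x).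
  apply/eqP; rewrite -subr_eq0 -pcoef_mul_triv -pcoefB; apply/eqP.
  have z : phi (f * f - f) = 0.
    by rewrite (linearB phi (f * f) f) phiMul ft tt subrr.
  exact: (@kernel_low _ (trivial_path x) z).
have [c0|c1] : f@_(trivial_path x) = 0 \/ f@_(trivial_path x) = 1.
  move/eqP: c2; rewrite -subr_eq0 -{3}[f@__]mulr1 -mulrBr mulf_eq0 => /orP[/eqP|].
    by left.
  by rewrite subr_eq0 => /eqP; right.
- by left; rewrite -ft; apply: radical_idempotent; [apply: low | rewrite ft].
right; apply/eqP; rewrite eq_sym -subr_eq0; apply/eqP.
have eft : phi (e - f) = vtx x - t by rewrite (linearB phi) ev ft.
rewrite -eft; apply: radical_idempotent.
  apply: low; first exact: corner_compl ee fe.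
  by rewrite pcoefB e_coef eqxx c1 subrr.
by rewrite eft mulrBl !mulrBr vtx_idem et te tt subrr subr0.
Qed.

Definition arr (a : arrow Q) : A := phi (path_elt K (apath a)).

Lemma arr_src a : vtx (src a) * arr a = arr a.
Proof. by rewrite /vtx /arr -phiMul path_elt_triv_mul eqxx. Qed.

Lemma arr_tgt a : arr a * vtx (tgt a) = arr a.
Proof. by rewrite /vtx /arr -phiMul path_elt_mul comp_trivial eqxx. Qed.

(** Elements of the kernel have coefficient 0 at arrows, whereas the difference of
    [a] and the product has coefficient 1 at [a]. *)
Lemma arrow_not_multiple a (f g : pathalg K Q) :
  (forall p r : qpath Q, path_comp p r = Some (apath a) ->
     f@_p = 0 \/ g@_r = 0) -> arr a <> phi f * phi g.
Proof.
move=> H e; have : phi (path_elt K (apath a) - f * g) = 0.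
  by rewrite linearB phiMul -/(arr a) e subrr.
move/(@kernel_low _ (apath a)) => /(_ isT); rewrite pcoefB path_elt_coef eqxx pcoef_mul0 //.
by move/eqP; rewrite subr0 oner_eq0.
Qed.

Hypothesis Anak : nakayama A.

(** The submodules generated by two arrows leaving a vertex are comparable in the
    uniserial projective there. *)
Lemma out_arrow_uniq (a a' : arrow Q) : src a = src a' -> a = a'.
Proof.
move=> ss; apply/eqP/negPn/negP => ne.
have idem : (vtx (src a) : A^c) * vtx (src a) = vtx (src a) := vtx_idem (src a).
have prim (t : A^c) : (vtx (src a) : A^c) * t = t -> t * vtx (src a) = t -> t * t = t ->
  t = 0 \/ t = vtx (src a) by move=> h1 h2; apply: (vtx_primitive (t := t)).
have Pi := idem_indecomposable idem (vtx_neq0 (src a)) prim.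
have Pp := idem_projective idem.
have uni := (proj2 Anak) _ Pi Pp.
pose S c : {pred pid_module (vtx (src a) : A^c)} :=
  [pred u | `[< exists t : A, (val u : A) = arr c * t >]].
have Sc c : submod_closed (S c).
  apply: asbool_submod; first by exists 0; rewrite mulr0.
  move=> r u v [t tE] [t' tE']; exists (t * (r : A) + t').
  by rewrite mulrDr mulrA -tE -tE'.
have at_src c : src c = src a -> vtx (src a) * arr c = arr c.
  by move=> <-; exact: arr_src.
have inS c : src c = src a -> pid_mk (vtx (src a) : A^c) (arr c) \in S c.
  by move=> sc; apply/mem_asbool; exists 1; rewrite mulr1; exact: at_src.
have nosub c c' : src c = src a -> c != c' -> ~ {subset S c <= S c'}.
  move=> sc ncc /(_ _ (inS c sc))/mem_asbool[t].
  have [g <-] := phiS t.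
  have -> : (val (pid_mk (vtx (src a) : A^c) (arr c)) : A) = arr c.
    exact: at_src.
  apply: arrow_not_multiple => p r /path_comp_some[_ _ _ /= e].
  left; rewrite path_elt_coef; case: eqP => // ep; rewrite -ep /= in e.
  by case: e => e; rewrite e eqxx in ncc.
have [/nosub|/nosub] := uni (S a) (S a') (Sc a) (Sc a'); apply=> //.
by rewrite eq_sym.
Qed.

(** The left modules generated by two arrows entering a vertex are comparable. *)
Lemma in_arrow_uniq (a a' : arrow Q) : tgt a = tgt a' -> a = a'.
Proof.
move=> ss; apply/eqP/negPn/negP => ne.
have idem := vtx_idem (tgt a).
have Pi := idem_indecomposable idem (vtx_neq0 (tgt a)) (@vtx_primitive (tgt a)).
have Pp := idem_projective idem.
have uni := (proj1 Anak) _ Pi Pp.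
pose S c : {pred pid_module (vtx (tgt a))} :=
  [pred u | `[< exists t : A, (val u : A) = t * arr c >]].
have Sc c : submod_closed (S c).
  apply: asbool_submod; first by exists 0; rewrite mul0r.
  move=> r u v [t tE] [t' tE']; exists ((r : A) * t + t').
  by rewrite mulrDl -mulrA -tE -tE'.
have at_tgt c : tgt c = tgt a -> arr c * vtx (tgt a) = arr c.
  by move=> <-; exact: arr_tgt.
have inS c : tgt c = tgt a -> pid_mk (vtx (tgt a)) (arr c) \in S c.
  by move=> sc; apply/mem_asbool; exists 1; rewrite mul1r; exact: at_tgt.
have nosub c c' : tgt c = tgt a -> c != c' -> ~ {subset S c <= S c'}.
  move=> sc ncc /(_ _ (inS c sc))/mem_asbool[t].
  have [g <-] := phiS t; have -> : (val (pid_mk (vtx (tgt a)) (arr c)) : A) = arr c.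
    exact: at_tgt.
  apply: arrow_not_multiple => p r /path_comp_some[_ _ _ /= e].
  right; rewrite path_elt_coef; case: eqP => // ep; rewrite -ep /= in e.
  have := congr1 (last c') e; rewrite last_cat /= => e'.
  by rewrite e' eqxx in ncc.
have [/nosub|/nosub] := uni (S a) (S a') (Sc a) (Sc a'); apply=> //.
by rewrite eq_sym.
Qed.

Section PathBasis.
Variable s : {perm vertex Q}.
Hypothesis sE : forall a, s (src a) = tgt a.

(** There is at most one arrow in the sum; if there is none, all longer products
    vanish with it. *)
Definition out_arrows x : pathalg K Q := \sum_(a | src a == x) path_elt K (apath a).

Fixpoint long_path x k : pathalg K Q :=
  if k is k'.+1 then out_arrows x * long_path (s x) k' else path_elt K (trivial_path x).

Lemma triv_out x y : path_elt K (trivial_path x) * out_arrows y =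
  if y == x then out_arrows y else 0.
Proof.
rewrite /out_arrows mulr_sumr; case: eqP => [->|ne].
  by apply: eq_bigr => a /eqP sa; rewrite path_elt_triv_mul -[path_src _]/(src a) sa eqxx.
by apply: big1 => a /eqP sa; rewrite path_elt_triv_mul -[path_src _]/(src a) sa; case: eqP.
Qed.

Lemma long_path_mul x k y l : long_path x k * long_path y l =
  if y == iter k s x then long_path x (k + l) else 0.
Proof.
elim: k x => [|k IH] x; last first.
  by rewrite /= -mulrA IH -iterSr; case: ifP => // _; rewrite mulr0.
case: l => [|l] /=; last first.
  by rewrite mulrA triv_out; case: eqP => [->|_]; rewrite ?mul0r.
by rewrite path_elt_triv_mul eq_sym [x == y]eq_sym; case: eqP => [->|].
Qed.

Lemma long_path_pow x k : in_pow k (long_path x k).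
Proof.
elim: k x => [|k IH] x //=; apply: (@in_pow_mul _ _ 1) => // q.
rewrite ltnS leqn0 => /eqP/plen0 ->; rewrite pcoef_sum big1 // => a _.
by rewrite path_elt_coef; case: eqP => // /(congr1 (@plen Q)).
Qed.

Lemma out_arrowsE a : out_arrows (src a) = path_elt K (apath a).
Proof.
rewrite /out_arrows (big_pred1 a) // => a'; apply/eqP/eqP => [|-> //].
exact: out_arrow_uniq.
Qed.

Lemma path_long q : path_elt K q = long_path (path_src q) (plen q).
Proof.
case: q => [[x t] tP]; rewrite /plen /path_src /path_arrows /=.
elim: t x tP => [|a t IH] x tP /=; first by congr path_elt; apply: val_inj.
have [sa tP'] : src a = x /\ is_path (tgt a) t by move: (tP) => /= /andP[/eqP].
have -> : out_arrows x = path_elt K (apath a) by rewrite -sa out_arrowsE.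
have -> : s x = tgt a by rewrite -sa sE.
rewrite -(IH _ tP') path_elt_mul; have := path_compP (apath a) (Sub (tgt a, t) tP').
rewrite {1}/path_tgt /= eqxx => -[r [-> rs _ ra]]; congr path_elt.
by apply: qpath_eq; rewrite ?rs ?ra.
Qed.

Lemma quiver_path_basis : inhabited (path_basis A).
Proof.
have [m m0 mP] := nilpotent_radical.
pose b x k := phi (long_path x k).
have bM x k y l : b x k * b y l = if y == iter k s x then b x (k + l)%N else 0.
  by rewrite /b -phiMul long_path_mul; case: ifP => // _; rewrite linear0.
have bex x : exists k, b x k == 0 by exists m; rewrite /b mP //; apply: long_path_pow.
pose len x := ex_minn (bex x).
have b0 x k : (b x k == 0) = (len x <= k)%N.
  rewrite /len; case: ex_minnP => d db dmin; apply/idP/idP; first exact: dmin.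
  move=> le; have := bM x d (iter d s x) (k - d)%N; rewrite eqxx subnKC // => <-.
  by rewrite (eqP db) mul0r.
constructor; apply: (@PathBasis K A (vertex Q) s len b m) => //.
- by rewrite -linear_sum /= pathalg_oneE.
- by move=> x; rewrite ltnNge -b0; exact: vtx_neq0.
- by move=> x; rewrite -b0 /b mP //; apply: long_path_pow.
move=> a; have [f <-] := phiS a.
exists (fun x k => \sum_(q <- msupp f | (path_src q == x) && (plen q == k)) f@_q).
rewrite [in LHS](pathalg_sum f) linear_sum /=.
under [RHS]eq_bigr do under eq_bigr do rewrite scaler_suml big_mkcond.
under [RHS]eq_bigr do rewrite exchange_big.
rewrite [RHS]exchange_big; apply: eq_bigr => q _; rewrite linearZ path_long /=.
rewrite (bigD1 (path_src q)) //= [X in _ + X]big1 ?addr0 => [|x ne]; last first.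
  by apply: big1 => k _; rewrite eq_sym (negPf ne).
case: (ltnP (plen q) m) => [lt|ge].
  rewrite (bigD1 (Ordinal lt)) //= !eqxx [X in _ + X]big1 ?addr0 // => k ne.
  case: eqP => // e; case/eqP: ne; apply: val_inj; exact: esym e.
rewrite big1 => [|k _].
  by rewrite mP ?scaler0 // => r lt; apply: long_path_pow; apply: leq_trans lt ge.
case: (plen q =P k) => [e|_]; last by rewrite andbF.
by have := ltn_ord k; rewrite -e ltnNge ge.
Qed.

End PathBasis.

Lemma nakayama_path_basis : inhabited (path_basis A).
Proof.
have [s sE] := perm_extension (f := @src Q) (g := @tgt Q) out_arrow_uniq in_arrow_uniq.
exact: quiver_path_basis sE.
Qed.

End QuiverPresentation.

Local Opaque pathalg_mul pathalg_basis.

Section PathAlgebraScaling.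
Variables (K : fieldType) (Q : quiver).
Implicit Types (f g h : pathalg K Q).

Lemma pathalg_basis_scale c d (o : option (qpath Q)) :
  c *: (pathalg_basis d o : pathalg K Q) = pathalg_basis (c * d) o.
Proof.
apply: pcoef_eq => q; apply: etrans (pcoefZ c (pathalg_basis d o) q) _.
apply: etrans (congr1 ( *%R c) (pcoef_basis d o q)) _.
apply: etrans (esym (pcoef_basis (c * d) o q)).
exact: mulrnAr.
Qed.

Lemma pathalg_scaleAl c f g : c *: (f * g) = (c *: f) * g.
Proof.
rewrite [RHS]pathalg_mulE.
rewrite (pathalg_mulw (msuppZ_le c f) (fsubset_refl (msupp g))).
rewrite [in LHS]pathalg_mulE.
rewrite (pathalg_mulw (fsubset_refl (msupp f)) (fsubset_refl (msupp g))).
rewrite scaler_sumr; apply: eq_bigr => p _.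
rewrite scaler_sumr; apply: eq_bigr => q _.
by rewrite (pcoefZ c f p) -mulrA; exact: pathalg_basis_scale.
Qed.

Lemma pathalg_scaleAr c f g : c *: (f * g) = f * (c *: g).
Proof.
rewrite [RHS]pathalg_mulE.
rewrite (pathalg_mulw (fsubset_refl (msupp f)) (msuppZ_le c g)).
rewrite [in LHS]pathalg_mulE.
rewrite (pathalg_mulw (fsubset_refl (msupp f)) (fsubset_refl (msupp g))).
rewrite scaler_sumr; apply: eq_bigr => p _.
rewrite scaler_sumr; apply: eq_bigr => q _.
by rewrite (pcoefZ c g q) mulrCA; exact: pathalg_basis_scale.
Qed.

Lemma pcoef_one y : (1 : pathalg K Q)@_(trivial_path y) = 1.
Proof.
have e x : (path_elt K (trivial_path x))@_(trivial_path y) = (x == y)%:R.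
  rewrite path_elt_coef; congr (nat_of_bool _)%:R.
  by apply/eqP/eqP => [/(congr1 (@path_src Q))|->].
rewrite -pathalg_oneE pcoef_sum (eq_bigr _ (fun x _ => e x)) (bigD1 y) // eqxx.
by rewrite big1 => [|x /negPf ->]; [exact: addr0 | ].
Qed.

End PathAlgebraScaling.

(** * The extremal algebra *)

(** There are [N+2] vertices, so that their number is at least 2. *)

Section Cycle.
Variable N : nat.
Notation n := N.+2.

Definition cyclic_quiver : quiver := @Quiver 'I_n 'I_n id (@ordS n).

Definition cycle_len (x : 'I_n) : nat := if x == ord0 then n else n.+1.

Lemma cycle_len_gt1 x : (1 < cycle_len x)%N.
Proof. by rewrite /cycle_len; case: ifP. Qed.

Lemma cycle_len_le x : (cycle_len x <= n.+1)%N.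
Proof. by rewrite /cycle_len; case: ifP. Qed.

Lemma cycle_len_next x k : (cycle_len x <= cycle_len (iter k (@ordS n) x) + k)%N.
Proof.
case: k => [|k]; first by rewrite addn0.
by apply: leq_trans (cycle_len_le x) _; rewrite /cycle_len; case: ifP => _; lia.
Qed.

Lemma iter_ordS k (x : 'I_n) : iter k (@ordS n) x = ((x + k) %% n)%N :> nat.
Proof.
elim: k => [|k IH]; first by rewrite addn0 modn_small.
by rewrite iterS /= IH -addn1 modnDml addn1 addnS.
Qed.

Lemma cpath_subproof (x : 'I_n) k : is_path (Q := cyclic_quiver) x (traject (@ordS n) x k).
Proof. by elim: k x => //= k IH x; rewrite eqxx IH. Qed.

Definition cpath (x : 'I_n) k : qpath cyclic_quiver :=
  Sub (x, traject (@ordS n) x k) (cpath_subproof x k).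

Lemma cpath_src x k : path_src (cpath x k) = x. Proof. by []. Qed.

Lemma cpath_len x k : plen (cpath x k) = k.
Proof. exact: size_traject. Qed.

Lemma cpathE (q : qpath cyclic_quiver) : q = cpath (path_src q) (plen q).
Proof.
case: q => [[x t] tP]; apply: val_inj; rewrite /= /plen /path_src /path_arrows /=.
congr pair; elim: t x tP => //= a t IH x /andP[/eqP ax tP].
by rewrite -ax; congr cons; exact: IH.
Qed.

Lemma cpath_tgt x k : path_tgt (cpath x k) = iter k (@ordS n) x.
Proof.
rewrite /path_tgt /path_src /path_arrows /=.
by elim: k x => //= k IH x; rewrite IH -iterSr.
Qed.

Lemma cpath_comp x k y l : path_comp (cpath x k) (cpath y l) =
  if y == iter k (@ordS n) x then Some (cpath x (k + l)%N) else None.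
Proof.
have := path_compP (cpath x k) (cpath y l); rewrite cpath_tgt eq_sym cpath_src.
case: eqP => [e [r [-> rs _ ra]]|//]; congr Some; rewrite (cpathE r) rs; congr cpath.
by rewrite /plen ra size_cat -/(plen (cpath x k)) -/(plen (cpath y l)) !cpath_len.
Qed.

Lemma cpath_inj x k y l : (cpath x k == cpath y l) = (x == y) && (k == l).
Proof.
apply/eqP/andP => [e|[/eqP -> /eqP ->] //].
by rewrite -(cpath_len x k) e cpath_len -[x in x == _](cpath_src x k) e.
Qed.

Definition survives (q : qpath cyclic_quiver) := (plen q < cycle_len (path_src q))%N.

(** The paths that do not survive span an ideal. *)
Lemma survives_comp p r q : path_comp p r = Some q -> survives q -> survives p /\ survives r.
Proof.
rewrite (cpathE p) (cpathE r) cpath_comp; case: eqP => // e [<-].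
rewrite /survives !cpath_len !cpath_src e; have := cycle_len_next (path_src p) (plen p).
by split; lia.
Qed.

Definition cindex : finType := {t : 'I_n * 'I_n.+1 | (t.2 < cycle_len t.1)%N}.

Definition cindex_path (t : cindex) := cpath (val t).1 (val t).2.

Lemma cindex_path_inj : injective cindex_path.
Proof.
move=> t t' /eqP; rewrite cpath_inj => /andP[/eqP e1 /eqP e2].
by apply: val_inj; case: (val t) (val t') e1 e2 => [x k] [y l] /= -> /val_inj ->.
Qed.

Lemma cindex_survives t : survives (cindex_path t).
Proof. by rewrite /survives cpath_len; exact: (valP t). Qed.

Lemma survives_cindex q : survives q -> exists t, q = cindex_path t.
Proof.
move=> sq; have lt : (plen q < n.+1)%N by apply: leq_trans (cycle_len_le (path_src q)).
have P : ((path_src q, Ordinal lt).2 < cycle_len (path_src q, Ordinal lt).1)%N by [].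
by exists (Sub (path_src q, Ordinal lt) P); rewrite {1}(cpathE q).
Qed.

Section Algebra.
Variable K : fieldType.
Notation KQ := (pathalg K cyclic_quiver).

(** The quotient of the path algebra by the paths that do not survive, carried
    by the functions on the surviving paths. *)
Definition cycle_alg : Type := {ffun cindex -> K^o}.
HB.instance Definition _ := Vector.on cycle_alg.

Definition cproj (f : KQ) : cycle_alg := [ffun t => (f@_(cindex_path t) : K^o)].

Definition clift (u : cycle_alg) : KQ := \sum_t (u t : K) *: path_elt K (cindex_path t).

Lemma cproj_linear : linear cproj.
Proof. by move=> c f g; apply/ffunP => t; rewrite !ffunE pcoefD pcoefZ. Qed.

Lemma clift_coef u t : (clift u)@_(cindex_path t) = u t.
Proof.
have e t' : ((u t' : K) *: path_elt K (cindex_path t'))@_(cindex_path t) = (u t' : K) * (t' == t)%:R.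
  by rewrite pcoefZ path_elt_coef (inj_eq cindex_path_inj).
rewrite /clift pcoef_sum (eq_bigr _ (fun t' _ => e t')) (bigD1 t) // eqxx mulr1.
by rewrite big1 => [|t' /negPf ->]; [exact: addr0 | rewrite mulr0].
Qed.

Lemma cliftK u : cproj (clift u) = u.
Proof. by apply/ffunP => t; rewrite ffunE clift_coef. Qed.

Lemma clift_linear : linear clift.
Proof.
move=> c u v; rewrite /clift scaler_sumr -big_split /=; apply: eq_bigr => t _.
by rewrite !ffunE scalerDl scalerA.
Qed.

HB.instance Definition _ := GRing.isLinear.Build K KQ cycle_alg *:%R cproj cproj_linear.
HB.instance Definition _ := GRing.isLinear.Build K cycle_alg KQ *:%R clift clift_linear.

Lemma cproj0 : cproj 0 = 0. Proof. exact: linear0. Qed.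
Lemma cprojB f g : cproj (f - g) = cproj f - cproj g. Proof. exact: linearB. Qed.
Lemma cprojD f g : cproj (f + g) = cproj f + cproj g. Proof. exact: linearD. Qed.
Lemma cprojZ c f : cproj (c *: f) = c *: cproj f. Proof. exact: linearZ. Qed.
Lemma cliftD u v : clift (u + v) = clift u + clift v. Proof. exact: linearD. Qed.
Lemma cliftZ c u : clift (c *: u) = c *: clift u. Proof. exact: linearZ. Qed.

Definition cmul (u v : cycle_alg) : cycle_alg := cproj (clift u * clift v).

Lemma cproj_eq0 f : cproj f = 0 <-> forall q, survives q -> f@_q = 0.
Proof.
split=> [/ffunP e q /survives_cindex[t ->]|e].
  by have := e t; rewrite !ffunE.
by apply/ffunP => t; rewrite !ffunE e //; apply: cindex_survives.
Qed.

Lemma cproj_mul0 f g : cproj f = 0 \/ cproj g = 0 -> cproj (f * g) = 0.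
Proof.
move=> fg0; apply/cproj_eq0 => q sq; apply: pcoef_mul0 => p r /survives_comp/(_ sq)[sp sr].
by case: fg0 => /cproj_eq0 e; [left|right]; apply: e.
Qed.

(** The product may be computed after truncating both factors, since what is cut
    off spans an ideal; hence the ring laws are inherited from the
    path algebra. *)
Lemma cprojM f g : cproj (f * g) = cmul (cproj f) (cproj g).
Proof.
have d h : cproj (h - clift (cproj h)) = 0 by rewrite cprojB cliftK subrr.
have step1 : cproj (f * g) = cproj (clift (cproj f) * g).
  apply/eqP; rewrite -subr_eq0 -cprojB -mulrBl; apply/eqP.
  by apply: cproj_mul0; left.
rewrite step1; apply/eqP; rewrite -subr_eq0 -cprojB -mulrBr; apply/eqP.
by apply: cproj_mul0; right.
Qed.

Definition cone : cycle_alg := cproj 1.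

Lemma cmulA : associative cmul.
Proof.
move=> u v w; transitivity (cproj (clift u * (clift v * clift w))).
  by rewrite [RHS]cprojM cliftK.
by rewrite mulrA [LHS]cprojM cliftK.
Qed.

Lemma cmul1l : left_id cone cmul.
Proof. by move=> u; rewrite -{1}[u]cliftK -cprojM mul1r cliftK. Qed.

Lemma cmul1r : right_id cone cmul.
Proof. by move=> u; rewrite -{1}[u]cliftK -cprojM mulr1 cliftK. Qed.

Lemma cmulDl : left_distributive cmul +%R.
Proof. by move=> u v w; rewrite /cmul cliftD mulrDl cprojD. Qed.

Lemma cmulDr : right_distributive cmul +%R.
Proof. by move=> u v w; rewrite /cmul cliftD mulrDr cprojD. Qed.

Lemma cone_neq0 : cone != 0.
Proof.
apply/eqP => /cproj_eq0 /(_ (cpath ord0 0)); rewrite /survives cpath_len.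
have -> : cpath ord0 0 = trivial_path (ord0 : vertex cyclic_quiver) by exact: val_inj.
by move=> /(_ isT) /eqP; rewrite pcoef_one oner_eq0.
Qed.

HB.instance Definition _ := GRing.Zmodule_isNzRing.Build cycle_alg
  cmulA cmul1l cmul1r cmulDl cmulDr cone_neq0.

Lemma cscaleAl c (u v : cycle_alg) : c *: (u * v) = (c *: u) * v.
Proof.
have e : c *: cmul u v = cmul (c *: u) v.
  by rewrite /cmul cliftZ -pathalg_scaleAl cprojZ.
exact: e.
Qed.

Lemma cscaleAr c (u v : cycle_alg) : c *: (u * v) = u * (c *: v).
Proof.
have e : c *: cmul u v = cmul u (c *: v).
  by rewrite /cmul cliftZ -pathalg_scaleAr cprojZ.
exact: e.
Qed.

HB.instance Definition _ := GRing.Lmodule_isLalgebra.Build K cycle_alg cscaleAl.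
HB.instance Definition _ := GRing.Lalgebra_isAlgebra.Build K cycle_alg cscaleAr.
HB.instance Definition _ := Algebra_isFalgebra.Build K cycle_alg.

Lemma cproj_monoid : monoid_morphism cproj.
Proof. split; [exact: erefl | exact: cprojM]. Qed.

Lemma cycle_alg_bound_quiver : bound_quiver_algebra cycle_alg.
Proof.
pose I : {pred KQ} := fun f => cproj f == 0.
have IP f : (f \in I) = (cproj f == 0) by [].
exists cyclic_quiver, I, cproj; split.
- split.
  + split; first split.
    * by rewrite IP cproj0.
    * by move=> c f g; rewrite !IP => /eqP f0 /eqP g0; rewrite cprojD cprojZ f0 g0 scaler0 addr0.
    move=> f g h; rewrite !IP => /eqP g0; apply/eqP.
    by apply: cproj_mul0; left; apply: cproj_mul0; right.
  + move=> f; rewrite IP => /eqP/cproj_eq0 f0; apply/in_powP => q lt.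
    by apply: f0; apply: leq_trans lt (cycle_len_gt1 _).
  exists n.+1; first by [].
  move=> f /in_powP fn; rewrite IP; apply/eqP/cproj_eq0 => q sq.
  by apply: fn; apply: leq_trans sq (cycle_len_le _).
- exact: cproj_monoid.
- by move=> u; exists (clift u); exact: cliftK.
- exact: IP.
Qed.

Definition cnext : {perm 'I_n} := perm (@ordS_inj n).

Lemma iter_cnext k x : iter k cnext x = iter k (@ordS n) x.
Proof. by elim: k => //= k ->; rewrite permE. Qed.

Definition cbasis x k : cycle_alg := cproj (path_elt K (cpath x k)).

Lemma cbasis_val x k t : cbasis x k t = (cpath x k == cindex_path t)%:R.
Proof. by rewrite ffunE path_elt_coef. Qed.

Lemma cycle_alg_sum (J : finType) (F : J -> cycle_alg) t :
  ((\sum_j F j) t : K) = \sum_j (F j t : K).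
Proof.
apply: (big_morph (fun u : cycle_alg => (u t : K))); last by rewrite ffunE.
by move=> u v; rewrite ffunE.
Qed.

Definition cycle_basis : path_basis cycle_alg.
Proof.
apply: (@PathBasis K cycle_alg 'I_n cnext cycle_len cbasis n.+1).
- move=> x k y l; rewrite iter_cnext; have := cprojM (path_elt K (cpath x k)) (path_elt K (cpath y l)).
  rewrite path_elt_mul cpath_comp; case: eqP => _ /= e; first exact: esym e.
  by rewrite cproj0 in e; exact: esym e.
- move=> x k; apply/eqP/idP => [/cproj_eq0 e|le].
    rewrite leqNgt; apply/negP => lt; have := e (cpath x k).
    by rewrite /survives cpath_len => /(_ lt) /eqP; rewrite path_elt_coef eqxx oner_eq0.
  apply/cproj_eq0 => q; rewrite /survives path_elt_coef; case: eqP => // <-.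
  by rewrite cpath_len ltnNge le.
- rewrite -linear_sum; have -> : \sum_x path_elt K (cpath x 0) = 1 :> KQ; last by [].
  rewrite -pathalg_oneE; apply: eq_bigr => x _; congr path_elt; exact: val_inj.
- by move=> x; apply: ltnW; apply: cycle_len_gt1.
- exact: cycle_len_le.
move=> u; have [F FE] : exists F : 'I_n -> nat -> K,
      forall t : cindex, F (val t).1 (val t).2 = u t.
  by exists (fun x k => (clift u)@_(cpath x k)) => t; exact: clift_coef.
exists F; apply/ffunP => t; rewrite -FE.
have e x (k : 'I_n.+1) : (F x k *: cbasis x k : cycle_alg) t =
    F x k * ((x == (val t).1) && (k == (val t).2))%:R :> K.
  by rewrite ffunE cbasis_val cpath_inj.
have E : F (val t).1 (val t).2 = \sum_x \sum_(k < n.+1)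
    F x k * ((x == (val t).1) && (k == (val t).2))%:R.
  rewrite (bigD1 (val t).1) // (bigD1 (val t).2) //= !eqxx mulr1.
  rewrite big1 => [|k /negPf ne]; last by rewrite ne andbF mulr0.
  rewrite big1 => [|x /negPf ne]; first by rewrite !addr0.
  by rewrite big1 // => k _; rewrite ne mulr0.
rewrite [LHS]E; apply: etrans (esym (cycle_alg_sum _ t)).
apply: eq_bigr => x _; apply: etrans (esym (cycle_alg_sum _ t)).
by apply: eq_bigr => k _; rewrite e.
Defined.

End Algebra.
End Cycle.

(** * Connectedness *)

Section Idempotents.
Variables (K : fieldType) (R : pzRingType) (kap : {rmorphism K -> R}).
Variable b : nakayama_basis kap.

Notation V := (nb_vertex b).
Notation s := (nb_next b).
Notation len := (nb_len b).
Notation bnd := (nb_bound b).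

Lemma coef_mul (r t : R) (x : V) k : (k < len x)%N -> coef (r * t) x k =
  \sum_(l < bnd | (l <= k)%N) coef t x l * coef r (iter l s x) (k - l).
Proof.
move=> lt; rewrite [in LHS](coefE b t) mulr_sumr coef_sum (bigD1 x) //=.
rewrite [X in _ + X]big1 ?addr0 => [|y ne]; last first.
  rewrite mulr_sumr coef_sum big1 // => l _.
  by rewrite mulrA -(nb_central b) -mulrA coefZ coef_mulR eq_sym (negPf ne) mulr0.
rewrite mulr_sumr coef_sum [RHS]big_mkcond; apply: eq_bigr => l _.
rewrite mulrA -(nb_central b) -mulrA coefZ coef_mulR eqxx lt andbT /=.
by case: ifP => // _; rewrite mulr0.
Qed.

(** Compare coefficients of [r r = r] by increasing length: in every term of the
    product one factor is trivial or both are shorter. *)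
Lemma idempotent_top0 (r : R) : r * r = r -> (forall x : V, coef r x 0 = 0) -> r = 0.
Proof.
move=> rr r0; have rk k (x : V) : coef r x k = 0.
  elim/ltn_ind: k x => k IH x; case: (ltnP k (len x)) => [lt|]; last exact: coef_ge.
  rewrite -[in LHS]rr coef_mul // big1 // => l; rewrite leq_eqVlt => /orP[/eqP e|lt'].
    by rewrite e subnn r0 mulr0.
  by rewrite IH // mul0r.
rewrite (coefE b r) big1 // => x _; rewrite big1 // => k _.
by rewrite rk rmorph0 mul0r.
Qed.

(** Compare the coefficients of the arrow leaving [x]. *)
Lemma central_coef (r : R) (x : V) : (1 < len x)%N -> r * b x 1%N = b x 1%N * r ->
  coef r (s x) 0 = coef r x 0.
Proof.
move=> lt e; have := coef_mulR x 1 r x 1; rewrite e coef_mulL eqxx lt subnn /= ?eqxx.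
by move=> ->.
Qed.

Lemma regular_injective_unextendable :
  injective_module (regular_module R) -> forall x : V, unextendable x.
Proof.
move=> Ri x; apply: injective_unextendable.
have sL := @path_val_linear R (b x 0%N).
have rL : linear (pid_mk (b x 0%N) : R^o -> pideal (b x 0%N)).
  by move=> c u t; apply: val_inj; rewrite /= mulrDl -mulrA.
apply: (@retract_injective _ (pid_module (b x 0%N)) (regular_module R) (mklin sL) (mklin rL)) => //.
by move=> u; apply: val_inj; exact: (pideal_idem (path_idem x) u).
Qed.

Lemma isomorphic_injective (M P : fgModule R) :
  isomorphic M P -> injective_module M -> injective_module P.
Proof. by case/isomorphic_bij => f [g [_ gK]]; apply: retract_injective gK. Qed.

End Idempotents.

(** The coefficients of a central idempotent at trivial paths agree at the two
    ends of each arrow, so they are all 0 or all 1, and the idempotent is 0 or 1. *)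
Lemma path_basis_connected (K : fieldType) (A : falgType K) (p : path_basis A) :
  (forall x y, exists k, y = iter k (pb_next p) x) ->
  (forall x, (1 < pb_len p x)%N) -> connected_algebra A.
Proof.
move=> trans len1 A1 A2 f [f1 fM] [g fK gK].
pose b := right_basis p; pose eps := g (1, 0).
have fe : f eps = (1, 0) by exact: gK.
have ee : eps * eps = eps.
  by apply: (can_inj fK); rewrite fM fe; congr pair; rewrite /= ?mulr1 ?mulr0.
have ec a : eps * a = a * eps.
  apply: (can_inj fK); rewrite !fM fe; case: (f a) => u v.
  by congr pair; rewrite /= ?mulr1 ?mul1r ?mul0r ?mulr0.
pose c x := @coef _ _ _ b (eps : A^c) x 0.
have cs x : c (pb_next p x) = c x.
  by apply: (@central_coef _ _ _ b); [exact: len1 | exact: esym (ec _)].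
have ck k x : c (iter k (pb_next p) x) = c x by elim: k => //= k IH; rewrite cs.
have cc x y : c y = c x by have [k ->] := trans x y; exact: ck.
have [x0 _] : exists x : pb_vertex p, True.
  apply: contrapT => n; have := oner_neq0 A; rewrite -(pb_one p) big1 ?eqxx // => x _.
  by case: n; exists x.
have c2 : c x0 * c x0 = c x0.
  have := @coef_top_mul _ _ _ b (eps : A^c) eps x0.
  by have -> : (eps : A^c) * eps = eps :> A^c by exact: ee.
have [c0|c1] : c x0 = 0 \/ c x0 = 1.
  move/eqP: c2; rewrite -subr_eq0 -{3}[c x0]mulr1 -mulrBr mulf_eq0 => /orP[/eqP|].
    by left.
  by rewrite subr_eq0 => /eqP; right.
- have e0 : eps = 0.
    by apply: (@idempotent_top0 _ _ _ b (eps : A^c)); [exact: ee | move=> x; rewrite -c0; exact: cc].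
  have : f eps = 0 by rewrite e0 linear0.
  by rewrite fe => -[/eqP]; rewrite oner_eq0.
have e1 : 1 - eps = 0.
  apply: (@idempotent_top0 _ _ _ b (1 - eps : A^c)).
    have e : (1 - eps) * (1 - eps) = 1 - eps.
      by rewrite mulrBl mul1r mulrBr mulr1 ee subrr subr0.
    exact: e.
  move=> x; apply: etrans (@coefD _ _ _ b (1 : A^c) (- eps) x 0) _.
  apply: etrans (congr2 +%R (@coef_one _ _ _ b x) (@coefN _ _ _ b (eps : A^c) x 0)) _.
  by rewrite -/(c x) (cc x0) c1 subrr.
have : f (1 - eps) = 0 by rewrite e1 linear0.
rewrite linearB f1 fe => -[_ /eqP]; rewrite subr0.
by rewrite oner_eq0.
Qed.

(** * The extremal algebra attains the bound *)

Section Extremal.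
Variables (K : fieldType) (N : nat).
Notation n := N.+2.
Notation A := (cycle_alg N K).
Let p := cycle_basis N K.
Let b := right_basis p.

Let it k (x : 'I_n) : iter k (nb_next b) x = ((x + k) %% n)%N :> nat.
Proof. by rewrite -iter_ordS -iter_cnext. Qed.

Lemma cycle_unextendable (x : nb_vertex b) : unextendable x = (x != ord0).
Proof.
have lenE y : nb_len b y = cycle_len y by [].
have bk : (((back 1 x : 'I_n) + 1) %% n)%N = (x : 'I_n) :> nat by rewrite -it iter_back.
rewrite /unextendable !lenE /cycle_len; case: (eqVneq x ord0) => [e|ne].
  case: (back 1 x =P ord0) => [e'|_]; last by rewrite ltnn.
  by move: bk; rewrite e' e modn_small.
by case: ifP => _; rewrite ?leqnn ?leqnSn.
Qed.

Lemma cycle_transitive (x y : 'I_n) : exists k, y = iter k (pb_next p) x.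
Proof.
exists (y + (n - x))%N; apply: val_inj; rewrite [RHS](it (y + (n - x)) x) /=.
have -> : (x + (y + (n - x)) = y + n)%N by have := ltn_ord x; lia.
by rewrite modnDr modn_small.
Qed.

Lemma cycle_not_selfinjective : ~ selfinjective A.
Proof.
by move=> /(@regular_injective_unextendable _ _ _ b)/(_ ord0); rewrite cycle_unextendable eqxx.
Qed.

Lemma cycle_nonselfinjective_nakayama : nonselfinjective_nakayama A.
Proof.
split.
- exact: cycle_alg_bound_quiver.
- apply: (@path_basis_connected _ _ p); first exact: cycle_transitive.
  exact: cycle_len_gt1.
- exact: (@path_basis_nakayama _ _ p).
- exact: cycle_not_selfinjective.
Qed.

Lemma cycle_simples : num_simples A n.
Proof. by have := simples_count b; rewrite card_ord. Qed.

Lemma cycle_proj_inj : num_indec_proj_inj A N.+1.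
Proof.
exists (fun i => pid_module (b (lift ord0 i : 'I_n) 0%N)); split.
- move=> i; split; first exact: proj_indecomposable.
    exact: idem_projective (path_idem _).
  by apply: unextendable_injective; rewrite cycle_unextendable eq_sym neq_lift.
- by move=> i j /proj_inj/lift_inj.
move=> M [Mi Mp Minj]; have [x iso] := @projective_cover _ _ _ b M Mi Mp.
have := injective_unextendable (isomorphic_injective iso Minj); rewrite cycle_unextendable.
case: (unliftP ord0 x) => [j ex _|->]; last by rewrite eqxx.
by exists j; rewrite -ex.
Qed.

(** The projective resolution of the simple module at 0: each map is a path
    [b x k], and the kernel of multiplication by it is generated by the path of
    length [len x - k] that starts where it ends. *)
Fixpoint cycle_res (i : nat) : 'I_n * nat :=
  if i is i'.+1 then
    (iter (cycle_res i').2 (nb_next b) (cycle_res i').1, (nb_len b (cycle_res i').1 - (cycle_res i').2)%N)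
  else (ord0, 1%N).

Let res1 i : (cycle_res i.+1).1 = iter (cycle_res i).2 (nb_next b) (cycle_res i).1. Proof. by []. Qed.
Let res2 i : (cycle_res i.+1).2 = (nb_len b (cycle_res i).1 - (cycle_res i).2)%N. Proof. by []. Qed.

(** The maps alternate between the path of length [k+1] from 0 to [k+1] and the
    complementary path back to 0. *)
Lemma cycle_resE k : (k <= N)%N ->
  [/\ (cycle_res (2 * k)).1 = 0%N :> nat, (cycle_res (2 * k)).2 = k.+1,
      (cycle_res (2 * k).+1).1 = k.+1 :> nat & (cycle_res (2 * k).+1).2 = (n - k.+1)%N].
Proof.
have odd_step j : (j <= N)%N -> (cycle_res (2 * j)).1 = 0%N :> nat -> (cycle_res (2 * j)).2 = j.+1 ->
    (cycle_res (2 * j).+1).1 = j.+1 :> nat /\ (cycle_res (2 * j).+1).2 = (n - j.+1)%N.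
  move=> le e1 e2; split; first by rewrite res1 it e1 e2 add0n modn_small.
  rewrite res2 e2; congr (_ - _)%N.
  have -> : (cycle_res (2 * j)).1 = ord0 by exact: val_inj.
  by [].
elim: k => [|k IH] le; first by have [//|//|//|e1 e2] := odd_step 0%N.
have [e1 e2 e3 e4] := IH (ltnW le).
have d : (2 * k.+1 = (2 * k).+2)%N by lia.
have f1 : (cycle_res (2 * k.+1)).1 = 0%N :> nat.
  by rewrite d res1 it e3 e4 subnKC ?modnn //; lia.
have f2 : (cycle_res (2 * k.+1)).2 = k.+2.
  rewrite d res2 e4.
  have -> : nb_len b (cycle_res (2 * k).+1).1 = n.+1.
    have ne : ((cycle_res (2 * k).+1).1 == ord0) = false.
      by apply/negbTE/eqP => e; move: e3; rewrite e.
    by rewrite -[LHS]/(cycle_len _) /cycle_len ne.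
  lia.
by have [f3 f4] := odd_step k.+1 le f1 f2.
Qed.

(** For [i > 0] a path killed by the [i]-th map is long enough to factor through
    the map before it; the only exception, the trivial path at 0, would require
    [i = 2 N + 2]. For [i = 0] no path is killed, as 0 is not a socle. *)
Lemma cycle_exact (I : min_inj_coresolution (regular_module A^c)) i : (i <= 2 * N + 1)%N ->
  @exact_at _ _ _ b (fun i => (cycle_res i).1) (fun i => (cycle_res i).2) (I 0%N)
    (@cosyzygy _ I 0) i.
Proof.
move=> le; apply: path_exact => // x l lt xl ge.
have {}xl : ((x + l) %% n)%N = (cycle_res i).1 by rewrite -xl it.
have lenx : nb_len b x = if x == ord0 then n else n.+1 by [].
have [k [kN [ei|ei]]] : exists k, (k <= N)%N /\ (i = 2 * k \/ i = (2 * k).+1)%N.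
  by exists i./2; have := odd_double_half i; case: (odd i) => /=; rewrite -muln2; lia.
- have [e1 e2 _ _] := cycle_resE kN; rewrite ei e1 in xl; rewrite ei e2 in ge.
  case: k kN ei e1 e2 xl ge => [|k] kN ei e1 e2 xl ge.
    exfalso; rewrite lenx in lt ge; case: (eqVneq x ord0) => [ex|ne].
      rewrite ex eqxx in lt ge xl; move: xl; rewrite add0n modn_small; lia.
    rewrite (negPf ne) in lt ge; have el : l = n by lia.
    move: xl; rewrite el modnDr modn_small // => x0.
    by case/eqP: ne; apply: val_inj.
  have [_ _ _ e4] := cycle_resE (ltnW kN).
  rewrite ei (_ : 2 * k.+1 = (2 * k).+2)%N; last by lia.
  rewrite -[(2 * k).+2.-1]/((2 * k).+1) e4 andTb.
  rewrite lenx in lt ge; case: (eqVneq x ord0) => [ex|ne]; last first.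
    by rewrite (negPf ne) in ge; lia.
  rewrite ex eqxx in lt ge xl; move: xl; rewrite add0n modn_small //; lia.
have [e1 e2 e3 e4] := cycle_resE kN; rewrite ei -[(2 * k).+1.-1]/(2 * k)%N e2 andTb.
rewrite ei e4 in ge; rewrite lenx in ge; move: ge; case: ifP => _; lia.
Qed.

(** All vertices but 0 are socles of unextendable projectives: a projective of
    length [n+1] ends at the vertex where it starts. *)
Lemma cycle_domdim : domdim A = Some (2 * n - 2)%N.
Proof.
have [I Id] := domdim_attained p.
apply: (coresolution_domdim_eq Id).
  apply: (@not_all_projective _ _ _ b I n ord0) => //; last by rewrite cycle_unextendable eqxx.
  by rewrite card_ord.
move=> j lt; apply: (@projective_terms _ _ _ b I ord0 (fun i => (cycle_res i).1)
  (fun i => (cycle_res i).2) (2 * N + 1)) => //; last by lia.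
- by move=> i le; apply: cycle_exact.
move=> v' ne; exists v'; last by rewrite cycle_unextendable.
rewrite /proj_socle; have -> : nb_len b v' = n.+1.
  by rewrite -[LHS]/(cycle_len _) /cycle_len (negPf ne).
by apply: val_inj; rewrite [LHS]it /= modnDr modn_small.
Qed.

End Extremal.

(** * The bound and its optimality *)

Local Close Scope ring_scope.

Theorem proposition3p4 (K : fieldType) (n : nat) (hn : 2 <= n) :
  (forall A : falgType K,
     nonselfinjective_nakayama A -> num_simples A n ->
     le_enat (domdim A) (Some (2 * n - 2))) /\
  (exists A : falgType K,
     [/\ nonselfinjective_nakayama A,
         num_simples A n,
         domdim A = Some (2 * n - 2)
       & num_indec_proj_inj A (n - 1)]).
Proof.
split=> [A [[Q [I [phi [Iadm phiM phiS phiK]]]] _ Anak Anself] An|].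
  have [p] := nakayama_path_basis Iadm phiM phiS phiK Anak.
  pose b := right_basis p.
  have [x nx] := @nonselfinjective_vertex _ _ _ b Anself.
  have cV := @card_vertices _ _ _ b n An.
  have [J Jd] := domdim_attained p.
  apply: (coresolution_domdim_le Jd).
  exact: (@not_all_projective _ _ _ b J n x (ltnW hn) cV nx).
case: n hn => [|[|N]] // _; exists (cycle_alg N K); split.
- exact: cycle_nonselfinjective_nakayama.
- exact: cycle_simples.
- exact: cycle_domdim.
by rewrite subn1; exact: cycle_proj_inj.
Qed.
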